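(* Let $v:\mathbb{R}^n\to\mathbb{R}^n$ be locally Lipschitz with sublinear growth, i.e. there exists $C>0$ such that $|v(x)|\le C(1+|x|)$ for all $x$. Then the Probability Vector Field $V^v[\mu]=\mu\otimes\delta_{v(x)}$ is locally $\mathcal{W}$-Lipschitz, i.e. for every $R>0$ there exists $K=K(R)>0$ such that $\mathcal{W}(V^v[\mu],V^v[\nu])\le K\,W(\mu,\nu)$ whenever $\mathrm{Supp}(\mu),\mathrm{Supp}(\nu)\subset B(0,R)$. Consequently, for every $T>0$, the equation $\dot\mu=V^v[\mu]$ admits a unique Lipschitz semigroup $S:[0,T]\times\mathcal{P}_c(\mathbb{R}^n)\to\mathcal{P}_c(\mathbb{R}^n)$ obtained as limit of Lattice Approximate Solutions.
   Context: $T\mathbb{R}^n=\mathbb{R}^n\times\mathbb{R}^n$ with points $(x,v)$, $\pi_1(x,v)=x$, $\pi_{13}(x,v,y,w)=(x,y)$. $\mathcal{P}(X)$: Borel probability measures; $\mathcal{P}_c(X)$: those with compact support. $P(\mu,\nu)$ is the set of couplings of $\mu,\nu$; $W$ is the 1-Wasserstein metric on $\mathbb{R}^n$ and $P^{opt}(\mu,\nu)$ the set of couplings minimizing $\int|x-y|\,d\tau$. $B(0,R)$ is the ball of radius $R$ centered at $0$. A Probability Vector Field (PVF) is a map $V:\mathcal{P}(\mathbb{R}^n)\to\mathcal{P}(T\mathbb{R}^n)$ with $\pi_1\#V[\mu]=\mu$. Here $\mu\otimes\nu_x$ denotes the measure with $\int\phi\,d(\mu\otimes\nu_x)=\int\int\phi(x,v)\,d\nu_x(v)\,d\mu(x)$,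 so $V^v[\mu]$ is the push-forward of $\mu$ under $x\mapsto(x,v(x))$. For $V_1,V_2\in\mathcal{P}_c(T\mathbb{R}^n)$ with $\mu_i=\pi_1\#V_i$, $$\mathcal{W}(V_1,V_2)=\inf\Big\{\int|v-w|\,dT(x,v,y,w): T\in P(V_1,V_2),\ \pi_{13}\#T\in P^{opt}(\mu_1,\mu_2)\Big\}.$$ Solution: $\mu:[0,T]\to\mathcal{P}(\mathbb{R}^n)$ is a solution to $\dot\mu=V[\mu]$ if for every $f\in C_c^\infty(\mathbb{R}^n)$: $\int_{T\mathbb{R}^n}\nabla f(x)\cdot v\,dV[\mu(s)](x,v)$ is defined for a.e. $s$ and is $L^1$ in $s\in[0,T]$, $t\mapsto\int f\,d\mu(t)$ is absolutely continuous, and for a.e. $t$, $\frac{d}{dt}\int f\,d\mu(t)=\int_{T\mathbb{R}^n}\nabla f(x)\cdot v\,dV[\mu(t)](x,v)$. Lipschitz semigroup for $\dot\mu=V[\mu]$ (where $V$ satisfies $\sup_{(x,v)\in \mathrm{Supp}(V[\mu])}|v|\le C(1+\sup_{x\in \mathrm{Supp}(\mu)}|x|)$ for $\mu\in\mathcal{P}_c(\mathbb{R}^n)$): a map $S:[0,T]\times\mathcal{P}_c(\mathbb{R}^n)\to\mathcal{P}_c(\mathbb{R}^n)$ such that for all $\mu,\nu\in\mathcal{P}_c(\mathbb{R}^n)$ and $t,s\in[0,T]$: (i) $S_0\mu=\mu$ and $S_tS_s\mu=S_{t+s}\mu$ (when $t+s\le T$); (ii) $t\mapsto S_t\mu$ is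 a solution to $\dot\mu=V[\mu]$; (iii) for every $R>0$ there is $C(R)>0$ such that if $\mathrm{Supp}(\mu),\mathrm{Supp}(\nu)\subset B(0,R)$ then $\mathrm{Supp}(S_t\mu)\subset B(0,e^{Ct}(R+1))$, $W(S_t\mu,S_t\nu)\le e^{C(R)t}W(\mu,\nu)$, and $W(S_t\mu,S_s\mu)\le C(R)|t-s|$. Lattice Approximate Solutions (LAS) with initial datum $\mu_0\in\mathcal{P}_c(\mathbb{R}^n)$: for $N\in\mathbb{N}$ let $\Delta_N=1/N$, let $x_i$ be the points of $(\mathbb{Z}^n/N^2)\cap[-N,N]^n$ and $v_j$ the points of $(\mathbb{Z}^n/N)\cap[-N,N]^n$. Set $\mu^N_0=\sum_i\mu_0(x_i+[0,N^{-2})^n)\,\delta_{x_i}$. Recursively, given $\mu^N_\ell$ supported on the points $x_i$, put $m_{ij}=V[\mu^N_\ell](\{(x_i,v): v\in v_j+[0,N^{-1})^n\})$ and, for $t\in[0,\Delta_N]$, $\mu^N(\ell\Delta_N+t)=\sum_{i,j}m_{ij}\,\delta_{x_i+t v_j}$, with $\mu^N_{\ell+1}=\mu^N((\ell+1)\Delta_N)$. This is considered for $N$ large enough that all mass stays within the grids on $[0,T]$. ''Obtained as limit of LASs'' means that each trajectory $t\mapsto S_t\mu_0$ is a limit, uniform on $[0,T]$ for $W$, of (a subsequence of) the LASs with initial datum $\mu_0$. *)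

(* Defs.v *)
From HB Require Import structures.
From mathcomp Require Import all_boot all_order all_algebra.
From mathcomp Require Import all_classical all_reals all_analysis.

Set Implicit Arguments.
Unset Strict Implicit.
Unset Printing Implicit Defensive.

Import Order.TTheory GRing.Theory Num.Theory.
Import numFieldNormedType.Exports.

Local Open Scope classical_set_scope.
Local Open Scope ring_scope.

(** * Euclidean space *)

(* The norm `|x| that the library puts on row vectors is the sup norm; the
   Wasserstein cost and the balls below are Euclidean.  Both norms
   induce the topology of 'rV[R]_n, which is the one used for Borel sets,
   supports and compactness. *)
Definition enorm (R : realType) (n : nat) (x : 'rV[R]_n) : R :=
  Num.sqrt (\sum_(i < n) x 0 i ^+ 2).

Definition eball (R : realType) (n : nat) (c : 'rV[R]_n) (r : R) :
  set 'rV[R]_n := [set x | enorm (x - c) < r].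

Definition dotv (R : realType) (n : nat) (x y : 'rV[R]_n) : R :=
  \sum_(i < n) x 0 i * y 0 i.

Definition locally_lipschitz (R : realType) (n : nat)
    (v : 'rV[R]_n -> 'rV[R]_n) : Prop :=
  forall c, exists2 r : R, 0 < r & exists L : R, forall x y,
    eball c r x -> eball c r y -> enorm (v x - v y) <= L * enorm (x - y).

(** * Borel probability measures *)

HB.instance Definition _ (X Y : ptopologicalType) := Pointed.on (X * Y)%type.

Definition borel (X : ptopologicalType) : Type := g_sigma_algebraType (@open X).
HB.instance Definition _ (X : ptopologicalType) :=
  Measurable.on (borel X).
Notation Prob R X := (probability (borel X) R).

(* All measures live on the sigma-algebra generated by the open sets, for
   product spaces too (it is equal there to the product sigma-algebra, since
   Euclidean spaces are second countable).

   Measures of the library are functions on all sets, constrained on measurable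
   sets only, so that two of them represent the same Borel measure when they
   agree on Borel sets. *)
Definition same_measure (R : realType) (X : ptopologicalType)
    (mu nu : Prob R X) : Prop :=
  forall A : set (borel X), measurable A -> mu A = nu A.

Definition supp (R : realType) (X : ptopologicalType) (mu : Prob R X) :
  set X := [set x | forall U : set X, open_nbhs x U -> (0 < mu U)%E].

Record cprob (R : realType) (X : ptopologicalType) := CProb {
  cprob_val :> Prob R X ;
  cprob_compact : compact (supp cprob_val) }.

Lemma continuous_borel (X Y : ptopologicalType) (f : X -> Y) :
  continuous f -> measurable_fun [set: borel X] (f : borel X -> borel Y).
Proof.
move=> /continuousP cf.
apply: (@measurability _ _ (borel X) (borel Y) [set: X] f (@open Y)) => //.
move=> _ [B oB <-].
by rewrite setTI; apply: sub_sigma_algebra; exact: cf.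
Qed.

Definition push (R : realType) (X Y : ptopologicalType) (f : X -> Y)
    (cf : continuous f) (mu : Prob R X) : Prob R Y :=
  distribution mu (mfun_Sub (mem_set (continuous_borel cf))).

(** * Couplings and Wasserstein distance *)

Definition coupling (R : realType) (X Y : ptopologicalType)
    (mu : Prob R X) (nu : Prob R Y) (tau : Prob R (X * Y)%type) : Prop :=
  (forall A : set (borel X), measurable A -> tau (fst @^-1` A) = mu A) /\
  (forall B : set (borel Y), measurable B -> tau (snd @^-1` B) = nu B).

Section wasserstein.
Context (R : realType) (n : nat).
Local Notation E := 'rV[R]_n.
Local Notation TE := (E * E)%type.
Local Open Scope ereal_scope.

Definition cost (tau : Prob R TE) : \bar R :=
  \int[tau]_p (enorm (p.1 - p.2)%R)%:E.

Definition W (mu nu : Prob R E) : \bar R :=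
  ereal_inf [set cost tau | tau in [set tau | coupling mu nu tau]].

Definition optimal_coupling (mu nu : Prob R E) (tau : Prob R TE) : Prop :=
  coupling mu nu tau /\
  forall tau', coupling mu nu tau' -> cost tau <= cost tau'.

Lemma continuous_pi1 : continuous (fst : TE -> E).
Proof. by move=> p; exact: cvg_fst. Qed.

Definition pi13 (q : (TE * TE)%type) : TE := (q.1.1, q.2.1).

Lemma continuous_pi13 : continuous pi13.
Proof.
move=> q; apply: (@cvg_pair _ _ _ _ (nbhs q.1.1) (nbhs q.2.1)).
- by apply: (@continuous_comp _ _ _ fst fst); exact: cvg_fst.
- by apply: (@continuous_comp _ _ _ snd fst); [exact: cvg_snd|exact: cvg_fst].
Qed.

(* The infimum is + oo when no coupling is admissible. *)
Definition Wtan (V1 V2 : Prob R TE) : \bar R :=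
  ereal_inf
    [set \int[T]_q (enorm (q.1.2 - q.2.2)%R)%:E
    | T in [set T : Prob R (TE * TE)%type | coupling V1 V2 T /\
        optimal_coupling (push continuous_pi1 V1) (push continuous_pi1 V2)
          (push continuous_pi13 T)]].

End wasserstein.

(** * Probability vector fields *)

(* [pvf_ext] says that the map acts on Borel measures, not on their
   representatives, see [same_measure]. *)
Record PVF (R : realType) (n : nat) := MkPVF {
  pvf_fun :> Prob R 'rV[R]_n -> Prob R ('rV[R]_n * 'rV[R]_n)%type ;
  pvf_proj : forall mu,
    same_measure (push (@continuous_pi1 R n) (pvf_fun mu)) mu ;
  pvf_ext : forall mu nu,
    same_measure mu nu -> same_measure (pvf_fun mu) (pvf_fun nu) }.

Definition pvf_sublinear (R : realType) (n : nat) (V : PVF R n) (C : R) : Prop :=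
  forall mu : cprob R 'rV[R]_n,
    (ereal_sup [set (enorm p.2)%:E | p in supp (V mu)] <=
     C%:E * (1 + ereal_sup [set (enorm x)%:E | x in supp mu]))%E.

Definition locally_W_lipschitz (R : realType) (n : nat) (V : PVF R n) : Prop :=
  forall r : R, 0 < r -> exists2 K : R, 0 < K &
    forall mu nu : Prob R 'rV[R]_n,
      supp mu `<=` eball 0 r -> supp nu `<=` eball 0 r ->
      (Wtan (V mu) (V nu) <= K%:E * W mu nu)%E.

Section vector_field.
Context (R : realType) (n : nat).
Local Notation E := 'rV[R]_n.

Lemma continuous_enorm : continuous (@enorm R n).
Proof.
move=> x; apply: continuous_comp; last exact: sqrt_continuous.
apply: (@cvg_big _ _ +%R 0 xpredT add_continuous _ (nbhs x) _
  (fun i (y : E) => y 0 i ^+ 2) (fun i => x 0 i ^+ 2)) => i _.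
apply: (@continuous_comp _ _ _ (fun y : E => y 0 i) (fun a : R => a ^+ 2)); first exact: coord_continuous.
exact: exprn_continuous.
Qed.

Lemma norm_le_enorm (x : E) : `|x| <= enorm x.
Proof.
rewrite /Num.Def.normr /= mx_normrE; apply: bigmax_le => [|[i j] _ /=].
  exact: sqrtr_ge0.
rewrite (ord1 i) -(sqrtr_sqr (x 0 j)) ler_sqrt; last first.
  by apply: sumr_ge0 => k _; exact: sqr_ge0.
by rewrite (bigD1 j) //= lerDl; apply: sumr_ge0 => k _; exact: sqr_ge0.
Qed.

Lemma enorm0 : enorm (0 : E) = 0.
Proof.
by rewrite /enorm big1 ?sqrtr0// => i _; rewrite mxE expr0n.
Qed.

Lemma locally_lipschitz_continuous (v : E -> E) :
  locally_lipschitz v -> continuous v.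
Proof.
move=> lv c; have [r r0 [L vL]] := lv c.
have cvg0 : enorm (x - c) @[x --> c] --> (0 : R).
  rewrite -enorm0 -(subrr c).
  apply: (@continuous_comp _ _ _ (fun x : E => x - c) (@enorm R n)).
    by apply: (@cvgB _ _ _ (nbhs c)); [exact: cvg_id|exact: cvg_cst].
  exact: continuous_enorm.
have cvgL : L * enorm (x - c) @[x --> c] --> (0 : R).
  by rewrite -(mulr0 L); apply: cvgM cvg0; exact: cvg_cst.
apply/(@cvgrPdist_lt _ _ _ (nbhs c) (nbhs_filter c)) => e e0.
have er : \forall x \near c, enorm (x - c) < r by apply: (@cvgr_lt _ _ (nbhs c) (nbhs_filter c) _ 0).
have eL : \forall x \near c, L * enorm (x - c) < e by apply: (@cvgr_lt _ _ (nbhs c) (nbhs_filter c) _ 0).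
near=> x; rewrite distrC; apply: le_lt_trans (norm_le_enorm _) _.
apply: (@le_lt_trans _ _ (L * enorm (x - c))); last by near: x.
apply: vL; last by rewrite /eball /= subrr enorm0.
by rewrite /eball /=; near: x.
Unshelve. all: by end_near. Qed.

Lemma continuous_graph (v : E -> E) :
  locally_lipschitz v -> continuous (fun x : E => (x, v x)).
Proof.
move=> lv x.
have vx := locally_lipschitz_continuous lv (x := x).
by apply: (@cvg_pair _ _ _ (nbhs x) (nbhs x) (nbhs (v x)) _ _ _ id v).
Qed.

Lemma same_measure_push (X Y : ptopologicalType) (f : X -> Y)
    (cf : continuous f) (mu nu : Prob R X) :
  same_measure mu nu -> same_measure (push cf mu) (push cf nu).
Proof.
move=> mn A mA; rewrite /push /distribution /pushforward /=; apply: mn.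
by rewrite -[X in measurable X]setTI; exact: continuous_borel.
Qed.

Definition graph_measure (v : E -> E) (lv : locally_lipschitz v)
    (mu : Prob R E) : Prob R (E * E)%type :=
  push (continuous_graph lv) mu.

Lemma graph_measure_proj v (lv : locally_lipschitz v) mu :
  same_measure (push (@continuous_pi1 R n) (graph_measure lv mu)) mu.
Proof. by []. Qed.

Lemma graph_measure_ext v (lv : locally_lipschitz v) mu nu :
  same_measure mu nu ->
  same_measure (graph_measure lv mu) (graph_measure lv nu).
Proof. exact: same_measure_push. Qed.

(* mu (x) delta_(v x) is the push-forward of mu under x |-> (x, v x), which is
   a Borel map because locally Lipschitz functions are continuous. *)
Definition pvf_of_field (v : E -> E) (lv : locally_lipschitz v) : PVF R n :=
  MkPVF (graph_measure_proj lv) (graph_measure_ext lv).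

End vector_field.

(** * Test functions and solutions *)

Section test_functions.
Context (R : realType) (n : nat).
Local Notation E := 'rV[R]_n.

Definition partial (i : 'I_n) (f : E -> R) : E -> R :=
  fun x => 'D_(delta_mx 0 i) f x.

Definition grad (f : E -> R) (x : E) : E := \row_(i < n) partial i f x.

(* All iterated partial derivatives, in any order, exist and are continuous. *)
Definition smooth (f : E -> R) : Prop :=
  forall s : seq 'I_n, let g := foldr partial f s in
    continuous g /\ forall i x, derivable g x (delta_mx 0 i).

Definition test_function (f : E -> R) : Prop :=
  smooth f /\ compact (closure [set x | f x != 0]).

End test_functions.

Definition absolutely_continuous (R : realType) (a b : R) (F : R -> R) : Prop :=
  forall e : R, 0 < e -> exists2 d : R, 0 < d &
    forall (k : nat) (l r : 'I_k -> R),
      (forall i, [/\ a <= l i, l i <= r i & r i <= b]) ->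
      trivIset [set: 'I_k] (fun i => `]l i, r i[%classic) ->
      \sum_(i < k) (r i - l i) < d ->
      \sum_(i < k) `|F (r i) - F (l i)| < e.

Section solution.
Context (R : realType) (n : nat).
Local Notation E := 'rV[R]_n.

Definition drift (V : PVF R n) (f : E -> R) (mu : Prob R E) : \bar R :=
  (\int[V mu]_p (dotv (grad f p.1) p.2)%:E)%E.

(* The drift needs to be defined for almost every s only, so that being L^1 in
   s is asserted of a function g that agrees with it almost everywhere.  Curves
   are functions on R of which only the restriction to [0, T] matters. *)
Definition is_solution (V : PVF R n) (T : R) (mu : R -> Prob R E) : Prop :=
  forall f : E -> R, test_function f ->
    [/\ exists2 g : R -> R,
          (@lebesgue_measure R).-integrable `[0, T]%classic (EFin \o g) &
          {ae @lebesgue_measure R, forall s, `[0, T]%classic s ->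
            (V (mu s)).-integrable setT
              (fun p => (dotv (grad f p.1) p.2)%:E) /\
            drift V f (mu s) = (g s)%:E},
        absolutely_continuous 0 T (fun t => \int[mu t]_x f x) &
        {ae @lebesgue_measure R, forall t, `]0, T[%classic t ->
          is_derive t 1 (fun s => \int[mu s]_x f x) (fine (drift V f (mu t)))}].

End solution.

(** * Lipschitz semigroups *)

(* C is the constant of the sublinear growth of V; it also governs the growth
   of the supports. *)
Record lipschitz_semigroup (R : realType) (n : nat) (V : PVF R n) (C T : R)
    (S : R -> cprob R 'rV[R]_n -> cprob R 'rV[R]_n) : Prop := {
  lsg_growth : pvf_sublinear V C ;
  lsg_id : forall mu, same_measure (S 0 mu) mu ;
  lsg_comp : forall mu t s, 0 <= t <= T -> 0 <= s <= T -> t + s <= T ->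
    same_measure (S t (S s mu)) (S (t + s) mu) ;
  lsg_solution : forall mu : cprob R 'rV[R]_n, is_solution V T (fun t => S t mu) ;
  lsg_bounds : forall r : R, 0 < r -> exists2 Cr : R, 0 < Cr &
    forall mu nu : cprob R 'rV[R]_n,
      supp mu `<=` eball 0 r -> supp nu `<=` eball 0 r ->
      forall t s, 0 <= t <= T -> 0 <= s <= T ->
      [/\ supp (S t mu) `<=` eball 0 (expR (C * t) * (r + 1)),
          (W (S t mu) (S t nu) <= (expR (Cr * t))%:E * W mu nu)%E &
          (W (S t mu) (S s mu) <= (Cr * `|t - s|)%:E)%E] }.

(** * Lattice approximate solutions *)

Section lattice.
Context (R : realType) (n : nat).
Local Notation E := 'rV[R]_n.

(* The points of (Z^n / m) /\ [-N, N]^n are those with coordinates - N + k / m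
   for 0 <= k <= 2 N m, so they are indexed by the finite type below. *)
Definition lattice (N m : nat) := {ffun 'I_n -> 'I_(2 * (N * m)).+1}.

Definition lattice_point (N m : nat) (k : lattice N m) : E :=
  \row_(j < n) ((k j)%:R / m%:R - N%:R).

Definition cell (m : nat) (x : E) : set E :=
  [set y | forall j, x 0 j <= y 0 j < x 0 j + m%:R^-1].

(* mu is the N-th lattice approximate solution on [0, T] with datum mu0; its
   value at l / N is mu^N_l.  As the values of mu are probability measures, no
   mass leaves the grids, so that N is large enough in the sense required by
   the construction. *)
Definition is_LAS (V : PVF R n) (T : R) (mu0 : Prob R E) (N : nat)
    (mu : R -> Prob R E) : Prop :=
  [/\ (0 < N)%N,
      forall A : set (borel E), measurable A ->
        mu 0 A = (\sum_(i : lattice N (N ^ 2))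
          mu0 (cell (N ^ 2) (lattice_point i)) * \d_(lattice_point i : borel E) A)%E &
      forall (l : nat) (t : R), 0 <= t <= N%:R^-1 -> l%:R / N%:R + t <= T ->
        forall A : set (borel E), measurable A ->
        mu (l%:R / N%:R + t) A =
          (\sum_(i : lattice N (N ^ 2)) \sum_(j : lattice N N)
            V (mu (l%:R / N%:R)%R)
              [set p | p.1 = lattice_point i /\ cell N (lattice_point j) p.2]
            * \d_((lattice_point i + t *: lattice_point j)%R : borel E) A)%E].

Definition limit_of_LAS (V : PVF R n) (T : R)
    (S : R -> cprob R E -> cprob R E) : Prop :=
  forall mu0 : cprob R E,
    exists (phi : nat -> nat) (mu : nat -> R -> Prob R E),
      [/\ {homo phi : i j / (i < j)%N},
          forall k, is_LAS V T mu0 (phi k) (mu k) &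
          forall e : R, 0 < e -> \forall k \near \oo,
            forall t, 0 <= t <= T -> (W (S t mu0) (mu k t) <= e%:E)%E].

End lattice.

(* Main.v *)
Require Import Defs.
From HB Require Import structures.
From mathcomp Require Import all_boot all_order all_algebra.
From mathcomp Require Import all_classical all_reals all_analysis.
From mathcomp Require Import measurable_realfun ring lra.
Set Implicit Arguments.
Unset Strict Implicit.
Unset Printing Implicit Defensive.
Import Order.TTheory GRing.Theory Num.Theory.
Import numFieldNormedType.Exports.
Local Open Scope classical_set_scope.
Local Open Scope ring_scope.

(* W-Lipschitz estimate: the map (x, y) |-> ((x, v x), (y, v y)) pushes an
   optimal coupling of mu and nu to an admissible coupling of the two lifted
   measures, whose cost is at most L W(mu, nu), with L a Lipschitz constant of v
   on the ball.  This needs an optimal coupling.  Along an ultrafilter, a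
   minimizing sequence of couplings converges on measurable rectangles to a
   finitely additive function; because the marginals are fixed and regular, the
   limit is countably subadditive there, and Caratheodory extends it to a
   coupling, whose cost is controlled by finite sums over grid cells.

   Semigroup: S_t is the push-forward by the flow of v, and the N-th LAS from mu0
   is the push-forward of mu0 by an Euler scheme of step 1/N for v rounded down
   to the grid.  The scheme is at distance O(1/N) from the flow, uniformly on
   balls, hence so are the measures for W.

   Uniqueness: an LAS is determined by N and by its initial datum, so the LASs
   that converge to another semigroup converge to the push-forward by the flow
   too, and W-limits are unique. *)

(** [Wtan] is an infimum over lifts whose base projection is optimal, so nearly optimal couplings
    are of no use: without an optimal one the infimum would be that of the empty set. A limit of
    probabilities along an ultrafilter is in general only finitely additive. On a rectangle,
    however, the mass that any coupling loses when the sides shrink is at most the sum of the losses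
    of the marginals, so that one compact inner or open outer approximation serves all couplings at
    once. The distance is rounded to a grid because finite sums of masses of rectangles pass to the
    limit.

    The LASs are push-forwards by a map because the fibre of the field over a point is a Dirac mass:
    the mass at a lattice point is never split among several velocities. Rounding moves velocities
    by at most n/N and initial points by at most n/N^2, whatever the field. A Lipschitz constant, in
    contrast, exists only ball by ball; therefore every estimate is preceded by an a priori bound on
    [1 + enorm], the quantity that sublinear growth propagates linearly, for the flow and for the
    Euler scheme alike. *)

Section euclidean_norm.
Context (R : realType) (n : nat).
Local Notation E := 'rV[R]_n.
Implicit Types x y : E.

Lemma enorm_ge0 x : 0 <= enorm x.
Proof. exact: sqrtr_ge0. Qed.

Lemma sqr_enorm x : enorm x ^+ 2 = dotv x x.
Proof.
rewrite sqr_sqrtr; last by apply: sumr_ge0 => i _; exact: sqr_ge0.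
by rewrite /dotv; apply: eq_bigr => i _; rewrite expr2.
Qed.

Lemma coord_le_enorm x i : `|x 0 i| <= enorm x.
Proof.
rewrite -sqrtr_sqr ler_sqrt; last by apply: sumr_ge0 => k _; exact: sqr_ge0.
by rewrite (bigD1 i) //= lerDl; apply: sumr_ge0 => k _; exact: sqr_ge0.
Qed.

Lemma enorm_eq0 x : enorm x = 0 -> x = 0.
Proof.
move=> x0; apply/rowP => i; rewrite mxE; apply/eqP.
by rewrite -normr_le0 -x0 coord_le_enorm.
Qed.

Lemma dotv_le x y : dotv x y <= enorm x * enorm y.
Proof.
have [x0|x0] := eqVneq (enorm x) 0.
  by rewrite x0 mul0r (enorm_eq0 x0) /dotv big1// => i _; rewrite mxE mul0r.
have [y0|y0] := eqVneq (enorm y) 0.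
  by rewrite y0 mulr0 (enorm_eq0 y0) /dotv big1// => i _; rewrite mxE mulr0.
have xp : 0 < enorm x by rewrite lt_def x0 enorm_ge0.
have yp : 0 < enorm y by rewrite lt_def y0 enorm_ge0.
have xx := sqr_enorm x; have yy := sqr_enorm y.
set a := enorm x in xp xx *; set b := enorm y in yp yy *.
(* Cauchy-Schwarz: with a = |x| and b = |y|, this square expands to 2ab(ab - x.y). *)
have : 0 <= dotv (b *: x - a *: y) (b *: x - a *: y).
  by apply: sumr_ge0 => i _; rewrite -expr2 sqr_ge0.
have -> : dotv (b *: x - a *: y) (b *: x - a *: y) =
    b ^+ 2 * dotv x x + a ^+ 2 * dotv y y - 2 * (a * b) * dotv x y.
  rewrite /dotv !mulr_sumr -sumrN -!big_split /=; apply: eq_bigr => i _.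
  by rewrite !mxE; ring.
rewrite -xx -yy => H.
have : 0 <= (2 * (a * b)) * (a * b - dotv x y) by nra.
by rewrite pmulr_rge0 ?subr_ge0// !mulr_gt0.
Qed.

Lemma enormD x y : enorm (x + y) <= enorm x + enorm y.
Proof.
rewrite -(@ler_pXn2r _ 2) ?nnegrE ?addr_ge0 ?enorm_ge0//.
have -> : enorm (x + y) ^+ 2 = enorm x ^+ 2 + 2 * dotv x y + enorm y ^+ 2.
  rewrite !sqr_enorm /dotv mulr_sumr -!big_split/=; apply: eq_bigr => i _.
  by rewrite !mxE; ring.
by have := dotv_le x y; rewrite sqrrD; lra.
Qed.

Lemma enormZ (a : R) x : enorm (a *: x) = `|a| * enorm x.
Proof.
rewrite /enorm -sqrtr_sqr -sqrtrM ?sqr_ge0//; congr Num.sqrt.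
by rewrite mulr_sumr; apply: eq_bigr => i _; rewrite mxE exprMn.
Qed.

Lemma enormN x : enorm (- x) = enorm x.
Proof. by rewrite -scaleN1r enormZ normrN1 mul1r. Qed.

Lemma enormB x y : enorm (x - y) = enorm (y - x).
Proof. by rewrite -enormN opprB. Qed.

Lemma ler_enorm_dist x y z : enorm (x - z) <= enorm (x - y) + enorm (y - z).
Proof. by rewrite -[x - z](subrKA y) enormD. Qed.

Lemma enorm_le_sum x : enorm x <= \sum_i `|x 0 i|.
Proof.
have h0 : 0 <= \sum_i `|x 0 i| by apply: sumr_ge0 => i _; exact: normr_ge0.
rewrite -(@ler_pXn2r _ 2) ?nnegrE ?enorm_ge0//.
rewrite sqr_enorm /dotv expr2 mulr_suml; apply: ler_sum => i _.
rewrite -expr2 -real_normK ?num_real// expr2; apply: ler_wpM2l => //.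
by rewrite (bigD1 i)//= lerDl; apply: sumr_ge0 => j _; exact: normr_ge0.
Qed.

Lemma enorm_le_const x (a : R) : (forall i, `|x 0 i| <= a) -> enorm x <= n%:R * a.
Proof.
move=> xa; apply: (le_trans (enorm_le_sum x)).
apply: (le_trans (ler_sum _ (fun i _ => xa i))).
by rewrite sumr_const card_ord mulr_natl.
Qed.

Lemma coord_le_norm x i : `|x 0 i| <= `|x|.
Proof.
rewrite [leRHS]/Num.Def.normr /= mx_normrE; apply/bigmax_geP; right => /=.
by exists (ord0, i).
Qed.

Lemma enorm_le_norm x : enorm x <= n%:R * `|x|.
Proof. by apply: enorm_le_const => i; exact: coord_le_norm. Qed.

Lemma norm_lt_coord x (e : R) : 0 < e -> (forall i, `|x 0 i| < e) -> `|x| < e.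
Proof.
move=> e0 xe; rewrite [ltLHS]/Num.Def.normr /= mx_normrE; apply/bigmax_ltP; split => //.
by move=> [i j] _ /=; rewrite (ord1 i).
Qed.

Lemma eballP x (r : R) : eball 0 r x = (enorm x < r) :> Prop.
Proof. by rewrite /eball /= subr0. Qed.

Lemma ball_row x (e : R) : ball x e = [set y | `|x - y| < e].
Proof. by rewrite -ball_normE. Qed.

Lemma enorm_open (r : R) : open [set x : E | enorm x < r].
Proof.
by apply: (open_comp (f := @enorm R n)) (@open_lt R r) => x _; exact: continuous_enorm.
Qed.

Lemma enorm_closed (r : R) : closed [set x : E | enorm x <= r].
Proof.
by apply: (preimage_closed (f := @enorm R n)) (@closed_le R r) => x _; exact: continuous_enorm.
Qed.

Lemma enorm_compact (r : R) : compact [set x : E | enorm x <= r].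
Proof.
apply: bounded_closed_compact; last exact: enorm_closed.
exists r; split; first exact: num_real.
by move=> s rs x /= xr; rewrite (le_trans (norm_le_enorm _))// (le_trans xr)// ltW.
Qed.

Lemma continuous_row (T : topologicalType) (f : T -> E) :
  (forall i, continuous (fun t => f t 0 i)) -> continuous f.
Proof.
move=> cf t; apply/cvgrPdist_lt => e e0.
have H i : \forall u \near t, `|f t 0 i - f u 0 i| < e.
  by have /cvgrPdist_lt/(_ e e0) := cf i t.
have : \forall u \near t, forall i : 'I_n, `|f t 0 i - f u 0 i| < e.
  exact: filter_forall.
by apply: filterS => u ue; apply: norm_lt_coord => // i; rewrite !mxE.
Qed.

Lemma lipschitz_continuous (f : E -> E) (L : R) :
  (forall x y, enorm (f x - f y) <= L * enorm (x - y)) -> continuous f.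
Proof.
move=> fL; apply: locally_lipschitz_continuous => c.
by exists 1 => //; exists L.
Qed.

End euclidean_norm.

(** * Countable unions and sets of full measure *)

Section null_sets.
Context d (T : measurableType d) (R : realType).

Lemma measure_countable_union0 (mu : {measure set T -> \bar R})
    (I : countType) (D : set I) (F : I -> set T) :
  (forall i, D i -> measurable (F i)) -> (forall i, D i -> mu (F i) = 0%E) ->
  measurable (\bigcup_(i in D) F i) /\ mu (\bigcup_(i in D) F i) = 0%E.
Proof.
move=> mF F0.
pose G k := if unpickle k is Some i then if i \in D then F i else set0 else set0.
have GE : \bigcup_(i in D) F i = \bigcup_k G k.
  apply/seteqP; split=> [x [i Di Fi]|x [k _]].
    by exists (pickle i) => //; rewrite /G pickleK mem_set.
  rewrite /G; case: unpickle => // i; case: ifPn => // /set_mem Di Fi.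
  by exists i.
have mG k : measurable (G k).
  rewrite /G; case: unpickle => // i; case: ifPn => // /set_mem Di.
  exact: mF.
have mGU : measurable (\bigcup_k G k) by exact: bigcupT_measurable.
rewrite GE; split=> //; apply: measure_negligible => //.
apply: negligible_bigcup => k; apply/negligibleP => //.
by rewrite /G; case: unpickle => // i; case: ifPn => // /set_mem Di; exact: F0.
Qed.

Lemma measurable_countable_union (I : countType) (D : set I) (F : I -> set T) :
  (forall i, D i -> measurable (F i)) -> measurable (\bigcup_(i in D) F i).
Proof.
move=> mF; rewrite bigcup_mkcond; apply: countable_bigcupT_measurable => // i.
by case: ifPn => // /set_mem; exact: mF.
Qed.

Lemma probability_setC0 (P : probability T R) (A : set T) :
  measurable A -> P (~` A) = 0%E -> P A = 1%E.
Proof. by move=> mA A0; rewrite -(setCK A) probability_setC ?A0 ?sube0//; exact: measurableC. Qed.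

Lemma measure_setI_full (P : probability T R) (A N : set T) :
  measurable A -> measurable N -> P (~` N) = 0%E -> P (A `&` N) = P A.
Proof.
move=> mA mN N0; have mCN := measurableC mN.
apply/eqP; rewrite eq_le; apply/andP; split.
  by apply: le_measure; rewrite ?inE//; exact: measurableI.
have -> : A = (A `&` N) `|` (A `&` ~` N) by rewrite -setIUr setUCr setIT.
rewrite -[leRHS]adde0 -[X in (_ <= _ + X)%E]N0.
have := measureU2 P (measurableI _ _ mA mN) (measurableI _ _ mA mCN).
move=> /le_trans; apply.
apply: leeD; first by rewrite -setIUr setUCr setIT.
by apply: le_measure; rewrite ?inE//; apply: measurableI.
Qed.

End null_sets.

(** * Borel measures on Euclidean spaces *)

Section borel_sets.
Context (R : realType).

Lemma open_borel (X : ptopologicalType) (U : set X) :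
  open U -> measurable (U : set (borel X)).
Proof. by move=> oU; exact: sub_sigma_algebra. Qed.

Lemma closed_borel (X : ptopologicalType) (U : set X) :
  closed U -> measurable (U : set (borel X)).
Proof. by move=> cU; rewrite -[U]setCK; apply: measurableC; apply: open_borel; rewrite openC. Qed.

Context (n : nat).
Local Notation E := 'rV[R]_n.
Local Notation TE := (E * E)%type.

(** Sup-norm balls with rational centre and radius 1/(m+1): a base of the topology indexed by a
    countable type. *)
Definition rational_box (i : 'rV[rat]_n * nat) : set E :=
  [set x | forall k, `|x 0 k - ratr (i.1 0 k)| < i.2.+1%:R^-1].

Lemma rational_box_open i : open (rational_box i).
Proof.
case: i => q m.
have -> : rational_box (q, m) = ball (map_mx ratr q : E) m.+1%:R^-1.
  apply/seteqP; split=> x.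
    move=> xb; rewrite ball_row /=; apply: norm_lt_coord.
      by rewrite invr_gt0.
    by move=> k; rewrite !mxE distrC; exact: xb.
  rewrite ball_row /= => xb k; apply: le_lt_trans xb.
  by rewrite distrC; have := coord_le_norm (map_mx ratr q - x) k; rewrite !mxE.
by apply: ball_open; rewrite invr_gt0.
Qed.

Lemma measurable_rational_box i : measurable (rational_box i : set (borel E)).
Proof. by apply: open_borel; exact: rational_box_open. Qed.

Lemma rational_box_basis (x : E) (U : set E) :
  nbhs x U -> exists2 i, rational_box i x & rational_box i `<=` U.
Proof.
move=> /nbhs_ballP[e /= e0 xU].
have e20 : 0 < e / 2 by rewrite divr_gt0.
have [m] := ltr_add_invr e20; rewrite add0r => me.
have m0 : 0 < m.+1%:R^-1 :> R by rewrite invr_gt0.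
pose a : R := m.+1%:R^-1; rewrite -/a in me m0.
have H k : exists q : rat, `|x 0 k - ratr q| < a.
  have : x 0 k - a < x 0 k + a by lra.
  move=> /rat_in_itvoo[q]; rewrite in_itv/= => /andP[qa qb].
  by exists q; rewrite ltr_norml; lra.
have [q xq] := choice H.
exists (\row_k q k, m); first by move=> k /=; rewrite mxE.
move=> y /= yb; apply: xU; rewrite ball_row /=; apply: norm_lt_coord => // k.
have := yb k; have := xq k; rewrite /= !mxE -/a => h1 h2.
apply: (le_lt_trans (ler_distD (ratr (q k)) _ _)).
by rewrite [X in _ + X]distrC; lra.
Qed.

(** The union is countable, so the Borel sets of the product are generated by rectangles.
    Measurability of pairs and the passage from rectangles to Borel sets both rest on this. *)
Lemma open_prod_bigcup (U : set TE) : open U ->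
  U = \bigcup_(ij in [set ij | rational_box ij.1 `*` rational_box ij.2 `<=` U])
        (rational_box ij.1 `*` rational_box ij.2).
Proof.
move=> oU; apply/seteqP; split=> [[x y] Uxy|p [ij ijU]]; last exact: ijU.
have : nbhs (x, y) U by exact: open_nbhs_nbhs.
move=> [[A B]] /= [nA nB] ABU.
have [i ix iA] := rational_box_basis nA; have [j jy jB] := rational_box_basis nB.
exists (i, j) => //= -[a b] /= [ia jb]; apply: ABU.
by split; [exact: iA|exact: jB].
Qed.

Lemma measurable_fun_pair_borel d (T : measurableType d)
    (f g : T -> borel E) :
  measurable_fun setT f -> measurable_fun setT g ->
  measurable_fun setT (fun t => (f t, g t) : borel TE).
Proof.
move=> mf mg; apply: (@measurability _ _ T (borel TE) setT _ (@open TE)) => //.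
move=> _ [U oU <-]; rewrite setTI (open_prod_bigcup oU) preimage_bigcup.
apply: measurable_countable_union => ij _.
rewrite (_ : _ @^-1` _ = (f @^-1` rational_box ij.1) `&` (g @^-1` rational_box ij.2)).
  by apply: measurableI; rewrite -[X in measurable X]setTI; [apply: mf|apply: mg] => //;
    exact: measurable_rational_box.
by apply/seteqP; split=> t.
Qed.

Lemma measurable_fst_borel : measurable_fun setT (fst : borel TE -> borel E).
Proof. by apply: continuous_borel; exact: continuous_pi1. Qed.

Lemma measurable_snd_borel : measurable_fun setT (snd : borel TE -> borel E).
Proof. by apply: continuous_borel => p; exact: cvg_snd. Qed.

Lemma measurable_setX_borel (A B : set (borel E)) :
  measurable A -> measurable B -> measurable (A `*` B : set (borel TE)).
Proof.
move=> mA mB; rewrite (_ : _ `*` _ = (fst @^-1` A) `&` (snd @^-1` B)); last first.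
  by apply/seteqP; split.
apply: measurableI; rewrite -[X in measurable X]setTI.
  exact: measurable_fst_borel.
exact: measurable_snd_borel.
Qed.

Lemma continuous_measurable_real (X : ptopologicalType) (f : X -> R) :
  continuous f -> measurable_fun setT (f : borel X -> R).
Proof.
move=> /continuousP cf; apply: (measurability _ (RGenOpens.measurableE R)).
move=> _ [_ [a [b ->] <-]]; rewrite setTI; apply: open_borel.
exact/cf/interval_open.
Qed.

Lemma supp_closed (X : ptopologicalType) (mu : Prob R X) : closed (supp mu).
Proof.
move=> x xs U [oU Ux].
have nU : nbhs x U by apply: open_nbhs_nbhs; split.
by have [y [ys Uy]] := xs U nU; exact: ys.
Qed.

(** A point off the support has a null open neighbourhood, hence lies in a null rational box, and
    there are only countably many boxes. *)
Lemma supp_null (mu : Prob R E) : mu (~` supp mu) = 0%E.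
Proof.
pose D := [set i | mu (rational_box i) = 0%E].
have [_ D0] : measurable (\bigcup_(i in D) rational_box i : set (borel E)) /\
    mu (\bigcup_(i in D) rational_box i) = 0%E.
  by apply: measure_countable_union0 => // i _; exact: measurable_rational_box.
apply: (subset_measure0 _ _ _ D0).
- by apply: measurableC; apply: closed_borel; exact: supp_closed.
- by apply: measurable_countable_union => i _; exact: measurable_rational_box.
- move=> x; rewrite /supp/= => /existsNP[U] /not_implyP[[oU Ux]] /negP.
  rewrite -leNgt measure_le0 => /eqP U0.
  have nU : nbhs x U by apply: open_nbhs_nbhs; split.
  have [i ix iU] := rational_box_basis nU.
  have mU : measurable (U : set (borel E)) by exact: open_borel.
  exists i => //; rewrite /D/=; apply: (@subset_measure0 _ _ _ mu _ _ _ mU iU U0).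
  exact: measurable_rational_box.
Qed.

End borel_sets.

(** * Push-forward of probabilities and change of variables *)

Section pushforward_probability.
Context (R : realType).

Definition mpush d (T : measurableType d) (X : ptopologicalType)
    (P : probability T R) (f : T -> borel X) (mf : measurable_fun setT f) :
  Prob R X := distribution P (mfun_Sub (mem_set mf)).

Lemma mpushE d (T : measurableType d) (X : ptopologicalType)
    (P : probability T R) (f : T -> borel X) (mf : measurable_fun setT f) A :
  mpush P mf A = P (f @^-1` A).
Proof. by []. Qed.

Lemma pushE (X Y : ptopologicalType) (f : X -> Y) (cf : continuous f)
    (mu : Prob R X) A : push cf mu A = mu (f @^-1` A).
Proof. by []. Qed.

Lemma ge0_integral_mpush d (T : measurableType d) (X : ptopologicalType)
    (P : probability T R) (f : T -> borel X) (mf : measurable_fun setT f)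
    (h : borel X -> \bar R) :
  measurable_fun [set: borel X] h -> (forall x, 0 <= h x)%E ->
  (\int[mpush P mf]_x h x = \int[P]_t h (f t))%E.
Proof.
by move=> mh h0; rewrite (@ge0_integral_pushforward _ _ _ _ _ f mf P setT h)//.
Qed.

Lemma integrable_mpush d (T : measurableType d) (X : ptopologicalType)
    (P : probability T R) (f : T -> borel X) (mf : measurable_fun setT f)
    (h : borel X -> \bar R) :
  measurable_fun [set: borel X] h -> P.-integrable setT (h \o f) ->
  (mpush P mf).-integrable setT h.
Proof.
move=> mh /integrableP[_ hf]; apply/integrableP; split => //.
rewrite ge0_integral_mpush//; exact: measurableT_comp.
Qed.

Lemma integral_mpush d (T : measurableType d) (X : ptopologicalType)
    (P : probability T R) (f : T -> borel X) (mf : measurable_fun setT f)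
    (h : borel X -> \bar R) :
  measurable_fun [set: borel X] h -> P.-integrable setT (h \o f) ->
  (\int[mpush P mf]_x h x = \int[P]_t h (f t))%E.
Proof.
by move=> mh ih; rewrite (@integral_pushforward _ _ _ _ _ f mf P setT h).
Qed.

End pushforward_probability.

Lemma integral_cst_probability d (T : measurableType d) (R : realType)
    (P : probability T R) (c : \bar R) : (\int[P]_t c = c)%E.
Proof.
rewrite integral_cst// [X in (_ * X)%E](_ : _ = 1%E) ?mule1//.
exact: probability_setT.
Qed.

(** * Elementary properties of W *)

Section wasserstein_facts.
Context (R : realType) (n : nat).
Local Notation E := 'rV[R]_n.
Local Notation TE := (E * E)%type.
Implicit Types mu nu : Prob R E.

Lemma measurable_dist : measurable_fun setT
  ((fun p : TE => (enorm (p.1 - p.2))%:E) : borel TE -> \bar R).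
Proof.
apply/measurable_EFinP; apply: continuous_measurable_real => p.
apply: (@continuous_comp _ _ _ (fun p : TE => p.1 - p.2) (@enorm R n)).
  by apply: (@cvgB _ _ _ (nbhs p)); [exact: cvg_fst|exact: cvg_snd].
exact: continuous_enorm.
Qed.

Lemma coupling_null mu nu (tau : Prob R TE) (A B : set (borel E)) :
  coupling mu nu tau -> measurable A -> measurable B ->
  mu (~` A) = 0%E -> nu (~` B) = 0%E -> tau (~` (A `*` B)) = 0%E.
Proof.
move=> [c1 c2] mA mB A0 B0.
have mCA := measurableC mA; have mCB := measurableC mB.
have mfst : measurable (fst @^-1` (~` A) : set (borel TE)).
  by rewrite -[X in measurable X]setTI; exact: measurable_fst_borel.
have msnd : measurable (snd @^-1` (~` B) : set (borel TE)).
  by rewrite -[X in measurable X]setTI; exact: measurable_snd_borel.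
apply/eqP; rewrite -measure_le0.
have -> : ~` (A `*` B) = (fst @^-1` (~` A)) `|` (snd @^-1` (~` B)) :> set TE.
  by apply/seteqP; split=> -[x y] /=; [move=> /not_andP|move=> h; apply/not_andP].
apply: (le_trans (measureU2 tau mfst msnd)).
by rewrite [X in (X + _)%E]c1// [X in (_ + X)%E]c2// A0 B0 adde0.
Qed.

Lemma supp_eball_null mu (r : R) :
  supp mu `<=` eball 0 r -> mu (~` [set x : E | enorm x < r]) = 0%E.
Proof.
move=> mur; apply: (@subset_measure0 _ _ _ mu _ (~` supp mu)).
- by apply: measurableC; apply: open_borel; exact: enorm_open.
- by apply: measurableC; apply: closed_borel; exact: supp_closed.
- by move=> x xr /mur; rewrite eballP.
- exact: supp_null.
Qed.

(** The law of the pair [(f, g)] is a coupling. This converts a uniform estimate between two maps on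
    a set of full measure into an estimate for [W]. *)
Lemma W_le_law d (T : measurableType d) (P : probability T R) mu nu
    (f g : T -> borel E) (mf : measurable_fun setT f) (mg : measurable_fun setT g)
    (N : set T) (c : R) :
  same_measure (mpush P mf) mu -> same_measure (mpush P mg) nu ->
  measurable N -> P (~` N) = 0%E -> 0 <= c ->
  (forall t, N t -> enorm (f t - g t : E) <= c) ->
  (W mu nu <= c%:E)%E.
Proof.
move=> fmu gnu mN N0 c0 fgc.
pose mfg := measurable_fun_pair_borel mf mg.
apply: (@le_trans _ _ (cost (mpush P mfg))).
  apply: ereal_inf_lbound; exists (mpush P mfg) => //.
rewrite /cost ge0_integral_mpush//=; first last.
- by move=> p; rewrite lee_fin enorm_ge0.
- exact: measurable_dist.
apply: (@le_trans _ _ (\int[P]_t c%:E)%E); last first.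
  by rewrite integral_cst_probability.
apply: ae_ge0_le_integral => //.
- by move=> t _; rewrite lee_fin enorm_ge0.
- by apply: (measurableT_comp measurable_dist mfg).
- exists (~` N); split => //; first exact: measurableC.
  by move=> t /= + Nt; apply; move=> _; rewrite lee_fin; exact: fgc.
Qed.

Definition thickening (F : set E) (e : R) : set E :=
  \bigcup_(y in F) [set x | enorm (x - y) < e].

Lemma thickening_open F e : open (thickening F e).
Proof.
apply: bigcup_open => y _.
apply: (open_comp (f := fun x : E => enorm (x - y))) (@open_lt R e) => x _.
apply: (@continuous_comp _ _ _ (fun x : E => x - y) (@enorm R n)).
  by apply: (@cvgB _ _ _ (nbhs x)); [exact: cvg_id|exact: cvg_cst].
exact: continuous_enorm.
Qed.

Lemma thickening_thickening F e : thickening (thickening F e) e `<=` thickening F (2 * e).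
Proof.
move=> x [y [z Fz zy] yx]; exists z => //=.
apply: (le_lt_trans (ler_enorm_dist x y z)).
by move: zy yx => /= zy yx; lra.
Qed.

(** A closed set is the decreasing intersection of its thickenings, so continuity from above
    applies. *)
Lemma thickening_cvg mu (F : set E) : closed F ->
  mu (thickening F k.+1%:R^-1) @[k --> \oo] --> mu F.
Proof.
move=> cF.
have FE : F = \bigcap_k thickening F k.+1%:R^-1.
  apply/seteqP; split=> [x Fx k _|x xF].
    by exists x => //=; rewrite subrr enorm0.
  apply: cF => U /nbhs_ballP[e /= e0 xU].
  have [k] := ltr_add_invr e0; rewrite add0r => ke.
  have [y Fy /= xy] := xF k Logic.I.
  exists y; split => //; apply: xU; rewrite ball_row/=.
  by apply: (le_lt_trans (norm_le_enorm _)); exact: lt_trans xy ke.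
rewrite [in X in _ --> X]FE; apply: nonincreasing_cvg_mu.
- by rewrite (le_lt_trans (probability_le1 _ _))// ?ltry//; apply: open_borel; exact: thickening_open.
- by move=> k; apply: open_borel; exact: thickening_open.
- by rewrite -FE; exact: closed_borel.
- move=> i j ij; apply/subsetPset => x [y Fy xy]; exists y => //.
  apply: (lt_le_trans xy); rewrite lef_pV2 ?posrE//.
  by rewrite ler_nat.
Qed.

Lemma W_sym mu nu : (W mu nu <= W nu mu)%E.
Proof.
apply: le_ereal_inf_tmp => _ [tau [c1 c2] <-].
have mswap := measurable_fun_pair_borel (@measurable_snd_borel R n) (@measurable_fst_borel R n).
apply: (@le_trans _ _ (cost (mpush tau mswap))).
  by apply: ereal_inf_lbound; exists (mpush tau mswap) => //; split.
rewrite /cost ge0_integral_mpush.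
- by under eq_integral => p _ do rewrite /= enormB.
- exact: measurable_dist.
- by move=> p; rewrite lee_fin enorm_ge0.
Qed.

(* Markov's inequality for a coupling of cost less than [d * e]. *)
Lemma W_lt_thickening mu nu (F : set E) (d e : R) :
  measurable (F : set (borel E)) -> 0 < d ->
  (W mu nu < (d * e)%:E)%E -> (mu F <= nu (thickening F d) + e%:E)%E.
Proof.
move=> mF d0 /ereal_inf_lt[_ [tau [c1 c2] <-]] ce.
pose B := [set p : TE | enorm (p.1 - p.2) >= d].
have mB : measurable (B : set (borel TE)).
  have := measurable_dist measurableT (emeasurable_itv `[d%:E, +oo[).
  rewrite setTI; congr measurable; apply/seteqP; split=> p /=;
    by rewrite in_itv/= andbT lee_fin.
have tB : (tau B <= e%:E)%E.
  have := @le_integral_abse _ _ _ tau setT measurableT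
    (fun p : TE => (enorm (p.1 - p.2))%:E) d measurable_dist d0.
  rewrite setTI => h.
  rewrite -(@lee_pmul2l _ d%:E)//.
  rewrite -EFinM; apply: le_trans (ltW ce).
  move: h; rewrite (_ : [set x | _] = B); last first.
    by apply/seteqP; split=> p /=; rewrite lee_fin ger0_norm ?enorm_ge0.
  move=> /le_trans; apply; rewrite /cost.
  rewrite le_eqVlt; apply/orP; left; apply/eqP/eq_integral => p _.
  by rewrite gee0_abs// lee_fin enorm_ge0.
rewrite -c1//.
have mT : measurable (thickening F d : set (borel E)).
  by apply: open_borel; exact: thickening_open.
rewrite -c2//.
have ms : measurable (snd @^-1` thickening F d : set (borel TE)).
  by rewrite -[X in measurable X]setTI; exact: measurable_snd_borel.
apply: (@le_trans _ _ (tau ((snd @^-1` thickening F d) `|` B))).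
  apply: le_measure; rewrite ?inE.
  - by rewrite -[X in measurable X]setTI; exact: measurable_fst_borel.
  - exact: measurableU.
  - move=> p /= Fp; have [dp|pd] := leP d (enorm (p.1 - p.2)); [by right|left].
    by exists p.1 => //=; rewrite enormB.
apply: (le_trans (measureU2 tau ms mB)).
exact: leeD.
Qed.

(** Complements give the open sets, which are stable under intersection and generate the Borel sets.
    Closed sets are the convenient test class, since thickenings shrink to them. *)
Lemma same_measure_closed mu nu :
  (forall F : set E, closed F -> mu F = nu F) -> same_measure mu nu.
Proof.
move=> H A mA.
apply: (@measure_unique _ _ (borel E) (@open E) (fun=> setT)) => //.
- by move=> U V; exact: openI.
- by move=> _; exact: openT.
- by rewrite bigcup_const//; exists 0%N.
- move=> U oU; have mU : measurable (~` U : set (borel E)).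
    by apply: measurableC; exact: open_borel.
  have : mu (~` ~` U) = nu (~` ~` U).
    by rewrite probability_setC// [RHS]probability_setC// H// closedC.
  by rewrite setCK.
- by move=> _; rewrite (le_lt_trans (probability_le1 _ _))// ltry.
Qed.

End wasserstein_facts.

(** * Limits of couplings *)

(** Packs a bare set function on a semiring into the structure from which [measure_extension]
    starts. *)
Lemma measure_of_content d (T : semiRingOfSetsType d) (R : realType)
    (m : set T -> \bar R) :
  (forall A, 0 <= m A)%E -> measure_function.semi_additive m ->
  measurable_subset_sigma_subadditive m ->
  exists m' : {measure set T -> \bar R}, forall A, m' A = m A.
Proof.
move=> m0 mA mS.
pose c := isContent.Build d T R m m0 mA.
pose C : {content set T -> \bar R} := HB.pack m c.
pose s := Content_SigmaSubAdditive_isMeasure.Build d R T C mS.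
pose M : {measure set T -> \bar R} := HB.pack m c s.
by exists M.
Qed.

Lemma cvge_lt (R : realType) (T : Type) (F : set_system T) (FF : Filter F)
    (u : T -> \bar R) (l z : \bar R) :
  u @ F --> l -> (l < z)%E -> \forall k \near F, (u k < z)%E.
Proof.
by move=> ul lz; exact: (ul _ (open_ereal_lt' lz)).
Qed.

(** * Regularity of Borel probabilities *)

Section regularity.
Context (R : realType) (n : nat) (P : Prob R 'rV[R]_n).
Local Notation E := 'rV[R]_n.

Let regular (A : set E) := forall e : R, 0 < e -> exists F G : set E,
  [/\ closed F, open G, F `<=` A, A `<=` G & (P (G `\` F) <= e%:E)%E].

Let mclosed (F : set E) : closed F -> measurable (F : set (borel E)).
Proof. exact: closed_borel. Qed.

Let mopen (F : set E) : open F -> measurable (F : set (borel E)).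
Proof. exact: open_borel. Qed.

Let regular_open (U : set E) : open U -> regular U.
Proof.
move=> oU e e0.
have cU : closed (~` U) by rewrite closedC.
have := thickening_cvg (mu := P) cU.
have Pf : P (~` U) \is a fin_num by apply: fin_num_measure; exact: mclosed.
move=> h.
have lt : (P (~` U) < P (~` U) + e%:E)%E by rewrite lteDl// lte_fin.
have [k _ /(_ k (leqnn k)) /= Pk] := cvge_lt _ h lt.
set V := thickening _ _ in Pk.
have oV : open V by exact: thickening_open.
have UV : ~` U `<=` V.
  by move=> x Ux; exists x => //=; rewrite subrr enorm0 invr_gt0.
exists (~` V), U; split => //; first by rewrite closedC.
  by move=> x; apply: contra_notP => /UV.
have -> : U `\` ~` V = V `\` ~` U by rewrite !setDE !setCK setIC.
rewrite measureD; [|exact: mopen|exact: mclosed|]; last first.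
  by rewrite ltey_eq fin_num_measure//; exact: mopen.
rewrite setIidr// leeBlDr; last exact: Pf.
by rewrite addeC; exact: ltW Pk.
Qed.

Let regular_bigcup (A : (set E)^nat) :
  (forall k, regular (A k)) -> regular (\bigcup_k A k).
Proof.
move=> rA e e0.
(* One half of [e] is spread geometrically over the pieces; the other half pays for truncating the
   union of the inner sets. *)
have e20 : 0 < e / 2 by rewrite divr_gt0.
have ek k : 0 < (e / 2) / (2 ^ k.+1)%:R by rewrite divr_gt0// ltr0n expn_gt0.
have [F FP] := choice (fun k => rA k _ (ek k)).
have [G GP] := choice FP; clear FP.
have mF k : measurable (F k : set (borel E)) by have [? _ _ _ _] := GP k; exact: mclosed.
have mG k : measurable (G k : set (borel E)) by have [_ ? _ _ _] := GP k; exact: mopen.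
pose H := \bigcup_k F k; pose O := \bigcup_k G k.
have mH : measurable (H : set (borel E)) by exact: bigcupT_measurable.
have mO : measurable (O : set (borel E)) by exact: bigcupT_measurable.
have OH : (P (O `\` H) <= (e / 2)%:E)%E.
  apply: (@le_trans _ _ (\sum_(0 <= k <oo) P (G k `\` F k))%E).
    apply: measure_sigma_subadditive.
    - by move=> k; exact: measurableD.
    - exact: measurableD.
    - move=> x [[k _ Gk] Hx]; exists k => //; split => // Fk; apply: Hx.
      by exists k.
  apply: (le_trans _ (le_trans (@epsilon_trick R (fun=> 0%E) (e / 2) xpredT _ _) _)) => //.
  - apply: lee_nneseries => // k _; rewrite add0e.
    by have [_ _ _ _] := GP k.
  - exact: ltW.
  - by rewrite eseries0// add0e.
(* The union [H] of all [F k] need not be closed. Finite unions are, and the part of [H] that they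
   miss decreases to the empty set. *)
pose D N := H `\` \big[setU/set0]_(k < N) F k.
have mU N : measurable (\big[setU/set0]_(k < N) F k : set (borel E)).
  exact: bigsetU_measurable.
have mD N : measurable (D N : set (borel E)) by exact: measurableD.
have : P (D N) @[N --> \oo] --> P (\bigcap_N D N).
  apply: nonincreasing_cvg_mu => //.
  - by rewrite (le_lt_trans (probability_le1 _ _))// ltry.
  - exact: bigcapT_measurable.
  - move=> i j ij; apply/subsetPset; apply: setDS.
    exact: subset_bigsetU.
rewrite (_ : \bigcap_N D N = set0); last first.
  apply/seteqP; split=> // x Dx; have [[k _ Fk] _] := Dx 0%N Logic.I.
  have [_ []] := Dx k.+1 Logic.I; rewrite -bigcup_mkord; exists k => //=.
rewrite measure0 => h.
have lt : (0%:E < (e / 2)%:E)%E by rewrite lte_fin.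
have [N _ /(_ N (leqnn N)) /= PN] := cvge_lt _ h lt.
exists (\big[setU/set0]_(k < N) F k), O; split.
- by apply: closed_bigsetU => k _; have [] := GP k.
- by apply: bigcup_open => k _; have [] := GP k.
- rewrite -bigcup_mkord => x [k _ Fk]; exists k => //.
  by have [_ _ FA _ _] := GP k; exact: FA.
- by move=> x [k _ Ak]; exists k => //; have [_ _ _ AG _] := GP k; exact: AG.
apply: (@le_trans _ _ (P ((O `\` H) `|` D N))).
  apply: le_measure; rewrite ?inE.
  - exact: measurableD.
  - by apply: measurableU => //; exact: measurableD.
  - move=> x [Ox Fx]; have [Hx|Hx] := pselect (H x); [by right|by left].
have mOH : measurable (O `\` H : set (borel E)) by exact: measurableD.
apply: (le_trans (measureU2 P mOH (mD N))).
by rewrite (splitr e) EFinD; apply: leeD => //; exact: ltW.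
Qed.

(** The sets with this property form a sigma-algebra that contains the open sets; under complement
    the inner closed set and the outer open set exchange roles. *)
Lemma borel_regular (A : set (borel E)) (e : R) : measurable A -> 0 < e ->
  exists F G : set E,
  [/\ closed F, open G, F `<=` A, A `<=` G & (P (G `\` F) <= e%:E)%E].
Proof.
move=> mA; suff H : <<s @open E >> `<=` regular by exact: (H A mA).
apply: smallest_sub; last exact: regular_open.
split.
- move=> d d0; exists set0, set0; split => //; [exact: closed0|].
  by rewrite setD0 measure0 lee_fin ltW.
- move=> B rB d d0; have [F [G [cF oG FB BG PGF]]] := rB d d0.
  exists (~` G), (~` F); split.
  + by rewrite closedC.
  + by rewrite openC.
  + by move=> x Gx; split => // /BG.
  + by move=> x [_ Bx] /FB.
  + by rewrite setDE setCK setIC -setDE.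
- exact: regular_bigcup.
Qed.

(** Cutting the inner closed set by the ball that carries [P] makes it compact and costs no mass. *)
Lemma borel_compact_open (r : R) (A : set (borel E)) (e : R) :
  P (~` [set x : E | enorm x <= r]) = 0%E -> measurable A -> 0 < e ->
  exists K G : set E, [/\ compact K, open G,
   K `<=` A /\ A `<=` G, (P (A `\` K) <= e%:E)%E & (P (G `\` A) <= e%:E)%E].
Proof.
move=> Pr mA e0; have [F [G [cF oG FA AG PGF]]] := borel_regular mA e0.
set B := [set x | _] in Pr.
have cB : compact B by exact: enorm_compact.
have mB : measurable (B : set (borel E)) by apply: mclosed; exact: enorm_closed.
have mF := mclosed cF; have mG := mopen oG.
exists (F `&` B), G; split => //.
- rewrite setIC; apply: compact_closedI => //.
- by split => // x [/FA].
- apply: (@le_trans _ _ (P ((G `\` F) `|` ~` B))).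
    apply: le_measure; rewrite ?inE.
    + by apply: measurableD => //; exact: measurableI.
    + by apply: measurableU; [exact: measurableD|exact: measurableC].
    + move=> x [Ax /not_andP[Fx|Bx]]; [left; split => //; exact: AG|by right].
  have m1 : measurable (G `\` F : set (borel E)) by exact: measurableD.
  have m2 : measurable (~` B : set (borel E)) by exact: measurableC.
  apply: (le_trans (measureU2 P m1 m2)).
  by rewrite [X in (_ + X)%E]Pr adde0.
- apply: le_trans PGF; apply: le_measure; rewrite ?inE.
  + exact: measurableD.
  + exact: measurableD.
  + exact: setDS.
Qed.

End regularity.

(** * The semiring of measurable rectangles *)

Section measurable_rectangles.
Context (R : realType) (n : nat).
Local Notation E := 'rV[R]_n.
Local Notation TE := (E * E)%type.

(* A copy of [TE] that carries the semiring of measurable rectangles. *)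
Definition rect : Type := TE.

Definition measurable_rect : set (set rect) :=
  [set C | exists A B : set (borel E),
    [/\ measurable A, measurable B & C = A `*` B]].

Lemma measurable_rect0 : measurable_rect set0.
Proof. by exists set0, set0; split => //; rewrite setX0. Qed.

Lemma measurable_rectI : setI_closed measurable_rect.
Proof.
move=> _ _ [A [B [mA mB ->]]] [C [D [mC mD ->]]].
exists (A `&` C), (B `&` D); split; [exact: measurableI|exact: measurableI|].
by apply/seteqP; split=> -[x y] /=; [move=> [[? ?] [? ?]]|move=> [[? ?] [? ?]]].
Qed.

Lemma measurable_rectD : semi_setD_closed measurable_rect.
Proof.
move=> _ _ [A [B [mA mB ->]]] [C [D [mC mD ->]]].
pose X := (A `\` C) `*` B; pose Y := (A `&` C) `*` (B `\` D).
exists [set X; Y]; split.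
- exact: finite_set2.
- move=> _ [->|->].
    by exists (A `\` C), B; split => //; exact: measurableD.
  by exists (A `&` C), (B `\` D); split => //; [exact: measurableI|exact: measurableD].
- rewrite bigcup_setU !bigcup_set1; apply/seteqP; split=> -[x y].
    move=> [[/= Ax By] CD]; have [Cx|Cx] := pselect (C x); last by left.
    by right; split => //; split => // Dy; apply: CD.
  by move=> [[[Ax Cx] By]|[[Ax Cx] [By Dy]]]; split => //; move=> [].
- by move=> _ _ [->|->] [->|->] //; move=> [[x y] [[[? ?] ?] [[? ?] ?]]].
Qed.

HB.instance Definition _ := Pointed.on rect.
HB.instance Definition _ := isSemiRingOfSets.Build default_measure_display rect
  measurable_rect0 measurable_rectI measurable_rectD.

Lemma measurable_rect_borel (C : set rect) :
  measurable C -> measurable (C : set (borel TE)).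
Proof. by move=> [A [B [mA mB ->]]]; exact: measurable_setX_borel. Qed.

(** Caratheodory yields a measure on the sigma-algebra generated by rectangles; pushing it by this
    identity makes it a Borel measure on the product. *)
Lemma measurable_id_rect : measurable_fun setT
  ((fun p => p) : g_sigma_algebraType (@measurable _ rect) -> borel TE).
Proof.
apply: (@measurability _ _ (g_sigma_algebraType (@measurable _ rect)) (borel TE)
  setT _ (@open TE)) => //.
move=> _ [U oU <-]; rewrite setTI preimage_id (open_prod_bigcup oU).
apply: measurable_countable_union => ij _; apply: sub_sigma_algebra.
by exists (rational_box ij.1), (rational_box ij.2);
  split => //; exact: measurable_rational_box.
Qed.

End measurable_rectangles.

Lemma ler_cvg_filter (R : realType) (T : Type) (F : set_system T)
    (PF : ProperFilter F) (f g : T -> R) (l l' : R) :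
  f @ F --> l -> g @ F --> l' -> (forall t, f t <= g t) -> l <= l'.
Proof.
move=> fl gl fg; rewrite -subr_ge0.
apply: (@closed_cvg _ _ F _ (fun t => g t - f t) [set x | 0 <= x]).
- exact: closed_ge.
- by apply: filterE => t /=; rewrite subr_ge0.
- exact: cvgB.
Qed.

(** * Limits of couplings along an ultrafilter *)

Section coupling_limit.
Context (R : realType) (n : nat).
Local Notation E := 'rV[R]_n.
Local Notation TE := (E * E)%type.
Context (mu nu : Prob R E) (tau : nat -> Prob R TE).
Context (U : set_system nat) (UF : UltraFilter U).
Hypothesis ctau : forall k, coupling mu nu (tau k).

(* The absolute value makes it nonnegative on non-measurable sets too, where the
   limit along [U] need not exist. *)
Definition ultralim (A : set TE) : R :=
  `| lim ((fine (tau k A) : R^o) @[k --> U]) |.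

Let fin_tau k (A : set TE) : measurable (A : set (borel TE)) ->
  tau k A = (fine (tau k A))%:E.
Proof. by move=> mA; rewrite fineK//; exact: fin_num_measure. Qed.

(** The masses lie in the compact interval [0, 1], where the image ultrafilter has a limit. That
    limit is nonnegative, so the absolute value in [ultralim] leaves it unchanged. *)
Lemma ultralim_cvg (A : set TE) : measurable (A : set (borel TE)) ->
  (fine (tau k A) : R^o) @[k --> U] --> (ultralim A : R^o).
Proof.
move=> mA; set u : nat -> R^o := fun k => fine (tau k A).
have cI : compact (`[0, 1]%classic : set R^o) by exact: segment_compact.
have u01 k : `[0, 1]%classic (u k).
  rewrite /= in_itv /= fine_ge0//= -lee_fin -fin_tau//.
  exact: probability_le1.
have [l [l01 ul]] : exists l : R^o, `[0, 1]%classic l /\ u @ U --> l.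
  have UuF : UltraFilter (u @ U).
    split; first exact: fmap_proper_filter.
    move=> G PG uG; apply/seteqP; split=> // B GB; apply: contrapT => nB.
    have := @in_ultra_setVsetC _ U (u @^-1` B) UF.
    move=> [//|h]; have GC : G (~` B) by apply: uG; rewrite /nbhs/= preimage_setC.
    by have := filterI GB GC; rewrite setICr => G0; exact: (filter_not_empty G (G0 _)).
  move: cI; rewrite compact_ultra => /(_ _ UuF) [|l [l01 ul]].
    by exact: (@filterE _ U).
  by exists l.
have -> : ultralim A = l; last exact: ul.
rewrite /ultralim (cvg_lim _ ul)// ger0_norm//.
by move: l01; rewrite /= in_itv/= => /andP[].
Qed.

Lemma ultralim_ge0 A : 0 <= ultralim A.
Proof. exact: normr_ge0. Qed.

Lemma ultralim_le (A B : set TE) (c : R) :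
  measurable (A : set (borel TE)) -> measurable (B : set (borel TE)) ->
  (forall k, fine (tau k A) <= fine (tau k B) + c) -> ultralim A <= ultralim B + c.
Proof.
move=> mA mB AB.
apply: (@ler_cvg_filter _ _ U _ (fun k => fine (tau k A)) (fun k => fine (tau k B) + c)).
- exact: ultralim_cvg.
- by apply: cvgD; [exact: ultralim_cvg|exact: cvg_cst].
- exact: AB.
Qed.

Lemma ultralim_cst (A : set TE) (c : R) : measurable (A : set (borel TE)) ->
  (forall k, tau k A = c%:E) -> ultralim A = c.
Proof.
move=> mA Ac; have := ultralim_cvg mA.
rewrite (_ : (fun k => _) = fun=> c); last by apply/funext => k; rewrite Ac.
by move=> /cvg_unique; apply => //; exact: cvg_cst.
Qed.

Lemma ultralim_bigsetU (F : nat -> set TE) N :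
  (forall k, measurable (F k : set (borel TE))) -> trivIset setT F ->
  ultralim (\big[setU/set0]_(k < N) F k) = \sum_(k < N) ultralim (F k).
Proof.
move=> mF tF; have mU : measurable (\big[setU/set0]_(k < N) F k : set (borel TE)).
  exact: bigsetU_measurable.
have := ultralim_cvg mU.
rewrite (_ : (fun k => _) = fun k => \sum_(i < N) fine (tau k (F i))); last first.
  apply/funext => k; rewrite (measure_semi_additive_ord_I (tau k))//; last exact: sub_trivIset tF.
  rewrite (eq_bigr (fun i : 'I_N => (fine (tau k (F i)))%:E)) ?sumEFin//.
  by move=> i _; exact: fin_tau.
move=> /cvg_unique; apply => //.
apply: (@cvg_big _ _ +%R 0 xpredT add_continuous) => i _.
exact: ultralim_cvg.
Qed.

Lemma ultralim_bigsetU_le (F : nat -> set TE) N :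
  (forall k, measurable (F k : set (borel TE))) ->
  ultralim (\big[setU/set0]_(k < N) F k) <= \sum_(k < N) ultralim (F k).
Proof.
move=> mF; have mU : measurable (\big[setU/set0]_(k < N) F k : set (borel TE)).
  exact: bigsetU_measurable.
apply: (@ler_cvg_filter _ _ U _ (fun k => fine (tau k (\big[setU/set0]_(k < N) F k)))
   (fun k => \sum_(i < N) fine (tau k (F i)))).
- exact: ultralim_cvg.
- apply: (@cvg_big _ _ +%R 0 xpredT add_continuous) => i _.
  exact: ultralim_cvg.
- move=> k; rewrite -lee_fin -fin_tau// -sumEFin.
  rewrite (eq_bigr (fun i : 'I_N => tau k (F i))); last first.
    by move=> i _; rewrite -fin_tau.
  exact: Boole_inequality.
Qed.

(* The marginals of the couplings do not depend on [k], so that the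
   approximation of a rectangle by a compact one inside and an open one outside
   is uniform in [k] and survives in the limit. *)
Lemma ultralim_rect (A B A' B' : set (borel E)) (c d : R) :
  measurable A -> measurable B -> measurable A' -> measurable B' ->
  (mu (A `\` A') <= c%:E)%E -> (nu (B `\` B') <= d%:E)%E ->
  ultralim (A `*` B) <= ultralim (A' `*` B') + (c + d).
Proof.
move=> mA mB mA' mB' Ac Bd.
have mX := measurable_setX_borel mA mB; have mX' := measurable_setX_borel mA' mB'.
apply: ultralim_le => // k; rewrite -lee_fin EFinD -!fin_tau//.
have mfst : measurable (fst @^-1` (A `\` A') : set (borel TE)).
  rewrite -[X in measurable X]setTI; apply: measurable_fst_borel => //.
  exact: measurableD.
have msnd : measurable (snd @^-1` (B `\` B') : set (borel TE)).
  rewrite -[X in measurable X]setTI; apply: measurable_snd_borel => //.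
  exact: measurableD.
have mfs := measurableU _ _ mfst msnd.
apply: (@le_trans _ _ (tau k ((A' `*` B') `|`
    ((fst @^-1` (A `\` A')) `|` (snd @^-1` (B `\` B')))))).
  apply: le_measure; rewrite ?inE//; first exact: measurableU.
  move=> [x y] [/= Ax By]; have [A'x|A'x] := pselect (A' x); last by right; left.
  by have [B'y|B'y] := pselect (B' y); [left|right; right].
have [c1 c2] := ctau k.
have Ac' : (tau k (fst @^-1` (A `\` A')) <= c%:E)%E.
  by rewrite c1//; exact: measurableD.
have Bd' : (tau k (snd @^-1` (B `\` B')) <= d%:E)%E.
  by rewrite c2//; exact: measurableD.
apply: (le_trans (measureU2 _ mX' mfs)); apply: leeD => //.
by apply: (le_trans (measureU2 _ mfst msnd)); rewrite EFinD; exact: leeD.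
Qed.

End coupling_limit.

(** * Grids *)

Section grid.
Context (R : realType) (n : nat).
Local Notation E := 'rV[R]_n.

Definition grid_floor (m : nat) (x : E) : E :=
  \row_j ((Num.floor (m%:R * x 0 j))%:~R / m%:R).

Lemma cell_floor (m : nat) (x z : E) : (0 < m)%N ->
  (forall j, exists a : int, x 0 j = a%:~R / m%:R) ->
  cell m x z -> grid_floor m z = x.
Proof.
move=> m0 gx xz; apply/rowP => j; rewrite mxE.
have [a ax] := gx j; have := xz j; rewrite ax.
have mp : 0 < (m%:R : R) by rewrite ltr0n.
move=> /andP[h1 h2]; congr (_%:~R / _); apply: floor_def.
rewrite intrD mulrC -ler_pdivrMr// h1/= -ltr_pdivlMr// mulrDl.
by rewrite [1%:~R / _]mul1r.
Qed.

Lemma grid_floor_cell (m : nat) (x : E) : (0 < m)%N -> cell m (grid_floor m x) x.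
Proof.
move=> m0 j; rewrite /grid_floor mxE.
have mp : 0 < (m%:R : R) by rewrite ltr0n.
have /andP[h1 h2] := floor_itv (m%:R * x 0 j).
rewrite ler_pdivrMr// [x 0 j * _]mulrC h1/=.
rewrite -[X in _ < _ + X]mul1r -mulrDl ltr_pdivlMr// [x 0 j * _]mulrC.
by move: h2; rewrite intrD.
Qed.

Lemma lattice_point_grid (N m : nat) (i : lattice n N m) j : (0 < m)%N ->
  exists a : int, lattice_point R i 0 j = a%:~R / m%:R.
Proof.
move=> m0; exists ((i j)%:Z - (N * m)%:Z); rewrite mxE rmorphB/= mulrBl.
congr (_ - _); rewrite -pmulrn natrM mulfK//.
by rewrite pnatr_eq0 -lt0n.
Qed.

Lemma grid_floor_grid (m : nat) (x : E) j :
  exists a : int, grid_floor m x 0 j = a%:~R / m%:R.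
Proof. by rewrite mxE; eexists. Qed.

Lemma cellE (m : nat) (x z : E) : (0 < m)%N ->
  (forall j, exists a : int, x 0 j = a%:~R / m%:R) ->
  cell m x z <-> grid_floor m z = x.
Proof.
move=> m0 gx; split=> [|<-]; last exact: grid_floor_cell.
exact: cell_floor.
Qed.

Lemma lattice_point_inj (N m : nat) : (0 < m)%N ->
  injective (@lattice_point R n N m).
Proof.
move=> m0 i i' /rowP ii'; apply/ffunP => j; apply/val_inj => /=.
have := ii' j; rewrite !mxE => /addIr /mulIf.
rewrite invr_eq0 pnatr_eq0 -lt0n => /(_ m0) /eqP.
by rewrite eqr_nat => /eqP.
Qed.

Lemma grid_lattice (N m : nat) (x : E) : (0 < m)%N ->
  (forall j, exists a : int, x 0 j = a%:~R / m%:R) ->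
  (forall j, `|x 0 j| <= N%:R) -> exists i : lattice n N m, lattice_point R i = x.
Proof.
move=> m0 gx xN; have mp : 0 < (m%:R : R) by rewrite ltr0n.
have H j : exists k : 'I_(2 * (N * m)).+1, (k%:R / m%:R - N%:R : R) = x 0 j.
  have [a ax] := gx j; have := xN j; rewrite ler_norml ax => /andP[].
  rewrite ler_pdivlMr// ler_pdivrMr// => h1 h2.
  have a1 : 0 <= a + (N * m)%:Z.
    by rewrite -(ler_int R) rmorphD/= -pmulrn natrM; lra.
  have a2 : a + (N * m)%:Z <= (2 * (N * m))%:Z.
    by rewrite -(ler_int R) rmorphD/= -!pmulrn !natrM; lra.
  have ka : (absz (a + (N * m)%:Z)%R < (2 * (N * m)).+1)%N.
    by rewrite ltnS -lez_nat gez0_abs.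
  exists (Ordinal ka) => /=; rewrite pmulrn gez0_abs// rmorphD/= -pmulrn natrM.
  by rewrite mulrDl mulfK ?addrK// gt_eqF.
have [k kx] := choice H; exists [ffun j => k j].
by apply/rowP => j; rewrite mxE ffunE kx.
Qed.

Lemma grid_floor_lattice (N m : nat) (x : E) : (0 < m)%N ->
  (forall j, `|x 0 j| <= N%:R) ->
  exists i : lattice n N m, lattice_point R i = grid_floor m x.
Proof.
move=> m0 xN; have mp : 0 < (m%:R : R) by rewrite ltr0n.
apply: grid_lattice => // j; first exact: grid_floor_grid.
have := xN j; rewrite !ler_norml mxE => /andP[h1 h2].
rewrite ler_pdivlMr// ler_pdivrMr//; apply/andP; split; last first.
  by rewrite (le_trans (floor_le _))// mulrC ler_wpM2r// ltW.
have -> : - N%:R * m%:R = (- (N * m)%:Z)%:~R :> R.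
  by rewrite rmorphN/= -pmulrn natrM mulNr.
by rewrite ler_int floor_ge_int rmorphN/= -pmulrn natrM mulrC -mulrN ler_wpM2l// ltW.
Qed.

Lemma lattice_cell (N m : nat) (x : E) (i : lattice n N m) : (0 < m)%N ->
  cell m (lattice_point R i) x <-> grid_floor m x = lattice_point R i.
Proof. by move=> m0; apply: cellE => // j; exact: lattice_point_grid. Qed.

Lemma cell_enorm (m : nat) (x y z : E) :
  cell m z x -> cell m z y -> enorm (x - y) <= n%:R * m%:R^-1.
Proof.
move=> zx zy; apply: enorm_le_const => j; rewrite !mxE.
by have := zx j; have := zy j; rewrite ler_norml; lra.
Qed.

Lemma enorm_grid_floor (m : nat) (x : E) : (0 < m)%N ->
  enorm (x - grid_floor m x) <= n%:R * m%:R^-1.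
Proof.
move=> m0; apply: (@cell_enorm m _ _ (grid_floor m x)); first exact: grid_floor_cell.
by move=> j; rewrite lexx ltrDl invr_gt0 ltr0n.
Qed.

Lemma cell_measurable (m : nat) (x : E) : measurable (cell m x : set (borel E)).
Proof.
rewrite (_ : cell m x = \bigcap_(j in [set: 'I_n])
   [set y : E | `[x 0 j, x 0 j + m%:R^-1[%classic (y 0 j)]); last first.
  by apply/seteqP; split=> y h j; have := h j; rewrite /= in_itv/=; [|apply].
apply: fin_bigcap_measurable => // j _.
have := @continuous_measurable_real R E (fun y : E => y 0 j) (@coord_continuous _ _ _ 0 j).
move=> /(_ measurableT _ (measurable_itv `[x 0 j, x 0 j + m%:R^-1[)).
by rewrite setTI.
Qed.

(* Measurable because it takes countably many values, whatever [g] is. *)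
Lemma measurable_grid_fun (m : nat) (X : ptopologicalType) (g : E -> borel X) :
  (0 < m)%N ->
  measurable_fun setT ((fun x => g (grid_floor m x)) : borel E -> borel X).
Proof.
move=> m0 _ A mA; rewrite setTI.
pose p (a : 'rV[int]_n) : E := \row_j ((a 0 j)%:~R / m%:R).
rewrite (_ : _ @^-1` A = \bigcup_(a in [set a | A (g (p a))]) cell m (p a)).
  by apply: measurable_countable_union => a _; exact: cell_measurable.
apply/seteqP; split=> x.
  move=> Ax; exists (\row_j Num.floor (m%:R * x 0 j)) => /=.
    rewrite (_ : p _ = grid_floor m x)//.
    by apply/rowP => j; rewrite !mxE.
  rewrite (_ : p _ = grid_floor m x); first exact: grid_floor_cell.
  by apply/rowP => j; rewrite !mxE.
move=> [a /= Aa ax]; rewrite (_ : grid_floor m x = p a)//.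
apply/cellE => // j; rewrite mxE; by eexists.
Qed.

End grid.

(** * Optimal couplings *)

Section probability_of_measure.
Context d (T : measurableType d) (R : realType) (m : {measure set T -> \bar R}).
Hypothesis m1 : m setT = 1%E.

(** Carrying the proof of total mass 1 as an argument lets the probability structure be attached to
    this function. *)
Definition measure_probability (_ : m setT = 1%E) : set T -> \bar R := m.

HB.instance Definition _ := Measure.copy (measure_probability m1) m.
HB.instance Definition _ :=
  Measure_isProbability.Build _ _ _ (measure_probability m1) m1.

Definition probability_of_measure : probability T R := measure_probability m1.

End probability_of_measure.

(** * From the ultralimit to a coupling *)

Section ultralimit_coupling.
Context (R : realType) (n : nat).
Local Notation E := 'rV[R]_n.
Local Notation TE := (E * E)%type.
Context (mu nu : Prob R E) (tau : nat -> Prob R TE).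
Context (U : set_system nat) (UF : UltraFilter U).
Hypothesis ctau : forall k, coupling mu nu (tau k).
Context (r : R).
Hypothesis mur : mu (~` [set x : E | enorm x <= r]) = 0%E.
Hypothesis nur : nu (~` [set x : E | enorm x <= r]) = 0%E.

Let m (C : set (rect R n)) : \bar R := (ultralim tau U C)%:E.

Let m_additive : measure_function.semi_additive m.
Proof.
move=> F N mF tF _; rewrite /m (ultralim_bigsetU tau UF)//; first by rewrite sumEFin.
by move=> k; exact: measurable_rect_borel.
Qed.

(** Compactness reduces countable covers to finite ones: [A] is shrunk to a compact rectangle, each
    [F i] is enlarged to an open one, and a finite subcover is handled by finite subadditivity of
    the ultralimit. The two sides of [A] lose [e / 4] each; the two sides of [F i] gain
    [e / 4 / 2 ^ (i + 1)] each, which sums to the other [e / 2]. *)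
Let m_sigma_subadditive : measurable_subset_sigma_subadditive m.
Proof.
move=> A F mF mA AF.
have m0 i : (0 <= m (F i))%E by rewrite lee_fin ultralim_ge0.
apply/lee_addgt0Pr => e e0; have [A1 [A2 [mA1 mA2 AE]]] := mA.
have e40 : 0 < e / 4 by rewrite divr_gt0.
have [K1 [_ [cK1 _ [K1A _] PK1 _]]] := borel_compact_open mur mA1 e40.
have [K2 [_ [cK2 _ [K2A _] PK2 _]]] := borel_compact_open nur mA2 e40.
have mK1 : measurable (K1 : set (borel E)).
  by apply: closed_borel; apply: compact_closed => //; exact: norm_hausdorff.
have mK2 : measurable (K2 : set (borel E)).
  by apply: closed_borel; apply: compact_closed => //; exact: norm_hausdorff.
have H i : exists O : set TE, [/\ open O, F i `<=` O,
    measurable (O : set (borel TE)) &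
    ultralim tau U O <= ultralim tau U (F i) + (e / 2) / (2 ^ i.+1)%:R].
  have [B1 [B2 [mB1 mB2 ->]]] := mF i.
  have ei : 0 < (e / 4) / (2 ^ i.+1)%:R by rewrite divr_gt0// ltr0n expn_gt0.
  have [_ [V1 [_ oV1 [_ BO1] _ PO1]]] := borel_compact_open mur mB1 ei.
  have [_ [V2 [_ oV2 [_ BO2] _ PO2]]] := borel_compact_open nur mB2 ei.
  have mO1 := open_borel oV1; have mO2 := open_borel oV2.
  exists (V1 `*` V2); split.
  - rewrite (_ : V1 `*` V2 = (fst @^-1` V1) `&` (snd @^-1` V2)); last first.
      by apply/seteqP; split.
    by apply: openI; apply: open_comp => // p _; [exact: cvg_fst|exact: cvg_snd].
  - by move=> -[x y] [/= /BO1 ? /BO2].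
  - exact: measurable_setX_borel.
  - apply: (le_trans (ultralim_rect UF ctau mO1 mO2 mB1 mB2 PO1 PO2)).
    by rewrite lerD2l -mulrDl -mulrDr; lra.
have [V OP] := choice H.
have mO i : measurable (V i : set (borel TE)) by have [] := OP i.
have cK : compact (K1 `*` K2) by exact: compact_setX.
have [D _ KD] : finite_subset_cover [set: nat] V (K1 `*` K2).
  move: cK; rewrite compact_cover; apply.
    by move=> i _; have [] := OP i.
  move=> [x y] [/= /K1A A1x /K2A A2y].
  have : A (x, y) by rewrite AE.
  by move=> /AF[i _ Fi]; exists i => //; have [_ + _ _] := OP i; apply.
have /finite_seqP[s DE] := finite_fset D.
pose N := (\max_(i <- s) i).+1%N.
have KO : K1 `*` K2 `<=` \big[setU/set0]_(i < N) V i.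
  move=> p /KD[i]; rewrite DE => /= si Oi; rewrite -bigcup_mkord; exists i => //=.
  by rewrite ltnS; apply: (@leq_bigmax_seq _ s xpredT id).
have mK : measurable (K1 `*` K2 : set (borel TE)) by exact: measurable_setX_borel.
have mOU : measurable (\big[setU/set0]_(i < N) V i : set (borel TE)).
  exact: bigsetU_measurable.
have h1 : ultralim tau U A <= ultralim tau U (K1 `*` K2) + (e / 4 + e / 4).
  by rewrite AE; apply: (ultralim_rect UF ctau).
have h2 : ultralim tau U (K1 `*` K2) <= \sum_(i < N) ultralim tau U (V i).
  rewrite -[leLHS]addr0; apply: le_trans (ultralim_bigsetU_le tau UF N mO).
  rewrite addr0 -[leRHS]addr0.
  apply: (ultralim_le UF mK mOU) => k; rewrite addr0.
  by apply: fine_le; [exact: fin_num_measure|exact: fin_num_measure|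
    by apply: le_measure; rewrite ?inE].
apply: (@le_trans _ _ ((\sum_(0 <= i <oo) (m (F i) + ((e / 2) / (2 ^ i.+1)%:R)%:E))
   + (e / 2)%:E)%E); last first.
  rewrite [in leRHS](splitr e) EFinD addeA; apply: leeD => //.
  by apply: epsilon_trick => //; rewrite ltW// divr_gt0.
apply: (@le_trans _ _ (\sum_(i < N) ultralim tau U (V i) + e / 2)%:E).
  by rewrite lee_fin; move: h1 h2; lra.
rewrite EFinD; apply: leeD => //; rewrite -sumEFin.
apply: (@le_trans _ _ (\sum_(0 <= i < N) (m (F i) + ((e / 2) / (2 ^ i.+1)%:R)%:E))%E).
  rewrite big_mkord; apply: lee_sum => i _; rewrite -EFinD lee_fin.
  by have [] := OP i.
apply: nneseries_lim_ge => i _ _; apply: adde_ge0 => //.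
by rewrite lee_fin ltW// !divr_gt0// ltr0n expn_gt0.
Qed.

Lemma ultralimit_coupling : exists t : Prob R TE, coupling mu nu t /\
  forall A B : set (borel E), measurable A -> measurable B ->
    t (A `*` B) = (ultralim tau U (A `*` B))%:E.
Proof.
have m_ge0 A : (0 <= m A)%E by rewrite lee_fin ultralim_ge0.
have [M ME] := measure_of_content m_ge0 m_additive m_sigma_subadditive.
have ME' (A B : set (borel E)) : measurable A -> measurable B ->
    measure_extension M (A `*` B) = (ultralim tau U (A `*` B))%:E.
  move=> mA mB; rewrite /measure_extension measurable_mu_extE; first by rewrite ME.
  by exists A, B.
have M1 : measure_extension M setT = 1%E.
  rewrite -setXTT ME'// (@ultralim_cst _ _ tau _ UF _ 1)//.
    exact: measurable_setX_borel.
  by move=> k; rewrite setXTT probability_setT.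
pose P := probability_of_measure M1.
pose T := mpush P (@measurable_id_rect R n).
have TE' (A B : set (borel E)) : measurable A -> measurable B ->
    T (A `*` B) = (ultralim tau U (A `*` B))%:E by exact: ME'.
(* A cylinder over [A] is a rectangle whose mass under [tau k] is [mu A] for all [k], so the limit
   has the same marginal. *)
have margl (A : set (borel E)) : measurable A -> T (fst @^-1` A) = mu A.
  move=> mA; have AE : A `*` setT = fst @^-1` A :> set TE.
    by apply/seteqP; split=> // p []//.
  rewrite -AE TE'// (@ultralim_cst _ _ tau _ UF _ (fine (mu A))).
  - by rewrite fineK//; exact: fin_num_measure.
  - exact: measurable_setX_borel.
  - move=> k; rewrite fineK; last exact: fin_num_measure.
    by rewrite AE; have [c1 _] := ctau k; exact: c1.
have margr (A : set (borel E)) : measurable A -> T (snd @^-1` A) = nu A.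
  move=> mA; have AE : setT `*` A = snd @^-1` A :> set TE.
    by apply/seteqP; split=> // p []//.
  rewrite -AE TE'// (@ultralim_cst _ _ tau _ UF _ (fine (nu A))).
  - by rewrite fineK//; exact: fin_num_measure.
  - exact: measurable_setX_borel.
  - move=> k; rewrite fineK; last exact: fin_num_measure.
    by rewrite AE; have [_ c2] := ctau k; exact: c2.
by exists T; split; [split|].
Qed.

End ultralimit_coupling.

Lemma integral_step d (T : measurableType d) (R : realType)
    (P : probability T R) (I : finType) (Q : I -> set T) (c : I -> R) :
  (forall i, measurable (Q i)) -> (forall i, 0 <= c i) ->
  (\int[P]_t (\sum_i c i * \1_(Q i) t)%:E = (\sum_i c i * fine (P (Q i)))%:E)%E.
Proof.
move=> mQ c0.
under eq_integral do rewrite -sumEFin.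
rewrite ge0_integral_sum//; first last.
- by move=> i t _; rewrite lee_fin mulr_ge0.
- move=> i; apply/measurable_EFinP; apply: measurable_funM.
    exact: measurable_cst.
  exact: measurable_indic.
rewrite -sumEFin; apply: eq_bigr => i _.
rewrite (@integralZl_indic _ _ _ P setT measurableT (fun=> Q i))//.
  by rewrite integral_indic// setIT EFinM fineK//; exact: fin_num_measure.
by rewrite ltNge c0.
Qed.

Lemma measurable_step d (T : measurableType d) (R : realType) (I : finType)
    (Q : I -> set T) (c : I -> R) : (forall i, measurable (Q i)) ->
  measurable_fun setT (fun t => \sum_i c i * \1_(Q i) t : R).
Proof.
move=> mQ; apply: measurable_sum => i; apply: measurable_funM.
  exact: measurable_cst.
exact: measurable_indic.
Qed.

(** * Existence of an optimal coupling *)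

Section optimal_coupling.
Context (R : realType) (n : nat).
Local Notation E := 'rV[R]_n.
Local Notation TE := (E * E)%type.

Section grid_cost.
Context (N m : nat) (m0 : (0 < m)%N).

Let I : finType := (lattice n N m * lattice n N m)%type.
Let Q (i : I) : set TE :=
  cell m (lattice_point R i.1) `*` cell m (lattice_point R i.2).
Let c (i : I) : R := enorm (lattice_point R i.1 - lattice_point R i.2).

(** The cost with both points rounded down to the grid: a finite combination of masses of
    rectangles. The argument is a bare set function because [ultralim] has to be a possible
    value. *)
Definition grid_cost (q : set TE -> R) : R := \sum_(i : I) c i * q (Q i).

Let mQ i : measurable (Q i : set (borel TE)).
Proof. by apply: measurable_setX_borel; exact: cell_measurable. Qed.

Let step (p : TE) : R := \sum_(i : I) c i * \1_(Q i) p.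

Let step_close (p : TE) : enorm p.1 <= N%:R -> enorm p.2 <= N%:R ->
  `|enorm (p.1 - p.2) - step p| <= 2 * (n%:R * m%:R^-1).
Proof.
move=> p1 p2.
have H (x : E) : enorm x <= N%:R -> exists i : lattice n N m,
    lattice_point R i = grid_floor m x.
  move=> xN; apply: grid_floor_lattice => // j.
  exact: le_trans (coord_le_enorm x j) xN.
have [i ip] := H _ p1; have [j jp] := H _ p2.
have -> : step p = enorm (grid_floor m p.1 - grid_floor m p.2).
  rewrite /step (bigD1 (i, j))//= big1 ?addr0.
    rewrite /c/= ip jp indicE mem_set ?mulr1//.
    by split => /=; rewrite ?ip ?jp; exact: grid_floor_cell.
  move=> [i' j'] ij; rewrite indicE memNset ?mulr0//.
  move=> [/= /(lattice_cell _ _ m0) i'p /(lattice_cell _ _ m0) j'p].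
  move/negP : ij; apply; apply/eqP; congr pair; apply: (@lattice_point_inj R n N m m0).
    by rewrite -i'p.
  by rewrite -j'p.
have := enorm_grid_floor p.1 m0; have := enorm_grid_floor p.2 m0.
set a := grid_floor m p.1; set b := grid_floor m p.2.
have := ler_enorm_dist p.1 a p.2; have := ler_enorm_dist a b p.2.
have := ler_enorm_dist a p.1 b; have := ler_enorm_dist p.1 p.2 b.
rewrite (enormB a p.1) (enormB b p.2) => h1 h2 h3 h4 h5 h6.
by rewrite ler_norml; lra.
Qed.

(** Rounding moves each of the two points by at most n/m, hence changes their distance by at most
    2n/m. The null set condition places almost all pairs in the region that the finite lattice
    covers. *)
Lemma grid_cost_close (P : Prob R TE) :
  P (~` ([set x | enorm x <= N%:R] `*` [set x | enorm x <= N%:R])) = 0%E ->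
  (cost P <= (grid_cost (fine \o P) + 2 * (n%:R * m%:R^-1))%:E)%E /\
  ((grid_cost (fine \o P))%:E <= cost P + (2 * (n%:R * m%:R^-1))%:E)%E.
Proof.
move=> P0; have d0 : 0 <= 2 * (n%:R * m%:R^-1) :> R by rewrite !mulr_ge0.
have mB : measurable ([set x : E | enorm x <= N%:R] : set (borel E)).
  by apply: closed_borel; exact: enorm_closed.
have mBB := measurable_setX_borel mB mB.
have mstep : measurable_fun setT (EFin \o step : borel TE -> \bar R).
  by apply/measurable_EFinP; exact: measurable_step.
have step0 p : 0 <= step p.
  by apply: sumr_ge0 => i _; rewrite mulr_ge0// enorm_ge0.
have costE : (\int[P]_p (step p)%:E)%E = (grid_cost (fine \o P))%:E.
  by rewrite integral_step// => i; exact: enorm_ge0.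
have ae (f g : TE -> \bar R) :
   (forall p : TE, enorm p.1 <= N%:R -> enorm p.2 <= N%:R -> (f p <= g p)%E) ->
   {ae P, forall p, setT p -> (f p <= g p)%E}.
  move=> fg; exists (~` ([set x | enorm x <= N%:R] `*` [set x | enorm x <= N%:R])).
  split => //; first exact: measurableC.
  move=> p /= fgp [p1 p2]; apply: fgp => _; exact: fg.
have intD (f : borel TE -> \bar R) : measurable_fun setT f -> (forall p, 0 <= f p)%E ->
   (\int[P]_p (f p + (2 * (n%:R * m%:R^-1))%:E) =
    \int[P]_p f p + (2 * (n%:R * m%:R^-1))%:E)%E.
  by move=> mf f0; rewrite ge0_integralD// integral_cst_probability.
have mc := @measurable_dist R n.
have c0 (p : TE) : (0 <= (enorm (p.1 - p.2))%:E)%E by rewrite lee_fin enorm_ge0.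
split.
- have <- : (\int[P]_p ((step p)%:E + (2 * (n%:R * m%:R^-1))%:E))%E =
      (grid_cost (fine \o P) + 2 * (n%:R * m%:R^-1))%:E.
    by rewrite (intD _ mstep)// EFinD -costE.
  apply: ae_ge0_le_integral => //.
  + by move=> p _; rewrite adde_ge0 ?lee_fin// step0.
  + by apply: emeasurable_funD => //; exact: measurable_cst.
  + apply: ae => p p1 p2; rewrite -EFinD lee_fin.
    by have := step_close p1 p2; rewrite ler_norml; lra.
- rewrite -costE -(intD _ mc)//; apply: ae_ge0_le_integral => //.
  + by move=> p _; rewrite lee_fin step0.
  + by move=> p _; rewrite adde_ge0.
  + by apply: emeasurable_funD => //; exact: measurable_cst.
  + apply: ae => p p1 p2; rewrite -EFinD lee_fin.
    by have := step_close p1 p2; rewrite ler_norml; lra.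
Qed.

End grid_cost.

Lemma grid_cost_cvg (N m : nat) (T : Type) (F : set_system T) (FF : Filter F)
    (q : T -> set TE -> R) (q' : set TE -> R) :
  (forall A B : set (borel E), measurable A -> measurable B ->
     q t (A `*` B) @[t --> F] --> q' (A `*` B)) ->
  grid_cost N m (q t) @[t --> F] --> grid_cost N m q'.
Proof.
move=> qq'; apply: (@cvg_big _ _ +%R 0 xpredT add_continuous) => i _.
by apply: cvgM; [exact: cvg_cst|apply: qq'; exact: cell_measurable].
Qed.

Theorem optimal_coupling_exists (mu nu : Prob R E) (r : R) :
  mu (~` [set x : E | enorm x <= r]) = 0%E ->
  nu (~` [set x : E | enorm x <= r]) = 0%E ->
  (W mu nu < +oo)%E ->
  exists2 tau, optimal_coupling mu nu tau & cost tau = W mu nu.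
Proof.
move=> mur nur Woo.
have W0 : (0 <= W mu nu)%E.
  apply: le_ereal_inf_tmp => _ [t _ <-]; apply: integral_ge0 => p _.
  by rewrite lee_fin enorm_ge0.
have [w wE] : exists w : R, W mu nu = w%:E.
  by exists (fine (W mu nu)); rewrite fineK// ge0_fin_numE.
have H k : exists t : Prob R TE, coupling mu nu t /\ (cost t < (w + k.+1%:R^-1)%:E)%E.
  have : (W mu nu < (w + k.+1%:R^-1)%:E)%E.
    by rewrite wE lte_fin ltrDl invr_gt0.
  by move=> /ereal_inf_lt[_ [t ct <-]] lt; exists t.
have [tau tauP] := choice H.
have ctau k : coupling mu nu (tau k) by have [] := tauP k.
(* [U] refines the filter of [nat] at infinity, so that [k.+1%:R^-1] still tends to 0 along it. *)
have [U [UF oU]] := ultraFilterLemma (eventually_filter).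
have [t [ct tE]] := ultralimit_coupling UF ctau mur nur.
suff tw : (cost t <= w%:E)%E.
  have tW : cost t = W mu nu.
    apply/eqP; rewrite eq_le wE tw/= -wE.
    by apply: ereal_inf_lbound; exists t.
  exists t => //; split => // t' ct'; rewrite tW.
  by apply: ereal_inf_lbound; exists t'.
pose N := (Num.truncn r).+1.
have rN : [set x : E | enorm x <= r] `<=` [set x : E | enorm x <= N%:R].
  by move=> x /= /le_trans; apply; exact/ltW/truncnS_gt.
have mB s : measurable ([set x : E | enorm x <= s] : set (borel E)).
  by apply: closed_borel; exact: enorm_closed.
have null (t' : Prob R TE) : coupling mu nu t' ->
    t' (~` ([set x | enorm x <= N%:R] `*` [set x | enorm x <= N%:R])) = 0%E.
  move=> c'; apply: (coupling_null c') => //.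
    apply: (subset_measure0 _ _ _ mur); [exact: measurableC|exact: measurableC|].
    exact: subsetC.
  apply: (subset_measure0 _ _ _ nur); [exact: measurableC|exact: measurableC|].
  exact: subsetC.
apply/lee_addgt0Pr => e e0.
(* The rounding error 2n/m is paid twice, once from [cost (tau k)] to its grid cost and once from
   the limiting grid cost to [cost t]; each payment is at most [e / 2]. *)
pose m := (Num.truncn (4 * n%:R / e)).+1.
have m0 : (0 < m)%N by [].
have me : 2 * (2 * (n%:R * m%:R^-1)) <= e.
  have mp : 0 < (m%:R : R) by rewrite ltr0n.
  have : 4 * n%:R / e < m%:R by exact: truncnS_gt.
  rewrite ltr_pdivrMr// => /ltW lt.
  by rewrite !mulrA ler_pdivrMr//; move: lt; lra.
set del := 2 * (n%:R * m%:R^-1) in me.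
have gt : grid_cost N m (fine \o t) = grid_cost N m (ultralim tau U).
  by apply: eq_bigr => i _; rewrite /= tE//; exact: cell_measurable.
have glim : grid_cost N m (ultralim tau U) <= w + del.
  apply: (@ler_cvg_filter _ _ U _ (fun k => grid_cost N m (fine \o tau k))
     (fun k => w + k.+1%:R^-1 + del)).
  - apply: grid_cost_cvg => A B mA mB'; apply: ultralim_cvg.
    exact: measurable_setX_borel.
  - apply: cvgD; last exact: cvg_cst.
    rewrite -[X in _ --> X]addr0; apply: cvgD; first exact: cvg_cst.
    by move=> A nA; apply: oU; exact: (@cvg_harmonic R A nA).
  - move=> k; have [_ ck] := tauP k.
    have [_ g2] := grid_cost_close m0 (null _ (ctau k)).
    rewrite -lee_fin; apply: (le_trans g2).
    by rewrite [in leRHS]EFinD; apply: leeD => //; exact: ltW.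
have [g1 _] := grid_cost_close m0 (null _ ct).
apply: (le_trans g1); rewrite -EFinD lee_fin gt -/del.
by move: glim me; lra.
Qed.

End optimal_coupling.

(** * Lipschitz vector fields are W-Lipschitz *)

Section lipschitz_on_balls.
Context (R : realType) (n : nat).
Local Notation E := 'rV[R]_n.
Local Notation TE := (E * E)%type.

(** Compactness of the set of pairs. Near a diagonal pair a local Lipschitz constant works. Near
    another pair the distance stays above half its value [del] and the increment of [v] below [M],
    so [M / (del / 2)] works. *)
Lemma locally_lipschitz_ball (v : E -> E) (r : R) : locally_lipschitz v ->
  exists2 L : R, 0 < L & forall x y, enorm x <= r -> enorm y <= r ->
    enorm (v x - v y) <= L * enorm (x - y).
Proof.
move=> lv; have cv := locally_lipschitz_continuous lv.
pose K := [set x : E | enorm x <= r] `*` [set x : E | enorm x <= r].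
have cK : compact K by apply: compact_setX; exact: enorm_compact.
pose P (L : R) (p : TE) := enorm (v p.1 - v p.2) <= L * enorm (p.1 - p.2).
have mono (L L' : R) p : L <= L' -> P L p -> P L' p.
  by move=> LL'; rewrite /P => /le_trans; apply; rewrite ler_wpM2r// enorm_ge0.
(* The filter parameter is the constant itself: the near-covering form of compactness makes bounds
   valid for all large [L] near each pair uniform over [K]. *)
have : \forall L \near +oo, K `<=` P L.
  move: cK => /compact_near_coveringP/(_ _ _ P) H; apply: H => -[c d] [/= cr dr].
  have [cd|cd] := eqVneq c d.
    rewrite -{d dr}cd; have [s s0 [L0 vL]] := lv c.
    have ball : \forall p \near (c, c), eball c s p.1 /\ eball c s p.2.
      have nc : nbhs c (eball c s).
        have oB : open (eball c s).
          apply: (open_comp (f := fun x : E => enorm (x - c))) (@open_lt R s) => x _.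
          apply: (@continuous_comp _ _ _ (fun x : E => x - c) (@enorm R n)).
            by apply: (@cvgB _ _ _ (nbhs x)); [exact: cvg_id|exact: cvg_cst].
          exact: continuous_enorm.
        by apply: open_nbhs_nbhs; split => //; rewrite /eball/= subrr enorm0.
      by exists (eball c s, eball c s).
    exists ([set p : TE | eball c s p.1 /\ eball c s p.2], [set L | L0 <= L]).
      by split => //=; apply: nbhs_pinfty_ge; exact: num_real.
    move=> [p L] /= [[p1 p2] L0L]; apply: (mono L0) => //.
    exact: vL.
  pose del := enorm (c - d).
  have del0 : 0 < del.
    rewrite lt_def enorm_ge0 andbT; apply: contra_neq cd => /enorm_eq0 /eqP.
    by rewrite subr_eq0 => /eqP.
  pose M := enorm (v c - v d) + 1.
  have cdist : {for (c, d), continuous (fun p : TE => enorm (p.1 - p.2))}.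
    apply: (@continuous_comp _ _ _ (fun p : TE => p.1 - p.2) (@enorm R n)).
      by apply: (@cvgB _ _ _ (nbhs (c, d))); [exact: cvg_fst|exact: cvg_snd].
    exact: continuous_enorm.
  have cvdist : {for (c, d), continuous (fun p : TE => enorm (v p.1 - v p.2))}.
    apply: (@continuous_comp _ _ _ (fun p : TE => v p.1 - v p.2) (@enorm R n)).
      apply: (@cvgB _ _ _ (nbhs (c, d))).
        by apply: (@continuous_comp _ _ _ fst v); [exact: cvg_fst|exact: cv].
      by apply: (@continuous_comp _ _ _ snd v); [exact: cvg_snd|exact: cv].
    exact: continuous_enorm.
  have near1 : \forall p \near (c, d), del / 2 < enorm (p.1 - p.2).
    by apply: (@cvgr_gt _ _ (nbhs (c, d)) _ _ _ cdist); rewrite /= -/del; lra.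
  have near2 : \forall p \near (c, d), enorm (v p.1 - v p.2) < M.
    by apply: (@cvgr_lt _ _ (nbhs (c, d)) _ _ _ cvdist); rewrite /M ltrDl.
  exists ([set p : TE | del / 2 < enorm (p.1 - p.2) /\ enorm (v p.1 - v p.2) < M],
    [set L | M / (del / 2) <= L]).
    by split => //=; [exact: filterI near1 near2|apply: nbhs_pinfty_ge; exact: num_real].
  move=> [p L] /= [[p1 p2] ML]; apply: (mono (M / (del / 2))) => //.
  rewrite /P (le_trans (ltW p2))//.
  have del20 : 0 < del / 2 by rewrite divr_gt0.
  rewrite -[leLHS](divfK (lt0r_neq0 del20)) ler_wpM2l//; last exact: ltW.
  by rewrite divr_ge0// ?(ltW del20)// /M addr_ge0// enorm_ge0.
move=> [M [Mr ML]]; exists (Num.max M 0 + 1).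
  by rewrite ltr_wpDl// le_max lexx orbT.
move=> x y xr yr; apply: (ML _ _ (x, y)); last by split.
by rewrite ltr_pwDr// le_max lexx.
Qed.

End lipschitz_on_balls.

Section W_lipschitz.
Context (R : realType) (n : nat).
Local Notation E := 'rV[R]_n.
Local Notation TE := (E * E)%type.

Lemma measurable_velocity_dist : measurable_fun setT
  ((fun q : (TE * TE)%type => (enorm (q.1.2 - q.2.2))%:E) :
     borel (TE * TE)%type -> \bar R).
Proof.
apply/measurable_EFinP; apply: continuous_measurable_real => q.
apply: (@continuous_comp _ _ _ (fun q : (TE * TE)%type => q.1.2 - q.2.2) (@enorm R n)).
  apply: (@cvgB _ _ _ (nbhs q)).
    by apply: (@continuous_comp _ _ _ fst snd); [exact: cvg_fst|exact: cvg_snd].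
  by apply: (@continuous_comp _ _ _ snd snd); exact: cvg_snd.
exact: continuous_enorm.
Qed.

Lemma continuous_graph2 (v : E -> E) : continuous v ->
  continuous (fun p : TE => ((p.1, v p.1), (p.2, v p.2))).
Proof.
move=> cv p.
have c1 : v p.1 @[p --> p] --> v p.1.
  by apply: (@continuous_comp _ _ _ fst v); [exact: cvg_fst|exact: cv].
have c2 : v p.2 @[p --> p] --> v p.2.
  by apply: (@continuous_comp _ _ _ snd v); [exact: cvg_snd|exact: cv].
apply: (@cvg_pair _ _ _ (nbhs p) (nbhs (p.1, v p.1)) (nbhs (p.2, v p.2))).
  by apply: (@cvg_pair _ _ _ (nbhs p) (nbhs p.1) (nbhs (v p.1))) => //; exact: cvg_fst.
by apply: (@cvg_pair _ _ _ (nbhs p) (nbhs p.2) (nbhs (v p.2))) => //; exact: cvg_snd.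
Qed.

Lemma pvf_of_field_W_lipschitz (v : E -> E) (lv : locally_lipschitz v) :
  locally_W_lipschitz (pvf_of_field lv).
Proof.
move=> r r0; have [K K0 vK] := locally_lipschitz_ball r lv.
exists K => // mu nu mur nur.
(* Since [K > 0], an infinite [W] makes the right-hand side infinite; otherwise an optimal coupling
   exists. *)
have [Woo|Woo] := eqVneq (W mu nu) +oo%E.
  by rewrite Woo gt0_muley ?lte_fin// leey.
pose B := [set x : E | enorm x <= r].
have mB : measurable (B : set (borel E)) by apply: closed_borel; exact: enorm_closed.
have null (m : Prob R E) : supp m `<=` eball 0 r -> m (~` B) = 0%E.
  move=> /supp_eball_null; apply: subset_measure0.
  - exact: measurableC.
  - by apply: measurableC; apply: open_borel; exact: enorm_open.
  - by apply: subsetC => x /= /ltW.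
have [] := @optimal_coupling_exists R n mu nu r (null _ mur) (null _ nur).
  by rewrite ltey.
move=> tau [ctau otau] tauW.
pose T := push (continuous_graph2 (locally_lipschitz_continuous lv)) tau.
have [c1 c2] := ctau.
apply: (@le_trans _ _ (\int[T]_q (enorm (q.1.2 - q.2.2)%R)%:E)%E).
  apply: ereal_inf_lbound; exists T => //; split.
    split=> [A mA|A mA].
      have mA' : measurable ((fun x => (x, v x)) @^-1` A : set (borel E)).
        by rewrite -[X in measurable X]setTI; exact: (continuous_borel (continuous_graph lv)).
      exact: (c1 _ mA').
    have mA' : measurable ((fun x => (x, v x)) @^-1` A : set (borel E)).
      by rewrite -[X in measurable X]setTI; exact: (continuous_borel (continuous_graph lv)).
    exact: (c2 _ mA').
  (* [pi13] undoes the lift, so the projection of [T] inherits the marginals, the cost and the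
     optimality of [tau]. *)
  have costT : cost (push (@continuous_pi13 R n) T) = cost tau.
    rewrite /cost (@ge0_integral_mpush R _ _ _ T _ (continuous_borel (@continuous_pi13 R n))).
    + rewrite (@ge0_integral_mpush R _ _ _ tau _ (continuous_borel
        (continuous_graph2 (locally_lipschitz_continuous lv))))//.
        exact: (measurableT_comp (@measurable_dist R n)
          (continuous_borel (@continuous_pi13 R n))).
      by move=> q; rewrite lee_fin enorm_ge0.
    + exact: measurable_dist.
    + by move=> q; rewrite lee_fin enorm_ge0.
  split => // t [t1 t2]; rewrite costT; exact: otau.
rewrite (@ge0_integral_mpush R _ _ _ tau _ (continuous_borel
  (continuous_graph2 (locally_lipschitz_continuous lv))))/=.
- rewrite -tauW /cost -ge0_integralZl//; last 3 first.
  + exact: measurable_dist.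
  + by move=> p _; rewrite lee_fin enorm_ge0.
  + by rewrite lee_fin ltW.
  apply: ae_ge0_le_integral => //.
  + by move=> p _; rewrite lee_fin enorm_ge0.
  + exact: (measurableT_comp measurable_velocity_dist
      (continuous_borel (continuous_graph2 (locally_lipschitz_continuous lv)))).
  + by move=> p _; rewrite mule_ge0// lee_fin ?enorm_ge0// ltW.
  + by apply: measurable_funeM; exact: measurable_dist.
  + exists (~` (B `*` B)); split.
    * by apply: measurableC; exact: measurable_setX_borel.
    * exact: (coupling_null ctau mB mB (null _ mur) (null _ nur)).
    * move=> p /= + [p1 p2]; apply => _; rewrite -EFinM lee_fin; exact: vK.
- exact: measurable_velocity_dist.
- by move=> q; rewrite lee_fin enorm_ge0.
Qed.

End W_lipschitz.

(** * The flow of a vector field *)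

Section one_variable_calculus.
Context (R : realType).
Implicit Types (f g u du : R -> R).

Lemma is_derive_bigsum n (h : 'I_n -> R -> R) (x : R) (dh : 'I_n -> R) :
  (forall i, is_derive x 1 (h i) (dh i)) ->
  is_derive x 1 (fun s => \sum_i h i s) (\sum_i dh i).
Proof.
move=> hd; have -> : (fun s => \sum_i h i s) = \sum_i h i.
  by apply/funext => s; rewrite fct_sumE.
exact: is_derive_sum.
Qed.

Lemma MVT_continuous f df (a b : R) : a <= b -> continuous f ->
  (forall x, a < x < b -> is_derive x 1 f (df x)) ->
  exists2 c, a <= c <= b & f b - f a = df c * (b - a).
Proof.
move=> ab cf fd.
have fd' x : x \in `]a, b[ -> is_derive x 1 f (df x) by rewrite in_itv/=; exact: fd.
have [c cab ->] := MVT_segment ab fd' (continuous_subspaceT cf).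
by exists c => //; rewrite in_itv/= in cab.
Qed.

Lemma le_of_derive f df (a b : R) : a <= b -> continuous f ->
  (forall x, a < x < b -> is_derive x 1 f (df x)) ->
  (forall x, a < x < b -> df x <= 0) -> f b <= f a.
Proof.
move=> ab cf fd d0; have [->//|anb] := eqVneq a b.
have altb : a < b by rewrite lt_neqAle anb.
have fd' x : x \in `]a, b[ -> is_derive x 1 f (df x) by rewrite in_itv/=; exact: fd.
have [c cab] := MVT altb fd' (continuous_subspaceT cf).
rewrite -subr_le0 => ->; rewrite mulr_le0_ge0 ?subr_ge0// d0//.
Qed.

Lemma norm_le_of_derive f g df dg (a b : R) : a <= b ->
  continuous f -> continuous g ->
  (forall x, a < x < b -> is_derive x 1 f (df x)) ->
  (forall x, a < x < b -> is_derive x 1 g (dg x)) ->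
  (forall x, a < x < b -> `|df x| <= dg x) -> `|f b - f a| <= g b - g a.
Proof.
move=> ab cf cg fd gd fg.
have H1 : f b - g b <= f a - g a.
  apply: (@le_of_derive (fun x => f x - g x) (fun x => df x - dg x)) => //.
  - by move=> x; apply: cvgB; [exact: cf|exact: cg].
  - by move=> x xab; apply: is_deriveB; [exact: fd|exact: gd].
  - by move=> x /fg; rewrite ler_norml; lra.
have H2 : - f b - g b <= - f a - g a.
  apply: (@le_of_derive (fun x => - f x - g x) (fun x => - df x - dg x)) => //.
  - by move=> x; apply: cvgB; [apply: cvgN; exact: cf|exact: cg].
  - by move=> x xab; apply: is_deriveB; [apply: is_deriveN; exact: fd|exact: gd].
  - by move=> x /fg; rewrite ler_norml; lra.
by rewrite ler_norml; move: H1 H2 => /=; lra.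
Qed.

Lemma is_derive1_comp f g (x df dg : R) :
  is_derive x 1 f df -> is_derive (f x) 1 g dg ->
  is_derive x 1 (fun t => g (f t)) (dg * df).
Proof.
move=> [fx <-] [gx <-]; apply: DeriveDef; last first.
  by have := derive1_comp fx gx; rewrite !derive1E.
apply/derivable1_diffP; apply: (@differentiable_comp _ _ _ _ f g).
  exact/derivable1_diffP.
exact/derivable1_diffP.
Qed.

Lemma is_derive_exp_scale (c x : R) :
  is_derive x 1 (fun t => expR (c * t)) (c * expR (c * x)).
Proof.
have H : is_derive x 1 (fun t : R => c * t) c.
  have := is_deriveM (is_derive_cst c x 1) (is_derive_id x 1).
  by move=> /is_derive_eq; apply; rewrite scaler0 addr0 /GRing.scale/= mulr1.
rewrite mulrC; exact: (is_derive1_comp H (is_derive_expR _)).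
Qed.

Lemma continuous_exp_scale (c : R) : continuous (fun t : R => expR (c * t)).
Proof.
move=> x; apply: (@continuous_comp _ _ _ (fun t => c * t) expR).
  by apply: cvgM; [exact: cvg_cst|exact: cvg_id].
exact: continuous_expR.
Qed.

(** The product of [u t] and [expR (- c * t)] has a nonpositive derivative. *)
Lemma exp_gronwall u du (c T : R) : continuous u ->
  (forall t, 0 < t < T -> is_derive t 1 u (du t)) ->
  (forall t, 0 < t < T -> du t <= c * u t) ->
  forall t, 0 <= t <= T -> u t <= expR (c * t) * u 0.
Proof.
move=> cu ud duc t /andP[t0 tT].
have H : u t * expR (- c * t) <= u 0 * expR (- c * 0).
  apply: (@le_of_derive (fun s => u s * expR (- c * s)) (fun s => (du s - c * u s) * expR (- c * s))) => //.
  - by move=> x; apply: cvgM; [exact: cu|exact: continuous_exp_scale].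
  - move=> x /andP[x0 xt].
    have := ud x; rewrite x0 (lt_le_trans xt tT) => /(_ isT) dx.
    have := is_derive_exp_scale (- c) x => dex.
    have := is_deriveM dx dex => /is_derive_eq; apply.
    by rewrite /GRing.scale/=; ring.
  - move=> x /andP[x0 xt]; rewrite mulr_le0_ge0 ?expR_ge0// subr_le0.
    by apply: duc; rewrite x0 (lt_le_trans xt tT).
move: H => /=; rewrite mulr0 expR0 mulr1 mulNr expRN ler_pdivrMr ?expR_gt0//.
by rewrite mulrC.
Qed.

End one_variable_calculus.

(** * Growth and stability of solutions of an ODE *)

Section differential_equations.
Context (R : realType) (n : nat).
Local Notation E := 'rV[R]_n.
Implicit Types (w : E -> E) (X Y : R -> E).

(** The equation is imposed inside the interval only; continuity carries the estimates to 0 and [T],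
    so that one-sided derivatives never occur. *)
Definition ode_solution w (T : R) X :=
  (forall i, continuous (fun t => X t 0 i)) /\
  forall t, 0 < t < T -> forall i, is_derive t 1 (fun s => X s 0 i) (w (X t) 0 i).

Lemma ode_continuous w T X : ode_solution w T X -> continuous X.
Proof. by move=> [cX _]; exact: continuous_row. Qed.

Lemma is_derive_sqr (f : R -> R) (t df : R) :
  is_derive t 1 f df -> is_derive t 1 (fun s => f s ^+ 2) (2 * (f t * df)).
Proof.
move=> fd; have -> : (fun s => f s ^+ 2) = f * f by apply/funext => s; rewrite expr2.
have := is_deriveM fd fd => /is_derive_eq; apply.
by rewrite /GRing.scale/=; ring.
Qed.

Lemma continuous_sum_sqr (f : 'I_n -> R -> R) : (forall i, continuous (f i)) ->
  continuous (fun t => \sum_i f i t ^+ 2).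
Proof.
move=> cf t; apply: (@cvg_big _ _ +%R 0 xpredT add_continuous) => i _.
by apply: cvgM; exact: cf.
Qed.

(** Gronwall for [1 + enorm (X t)]: with the 1 put into the unknown, the affine growth bound becomes
    linear. *)
Lemma ode_growth w T X (C : R) : 0 <= C -> ode_solution w T X ->
  (forall x, enorm (w x) <= C * (1 + enorm x)) ->
  forall t, 0 <= t <= T -> 1 + enorm (X t) <= expR (C * t) * (1 + enorm (X 0)).
Proof.
move=> C0 [cX dX] wC t tT.
have enormE x : enorm x = Num.sqrt (\sum_i x 0 i ^+ 2) by [].
have S0 x : 0 <= \sum_i (x : E) 0 i ^+ 2.
  by apply: sumr_ge0 => i _; exact: sqr_ge0.
suff H d : 0 < d -> 1 + enorm (X t) <= expR (C * t) * (1 + enorm (X 0) + d).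
  apply/ler_addgt0Pr => e e0.
  have := H (e / expR (C * t)); rewrite divr_gt0 ?expR_gt0// => /(_ isT).
  by rewrite mulrDr mulrC [expR _ * (e / _)]mulrC divfK ?gt_eqF ?expR_gt0// mulrC.
move=> d0.
(* The Euclidean norm is smoothed, since it is not differentiable at 0. *)
pose phi s := Num.sqrt (\sum_i X s 0 i ^+ 2 + d ^+ 2).
have d20 : 0 < d ^+ 2 by rewrite exprn_gt0.
have phi2 s : 0 <= \sum_i X s 0 i ^+ 2 + d ^+ 2 by rewrite addr_ge0 ?S0 ?ltW.
have phi_ge s : enorm (X s) <= phi s.
  by rewrite enormE /phi ler_sqrt// lerDl ltW.
have phi_gt s : 0 < phi s by rewrite sqrtr_gt0 ltr_wpDl.
have phi_le s : phi s <= enorm (X s) + d.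
  rewrite -(@ler_pXn2r _ 2) ?nnegrE ?sqrtr_ge0 ?addr_ge0 ?enorm_ge0 ?(ltW d0)//.
  rewrite sqr_sqrtr// sqrrD enormE sqr_sqrtr//.
  rewrite -addrA lerD2l lerDr mulrn_wge0// mulr_ge0 ?sqrtr_ge0//.
  exact: ltW.
apply: (@le_trans _ _ (1 + phi t)); first by rewrite lerD2l.
apply: (@le_trans _ _ (expR (C * t) * (1 + phi 0))); last first.
  by rewrite ler_pM2l ?expR_gt0// -addrA lerD2l.
apply: (@exp_gronwall _ (fun s => 1 + phi s)
  (fun s => (2 * phi s)^-1 * \sum_i 2 * (X s 0 i * w (X s) 0 i)) C T) => //.
- move=> s; apply: cvgD; first exact: cvg_cst.
  apply: (@continuous_comp _ _ _ (fun s => \sum_i X s 0 i ^+ 2 + d ^+ 2) Num.sqrt);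
    last exact: sqrt_continuous.
  by apply: cvgD; [exact: continuous_sum_sqr|exact: cvg_cst].
- move=> s sT.
  have H : is_derive s 1 (fun s => \sum_i X s 0 i ^+ 2 + d ^+ 2)
      (\sum_i 2 * (X s 0 i * w (X s) 0 i) + 0).
    apply: is_deriveD; apply: is_derive_bigsum => i.
    by apply: is_derive_sqr; exact: dX.
  rewrite addr0 in H.
  have Hs := is_derive1_comp H (is_derive1_sqrt _).
  rewrite -[X in is_derive _ _ _ X]add0r; apply: is_deriveD.
  by apply: Hs; rewrite ltr_wpDl.
(* The derivative of [phi] is X.w(X) / phi. By Cauchy-Schwarz and |X| <= phi, it is at most C(1 +
   phi). *)
- move=> s sT; rewrite -mulr_sumr -/(dotv _ _).
  rewrite invfM mulrACA mulVf ?mul1r ?pnatr_eq0//.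
  rewrite -ler_pdivlMl ?invr_gt0// invrK.
  apply: (le_trans (dotv_le _ _)); apply: ler_pM; rewrite ?enorm_ge0//.
  by apply: (le_trans (wC _)); rewrite ler_wpM2l// lerD2l.
Qed.

(** Gronwall is applied to the squared distance, which is differentiable even where the curves meet;
    its rate [2 * L] is halved by the square root. *)
Lemma ode_dist w T X Y (L : R) : ode_solution w T X -> ode_solution w T Y ->
  (forall t, 0 < t < T -> enorm (w (X t) - w (Y t)) <= L * enorm (X t - Y t)) ->
  forall t, 0 <= t <= T -> enorm (X t - Y t) <= expR (L * t) * enorm (X 0 - Y 0).
Proof.
move=> [cX dX] [cY dY] wL t tT.
pose u s := \sum_i (X s 0 i - Y s 0 i) ^+ 2.
have uE s : u s = enorm (X s - Y s) ^+ 2.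
  by rewrite sqr_enorm; apply: eq_bigr => i _; rewrite !mxE expr2.
have : u t <= expR ((2 * L) * t) * u 0.
  apply: (@exp_gronwall _ u (fun s => \sum_i 2 * ((X s 0 i - Y s 0 i) *
    (w (X s) 0 i - w (Y s) 0 i))) (2 * L) T) => //.
  - by apply: continuous_sum_sqr => i s; apply: cvgB; [exact: cX|exact: cY].
  - move=> s sT; apply: is_derive_bigsum => i; apply: is_derive_sqr.
    by apply: is_deriveB; [exact: dX|exact: dY].
  - move=> s sT; rewrite -mulr_sumr -mulrA ler_pM2l// uE expr2.
    rewrite (_ : \sum_i _ = dotv (X s - Y s) (w (X s) - w (Y s))); last first.
      by apply: eq_bigr => i _; rewrite !mxE.
    apply: (le_trans (dotv_le _ _)); rewrite mulrCA ler_wpM2l ?enorm_ge0//.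
    exact: wL.
rewrite !uE -mulrA expRM_natl -exprMn ler_pXn2r// nnegrE ?enorm_ge0//.
by rewrite mulr_ge0 ?expR_ge0 ?enorm_ge0.
Qed.

(** Consistency error of one explicit Euler step. Each coordinate has its own mean value time, and
    recombining the coordinates costs the factor [n]. *)
Lemma ode_step w T X (e s t : R) : ode_solution w T X ->
  0 <= s -> s <= t -> t <= T ->
  (forall a, s <= a <= t -> enorm (w (X a) - w (X s)) <= e) ->
  enorm (X t - X s - (t - s) *: w (X s)) <= n%:R * (e * (t - s)).
Proof.
move=> [cX dX] s0 st tT we; apply: enorm_le_const => i.
have [a sat /= H] : exists2 a, s <= a <= t &
    X t 0 i - X s 0 i = w (X a) 0 i * (t - s).
  apply: (MVT_continuous (f := fun s => X s 0 i) (df := fun a => w (X a) 0 i)) => //.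
  move=> a /andP[sa at_]; apply: dX.
  by rewrite (le_lt_trans s0 sa) (lt_le_trans at_ tT).
rewrite !mxE H (_ : _ - _ = (w (X a) - w (X s)) 0 i * (t - s)); last first.
  by rewrite !mxE; ring.
rewrite normrM (ger0_norm (_ : 0 <= t - s)) ?subr_ge0// ler_wpM2r ?subr_ge0//.
exact: le_trans (coord_le_enorm _ _) (we _ sat).
Qed.

Lemma ode_time_lipschitz w T X (M s t : R) : ode_solution w T X ->
  (forall a, 0 <= a <= T -> enorm (w (X a)) <= M) ->
  0 <= s <= T -> 0 <= t <= T -> enorm (X t - X s) <= n%:R * (M * `|t - s|).
Proof.
move=> [cX dX] wM; wlog st : s t / s <= t => [hw sT tT|].
  have [st|/ltW ts] := leP s t; first exact: hw.
  by rewrite enormB distrC; exact: hw.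
move=> /andP[s0 _] /andP[_ tT]; apply: enorm_le_const => i.
have [a sat /= H] : exists2 a, s <= a <= t &
    X t 0 i - X s 0 i = w (X a) 0 i * (t - s).
  apply: (MVT_continuous (f := fun s => X s 0 i) (df := fun a => w (X a) 0 i)) => //.
  move=> a /andP[sa at_]; apply: dX.
  by rewrite (le_lt_trans s0 sa) (lt_le_trans at_ tT).
rewrite !mxE H normrM ler_wpM2r//; move: sat => /andP[sa at_].
by rewrite (le_trans (coord_le_enorm _ _))// wM// (le_trans s0 sa) (le_trans at_ tT).
Qed.

End differential_equations.

(** * Picard iteration for globally Lipschitz fields *)

Section picard.
Context (R : realType).

Lemma near_is_derive (f g : R -> R) (x d : R) :
  (\forall y \near x, f y = g y) -> is_derive x 1 f d -> is_derive x 1 g d.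
Proof.
move=> fg [fx <-].
apply: DeriveDef; first exact: (near_eq_derivable fg).
by apply/esym; exact: near_eq_derive.
Qed.

Lemma continuous_max0 : continuous (fun t : R => Num.max t 0).
Proof.
move=> t; apply: (@continuous_max _ R (fun t => t) (fun=> 0)); first exact: cvg_id.
exact: cvg_cst.
Qed.

(** The constant extension to negative times makes [F] continuous on the whole line, as
    [ode_solution] requires; the derivative is prescribed at positive times only. *)
Definition antiderivative (h F : R -> R) :=
  [/\ forall t : R, t <= 0 -> F t = 0, continuous F &
      forall t : R, 0 < t -> is_derive t 1 F (h t)].

Lemma antiderivative_exists (h : R -> R) : continuous h ->
  exists F, antiderivative h F.
Proof.
(* Integrating from -1 makes 0 an interior point, where [G] is continuous. *)
move=> ch; pose G t := \int[lebesgue_measure]_(s in `[-1, t]) h s.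
have dG (t : R) : -1 < t -> is_derive t 1 G (h t).
  move=> t1; have tu : t < t + 1 by rewrite ltrDl.
  have ih : (@lebesgue_measure R).-integrable `[-1, t + 1] (EFin \o h).
    apply: continuous_compact_integrable; first exact: segment_compact.
    exact: continuous_subspaceT.
  have [G1 G2] := continuous_FTC1_closed tu ih t1 (ch t).
  by apply: (DeriveDef G1); rewrite -derive1E.
have cG (t : R) : -1 < t -> {for t, continuous G}.
  move=> t1; apply: differentiable_continuous; apply/derivable1_diffP.
  by have [] := dG _ t1.
exists (fun t => G (Num.max t 0) - G 0); split.
- by move=> t t0; rewrite max_r// subrr.
- move=> t; have cm : {for Num.max t 0, continuous G}.
    by apply: cG; rewrite lt_max (_ : -1 < 0)// ?orbT// ltrN10.
  have cGm : G (Num.max s 0) @[s --> t] --> G (Num.max t 0).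
    exact: continuous_comp (@continuous_max0 t) cm.
  by apply: cvgB; [exact: cGm|exact: cvg_cst].
- move=> t t0; have : is_derive t 1 (fun s => G s - G 0) (h t).
    rewrite -[h t]subr0; apply: is_deriveB.
    by apply: dG; rewrite (lt_trans _ t0)// ltrN10.
  apply: near_is_derive; have : \forall s \near t, 0 < s.
    by apply: open_nbhs_nbhs; split => //; exact: open_gt.
  by apply: filterS => s s0; rewrite max_l// ltW.
Qed.

(** The intervals of radius [2 * c / 2 ^+ k] about [u k] are nested; a common point is a limit
    together with its rate. *)
Lemma geometric_limit (u : nat -> R) (c : R) :
  (forall k, `|u k.+1 - u k| <= c / (2 ^+ k)) ->
  exists l, forall k, `|u k - l| <= 2 * c / (2 ^+ k).
Proof.
move=> uc; pose b k := u k - 2 * c / 2 ^+ k; pose a k := u k + 2 * c / 2 ^+ k.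
have E k : 2 * c / 2 ^+ k.+1 = c / 2 ^+ k :> R.
  by rewrite exprS invfM mulrACA divff ?mul1r// pnatr_eq0.
have E2 k : 2 * c / 2 ^+ k = c / 2 ^+ k + c / 2 ^+ k :> R by rewrite -mulrA; ring.
have bS k : b k <= b k.+1.
  by have := uc k; rewrite /b E E2 ler_norml; lra.
have aS k : a k.+1 <= a k.
  by have := uc k; rewrite /a E E2 ler_norml; lra.
have c0 : 0 <= c by have := uc 0%N; rewrite expr0 divr1; apply: le_trans.
have ba k : b k <= a k.
  have : 0 <= 2 * c / 2 ^+ k by rewrite divr_ge0 ?mulr_ge0// exprn_ge0.
  by rewrite /a /b; lra.
have bm : {homo b : i j / (i <= j)%N >-> i <= j} by exact/nondecreasing_seqP.
have am : {homo a : i j / (i <= j)%N >-> j <= i} by exact/nonincreasing_seqP.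
have bak i j : b i <= a j.
  apply: (le_trans (bm _ _ (leq_maxl i j))); apply: (le_trans (ba _)).
  exact: am (leq_maxr i j).
have hb : has_ubound (range b) by exists (a 0%N) => _ [i _ <-].
exists (sup (range b)) => k.
have h1 : b k <= sup (range b) by apply: ub_le_sup => //; exists k.
have h2 : sup (range b) <= a k.
  by apply: ge_sup; [exists (b 0%N), 0%N|move=> _ [i _ <-]].
by rewrite ler_norml; move: h1 h2; rewrite /a /b; lra.
Qed.

(** The bound on the integrands is the derivative of [c * expR (l * s)], so that integration gains
    the factor 1/l: this is what makes the iteration contract. *)
Lemma antiderivative_compare (h1 h2 F1 F2 : R -> R) (l c : R) :
  antiderivative h1 F1 -> antiderivative h2 F2 -> 0 <= c ->
  (forall s, 0 < s -> `|h1 s - h2 s| <= c * (l * expR (l * s))) ->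
  forall t, `|F1 t - F2 t| <= c * expR (l * Num.max t 0).
Proof.
move=> [F10 cF1 dF1] [F20 cF2 dF2] c0 h12 t.
have [t0|t0] := leP t 0.
  by rewrite F10// F20// subrr normr0 mulr_ge0// expR_ge0.
have : `|(F1 t - F2 t) - (F1 0 - F2 0)| <= c * expR (l * t) - c * expR (l * 0).
  apply: (@norm_le_of_derive _ (fun s => F1 s - F2 s) (fun s => c * expR (l * s))
    (fun s => h1 s - h2 s) (fun s => c * (l * expR (l * s)))).
  - exact: ltW.
  - by move=> s; apply: cvgB; [exact: cF1|exact: cF2].
  - by move=> s; apply: cvgM; [exact: cvg_cst|exact: continuous_exp_scale].
  - by move=> s /andP[s0 _]; apply: is_deriveB; [exact: dF1|exact: dF2].
  - move=> s _; have := is_deriveM (is_derive_cst c s 1) (is_derive_exp_scale l s).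
    by move=> /is_derive_eq; apply; rewrite scaler0 addr0.
  - by move=> s /andP[s0 _]; exact: h12.
rewrite (F10 0)// (F20 0)// subrr subr0 mulr0 expR0 mulr1 => /le_trans; apply.
by rewrite lerBlDr lerDl.
Qed.

End picard.

Section picard_lindelof.
Context (R : realType) (n : nat) (w : 'rV[R]_n -> 'rV[R]_n) (L : R).
Local Notation E := 'rV[R]_n.
Hypothesis L0 : 0 <= L.
Hypothesis wL : forall x y, enorm (w x - w y) <= L * enorm (x - y).

Theorem picard_lindelof (x0 : E) :
  exists2 X, X 0 = x0 & forall T, ode_solution w T X.
Proof.
have cw : continuous w by exact: lipschitz_continuous wL.
(* Choosing an antiderivative once and for all needs a total function; at a discontinuous integrand
   its value is arbitrary. *)
have HA (h : R -> R) : exists F : R -> R, continuous h -> antiderivative h F.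
  have [ch|nch] := pselect (continuous h); last by exists h.
  by have [F] := antiderivative_exists ch; exists F.
have [A AP] := choice HA; clear HA.
pose step (X : R -> E) : R -> E :=
  fun t => \row_i (x0 0 i + A (fun s => w (X s) 0 i) t).
pose Xs k := iter k step (fun=> x0).
have cwX (X : R -> E) : (forall i, continuous (fun t => X t 0 i)) ->
    forall i, continuous (fun t => w (X t) 0 i).
  move=> cX i t; apply: (@continuous_comp _ _ _ (fun t => w (X t)) (fun y : E => y 0 i)).
    apply: (@continuous_comp _ _ _ X w); last exact: cw.
    exact: (continuous_row cX).
  exact: coord_continuous.
have cstep (X : R -> E) : (forall i, continuous (fun t => X t 0 i)) ->
    forall i, continuous (fun t => step X t 0 i).
  move=> cX i; have [_ cA _] := AP _ (cwX _ cX i).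
  rewrite (_ : (fun t => _) = fun t => x0 0 i + A (fun s => w (X s) 0 i) t).
    by move=> t; apply: cvgD; [exact: cvg_cst|exact: cA].
  by apply/funext => t; rewrite mxE.
have cX k i : continuous (fun t => Xs k t 0 i).
  elim: k i => [i t|k IH]; first exact: cvg_cst.
  exact: cstep.
(* In the weight [exp (l t)] each iteration contracts by at least 1/2, so that no
   bound on the length of the time interval is needed. *)
pose l : R := 2 * (n%:R * L) + 1; pose e t := expR (l * Num.max t 0).
have nL0 : 0 <= n%:R * L by rewrite mulr_ge0.
have l1 : 1 <= l by rewrite lerDr mulr_ge0.
pose a0 := enorm (w x0); have a00 : 0 <= a0 := enorm_ge0 _.
(* Measured coordinate by coordinate, the Lipschitz constant becomes n L. This is what [l] doubles;
   the added 1 gives [1 <= l], used for the first iterate. *)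
have wcoord (x y : E) (c : R) i : (forall j, `|x 0 j - y 0 j| <= c) ->
    `|w x 0 i - w y 0 i| <= n%:R * L * c.
  move=> xyc; have := coord_le_enorm (w x - w y) i; rewrite !mxE => /le_trans; apply.
  apply: (le_trans (wL _ _)); rewrite -mulrA mulrCA; apply: ler_wpM2l => //.
  by apply: enorm_le_const => j; rewrite !mxE.
have dX k t i : `|Xs k.+1 t 0 i - Xs k t 0 i| <= a0 * e t / 2 ^+ k.
  elim: k t i => [|k IH] t i.
    rewrite expr0 divr1 /= mxE addrC addKr -[A _ t]subr0.
    apply: (@antiderivative_compare R (fun s => w x0 0 i) (fun=> 0) _ (fun=> 0)) => //.
    - by apply: AP => s; exact: cvg_cst.
    - by split => // [s|s _]; [exact: cvg_cst|exact: is_derive_cst].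
    - move=> s s0; rewrite subr0 (le_trans (coord_le_enorm _ _))//.
      rewrite -/a0 ler_peMr// -[leLHS]mul1r ler_pM//.
      by rewrite -[leLHS](@expR0 R) ler_expR mulr_ge0// ?(ltW s0)// (le_trans ler01).
  rewrite [Xs k.+2 _]/= [X in _ - X]/= !mxE opprD addrACA subrr add0r mulrAC.
  apply: (@antiderivative_compare R (fun s => w (Xs k.+1 s) 0 i)
    (fun s => w (Xs k s) 0 i)) => //.
  - by apply: AP; exact: cwX.
  - by apply: AP; exact: cwX.
  - by rewrite divr_ge0// exprn_ge0.
  - move=> s s0; apply: (le_trans (wcoord _ _ _ i (fun j => IH s j))).
    rewrite /e max_l; last exact: ltW.
    rewrite exprS invfM.
    have -> : n%:R * L * (a0 * expR (l * s) / 2 ^+ k) =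
      (n%:R * L) * (a0 / 2 ^+ k * expR (l * s)) by ring.
    have -> : a0 * (2^-1 / 2 ^+ k) * (l * expR (l * s)) =
      (l / 2) * (a0 / 2 ^+ k * expR (l * s)) by ring.
    rewrite ler_wpM2r//; last by rewrite /l; lra.
    by rewrite !mulr_ge0 ?expR_ge0// invr_ge0 exprn_ge0.
have [X XP] : exists X : R -> E, forall t i k,
    `|Xs k t 0 i - X t 0 i| <= 2 * (a0 * e t) / 2 ^+ k.
  have H t i : exists x, forall k, `|Xs k t 0 i - x| <= 2 * (a0 * e t) / 2 ^+ k.
    exact: geometric_limit (fun k => dX k t i).
  have HF t : exists f : 'I_n -> R, forall i k,
      `|Xs k t 0 i - f i| <= 2 * (a0 * e t) / 2 ^+ k.
    by have [f fP] := choice (H t); exists f.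
  have [F FP] := choice HF.
  by exists (fun t => \row_i F t i) => t i k; rewrite mxE.
have small (b c : R) : 0 <= c -> (forall k : nat, b <= c / 2 ^+ k) -> b <= 0.
  move=> c0 bc; rewrite leNgt; apply/negP => b0.
  have [k ck] : exists k : nat, c / b < 2 ^+ k.
    exists (Num.truncn (c / b)).+1; apply: (lt_trans (truncnS_gt _)).
    by rewrite -natrX ltr_nat ltn_expl.
  have := bc k; rewrite leNgt ltr_pdivrMr ?exprn_gt0//.
  by move: ck; rewrite ltr_pdivrMr// mulrC => ->.
have e0 t : 0 <= e t by exact: expR_ge0.
(* The weight [e] is nondecreasing, so the convergence is uniform on times up to [t + 1], and three
   errors of size [d / 3] suffice. *)
have cXlim i : continuous (fun t => X t 0 i).
  move=> t; apply/cvgrPdist_lt => d d0.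
  have e1 : 0 <= 2 * (a0 * e (t + 1)) by rewrite !mulr_ge0.
  have [k ck] : exists k : nat, 2 * (a0 * e (t + 1)) / 2 ^+ k < d / 3.
    apply: contrapT => /forallNP H.
    have : d / 3 <= 0 by apply: (small _ _ e1) => k; rewrite leNgt; apply/negP; exact: H.
    by rewrite leNgt divr_gt0.
  have near1 : \forall s \near t, s < t + 1.
    by apply: open_nbhs_nbhs; split; [exact: open_lt|rewrite /= ltrDl].
  have d30 : 0 < d / 3 by rewrite divr_gt0.
  have near2 : \forall s \near t, `|Xs k t 0 i - Xs k s 0 i| < d / 3.
    by move/cvgrPdist_lt : (cX k i t) => /(_ _ d30).
  near=> s.
  have close u : u <= t + 1 -> `|Xs k u 0 i - X u 0 i| < d / 3.
    move=> ut; apply: le_lt_trans ck; apply: (le_trans (XP u i k)).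
    rewrite ler_wpM2r ?invr_ge0 ?exprn_ge0// ler_wpM2l// ler_wpM2l//.
    rewrite ler_expR ler_wpM2l ?(le_trans ler01)//.
    by rewrite ge_max !le_max ut lexx !orbT.
  have h1 : `|Xs k t 0 i - X t 0 i| < d / 3 by apply: close; rewrite lerDl.
  have h2 : `|Xs k s 0 i - X s 0 i| < d / 3 by apply: close; apply: ltW; near: s.
  have h3 : `|Xs k t 0 i - Xs k s 0 i| < d / 3 by near: s.
  by move: h1 h2 h3; rewrite !ltr_norml; lra.
(* Both sides are within O(2^-k) of the iterate [Xs k.+1], for every [k]. *)
have Xfix t i : X t 0 i = x0 0 i + A (fun s => w (X s) 0 i) t.
  apply/eqP; rewrite -subr_eq0 -normr_le0.
  have c0 : 0 <= (a0 + a0) * (2 * e t) by rewrite !mulr_ge0// addr_ge0.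
  apply: (small _ _ c0) => k.
  have h1 := XP t i k.+1.
  have h2 : `|Xs k.+1 t 0 i - (x0 0 i + A (fun s => w (X s) 0 i) t)| <=
      (a0 / 2 ^+ k) * e t.
    rewrite [Xs k.+1 _]/= mxE opprD addrACA subrr add0r.
    apply: (@antiderivative_compare R (fun s => w (Xs k s) 0 i)
      (fun s => w (X s) 0 i)) => //.
    - by apply: AP; exact: cwX.
    - by apply: AP; exact: cwX.
    - by rewrite divr_ge0// exprn_ge0.
    - move=> s s0; apply: (le_trans (wcoord _ _ _ i (fun j => XP s j k))).
      rewrite /e max_l; last exact: ltW.
      have -> : n%:R * L * (2 * (a0 * expR (l * s)) / 2 ^+ k) =
        (2 * (n%:R * L)) * (a0 / 2 ^+ k * expR (l * s)) by ring.
      have -> : a0 / 2 ^+ k * (l * expR (l * s)) = l * (a0 / 2 ^+ k * expR (l * s)) by ring.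
      rewrite ler_wpM2r//; last by rewrite /l lerDl.
      by rewrite !mulr_ge0 ?expR_ge0// invr_ge0 exprn_ge0.
  rewrite exprS invfM in h1.
  have : (a0 + a0) * (2 * e t) / 2 ^+ k =
    2 * (a0 * e t) * (2^-1 / 2 ^+ k) + a0 / 2 ^+ k * e t + 2 * (a0 * e t / 2 ^+ k).
    by field; rewrite expf_neq0.
  have : 0 <= a0 * e t / 2 ^+ k by rewrite divr_ge0 ?mulr_ge0// exprn_ge0.
  by move: h1 h2; rewrite !ler_norml; lra.
exists X.
  apply/rowP => i; rewrite Xfix.
  by have [A0 _ _] := AP _ (cwX _ cXlim i); rewrite A0// addr0.
move=> T; split => // t /andP[t0 tT] i.
have [_ _ dA] := AP _ (cwX _ cXlim i).
have -> : (fun s => X s 0 i) = fun s => x0 0 i + A (fun s => w (X s) 0 i) s.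
  by apply/funext => s; exact: Xfix.
rewrite -[w (X t) 0 i]add0r; apply: is_deriveD; exact: dA.
Unshelve. all: by end_near. Qed.

End picard_lindelof.

(** * Truncation onto intervals and cubes *)

Section clamp.
Context (R : realType).

Definition clamp (a b x : R) := Num.max a (Num.min b x).

Lemma clamp_itv (a b x : R) : a <= b -> a <= clamp a b x <= b.
Proof. by move=> ab; rewrite /clamp le_max lexx/= ge_max ab ge_min lexx. Qed.

Lemma clamp_id (a b x : R) : a <= x <= b -> clamp a b x = x.
Proof. by move=> /andP[ax xb]; rewrite /clamp min_r// max_r. Qed.

Lemma clamp_dist (a b x y : R) : `|clamp a b x - clamp a b y| <= `|x - y|.
Proof.
rewrite /clamp; have [bx|bx] := leP b x; have [by_|by_] := leP b y;
  have [h1|h1] := leP a b; rewrite ?subrr ?normr0//;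
  try (have [h2|h2] := leP a x); try (have [h3|h3] := leP a y);
  rewrite ?subrr ?normr0//.
all: have := normr_ge0 (x - y); have := ler_norm (x - y); have := ler_norm (y - x).
all: rewrite [`|y - x|]distrC ler_norml => k1 k2 k3; lra.
Qed.

Lemma clamp_continuous (a b : R) : continuous (clamp a b).
Proof.
move=> x; apply/cvgrPdist_lt => e e0.
have : \forall y \near x, `|x - y| < e.
  by move: (@cvg_id _ (nbhs x)) => /cvgrPdist_lt/(_ _ e0).
by apply: filterS => y; apply: le_lt_trans; exact: clamp_dist.
Qed.

End clamp.

Section clamp_vector.
Context (R : realType) (n : nat).
Local Notation E := 'rV[R]_n.

Lemma enorm_le_coord (x y : E) : (forall i, `|x 0 i| <= `|y 0 i|) ->
  enorm x <= enorm y.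
Proof.
move=> xy; rewrite /enorm ler_wsqrtr//; apply: ler_sum => i _.
by rewrite -[leLHS]real_normK ?num_real// -[leRHS]real_normK ?num_real// ler_pXn2r ?nnegrE.
Qed.

(** Projection onto a cube rather than a ball: it acts on each coordinate separately and inherits
    the contraction property from [clamp]. *)
Definition clampv (rho : R) (x : E) : E := \row_i clamp (- rho) rho (x 0 i).

Lemma clampv_id rho x : enorm x <= rho -> clampv rho x = x.
Proof.
move=> xr; apply/rowP => i; rewrite mxE clamp_id// -ler_norml.
exact: le_trans (coord_le_enorm _ _) xr.
Qed.

Lemma clampv_dist rho x y : enorm (clampv rho x - clampv rho y) <= enorm (x - y).
Proof. by apply: enorm_le_coord => i; rewrite !mxE clamp_dist. Qed.

Lemma clampv_le rho x : 0 <= rho -> enorm (clampv rho x) <= enorm x.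
Proof.
move=> r0; have := clampv_dist rho x 0; rewrite subr0 (_ : clampv rho 0 = 0) ?subr0//.
by rewrite clampv_id// enorm0.
Qed.

Lemma clampv_bound rho x : 0 <= rho -> enorm (clampv rho x) <= n%:R * rho.
Proof.
move=> r0; apply: enorm_le_const => i; rewrite mxE ler_norml clamp_itv//.
by rewrite ge0_cp.
Qed.

End clamp_vector.

(** * The flow of a locally Lipschitz field of sublinear growth *)

Section flow.
Context (R : realType) (n : nat) (v : 'rV[R]_n -> 'rV[R]_n).
Local Notation E := 'rV[R]_n.
Hypothesis lv : locally_lipschitz v.
Context (C : R).
Hypothesis C0 : 0 < C.
Hypothesis vC : forall x, enorm (v x) <= C * (1 + enorm x).

(** The growth bound confines both solutions to one ball, where [v] is Lipschitz; then [ode_dist]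
    propagates the zero initial distance. *)
Lemma ode_unique (T : R) (X Y : R -> E) :
  ode_solution v T X -> ode_solution v T Y -> X 0 = Y 0 ->
  forall t, 0 <= t <= T -> X t = Y t.
Proof.
move=> sX sY XY0 t tT; have /andP[t0 tT'] := tT.
have bound Z s : ode_solution v T Z -> 0 <= s <= T ->
    enorm (Z s) <= expR (C * T) * (1 + enorm (Z 0)).
  move=> sZ /[dup] sT /andP[s0 sT'].
  have := ode_growth (ltW C0) sZ vC sT => h.
  apply: (@le_trans _ _ (1 + enorm (Z s))); first by rewrite lerDr.
  apply: (le_trans h); rewrite ler_wpM2r ?addr_ge0 ?enorm_ge0// ler_expR.
  by rewrite ler_wpM2l// ltW.
have [L L0 vL] := locally_lipschitz_ball (expR (C * T) * (1 + enorm (X 0))) lv.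
have := ode_dist sX sY (L := L) _ tT.
rewrite XY0 subrr enorm0 mulr0 => h.
apply/eqP; rewrite -subr_eq0; apply/eqP/enorm_eq0/eqP.
rewrite eq_le enorm_ge0 andbT; apply: h => s /andP[s0 sT].
have sT2 : 0 <= s <= T by rewrite !ltW.
apply: vL; first exact: bound.
by rewrite XY0; exact: bound.
Qed.

(* Clamping the argument makes the field globally Lipschitz and keeps its growth
   bound; by that bound, the solution never reaches the clamped region. *)
Lemma ode_exists (T : R) (x : E) : exists2 X, X 0 = x & ode_solution v T X.
Proof.
pose rho := expR (C * T) * (1 + enorm x).
have rho0 : 0 <= rho by rewrite mulr_ge0 ?expR_ge0// addr_ge0// enorm_ge0.
have [L L0 vL] := locally_lipschitz_ball (n%:R * rho) lv.
pose w y := v (clampv rho y).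
have wL y z : enorm (w y - w z) <= L * enorm (y - z).
  apply: (le_trans (vL _ _ (clampv_bound _ rho0) (clampv_bound _ rho0))).
  by rewrite ler_wpM2l ?clampv_dist// ltW.
have wC y : enorm (w y) <= C * (1 + enorm y).
  by apply: (le_trans (vC _)); rewrite ler_wpM2l ?lerD2l ?clampv_le// ltW.
have [X X0 sX] := picard_lindelof (ltW L0) wL x.
exists X => //; split; first by have [] := sX 0.
move=> t tT i; have [_ dX] := sX T.
have := dX t tT i; rewrite /w clampv_id//.
have tT2 : 0 <= t <= T by move: tT => /andP[/ltW -> /ltW].
have := ode_growth (ltW C0) (sX T) wC tT2; rewrite X0 => h.
apply: (@le_trans _ _ (1 + enorm (X t))); first by rewrite lerDr.
apply: (le_trans h); rewrite ler_wpM2r ?addr_ge0 ?enorm_ge0// ler_expR.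
by rewrite ler_wpM2l ?(ltW C0)//; move: tT2 => /andP[].
Qed.

(* Time is clamped to [0, T] so that the flow is continuous on the whole line. *)
Lemma flow_exists (T : R) : 0 < T -> exists Phi : R -> E -> E,
  [/\ forall x, Phi 0 x = x, forall x, ode_solution v T (Phi^~ x) &
      forall t x, Phi t x = Phi (clamp 0 T t) x].
Proof.
move=> T0.
have H (x : E) : exists X : R -> E, X 0 = x /\ ode_solution v T X.
  by have [X X0 sX] := ode_exists T x; exists X.
have [F FP] := choice H.
have cc t : clamp 0 T (clamp 0 T t) = clamp 0 T t by rewrite [LHS]clamp_id// clamp_itv// ltW.
exists (fun t x => F x (clamp 0 T t)); split.
- by move=> x; rewrite clamp_id ?lexx ?ltW//; have [] := FP x.
- move=> x; have [_ [cX dX]] := FP x; split.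
    move=> i t; apply: (@continuous_comp _ _ _ (clamp 0 T) (fun t => F x t 0 i)).
      exact: clamp_continuous.
    exact: cX.
  move=> t /[dup] tT /andP[t0 tT'] i; rewrite clamp_id ?ltW//.
  apply: (near_is_derive _ (dX t tT i)).
  have : \forall s \near t, 0 < s /\ s < T.
    by apply: filterI; apply: open_nbhs_nbhs; split.
  by apply: filterS => s [s0 sT]; rewrite clamp_id// !ltW.
- by move=> t x; rewrite cc.
Qed.

Section flow_properties.
Context (T : R) (Phi : R -> E -> E).
Hypothesis T0 : 0 < T.
Hypothesis Phi0 : forall x, Phi 0 x = x.
Hypothesis sPhi : forall x, ode_solution v T (Phi^~ x).
Hypothesis Phi_clamp : forall t x, Phi t x = Phi (clamp 0 T t) x.

Lemma flow_growth t x : 0 <= t <= T ->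
  1 + enorm (Phi t x) <= expR (C * t) * (1 + enorm x).
Proof. by move=> tT; have := ode_growth (ltW C0) (sPhi x) vC tT; rewrite /= Phi0. Qed.

(** Bounds [1 + enorm (Phi t x)] on the whole interval, so that [C * flow_radius r] bounds the
    speed. *)
Definition flow_radius r := expR (C * T) * (1 + r).

Lemma flow_bound r t x : 0 <= t <= T -> enorm x <= r ->
  1 + enorm (Phi t x) <= flow_radius r.
Proof.
move=> tT xr; apply: (le_trans (flow_growth x tT)).
apply: ler_pM; rewrite ?expR_ge0 ?addr_ge0 ?enorm_ge0//; last by rewrite lerD2l.
by rewrite ler_expR ler_wpM2l ?(ltW C0)//; move: tT => /andP[].
Qed.

Lemma flow_ball r t x : 0 <= t <= T -> enorm x <= r ->
  enorm (Phi t x) <= flow_radius r.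
Proof. by move=> tT xr; apply: le_trans (flow_bound tT xr); rewrite lerDr. Qed.

Lemma flow_dist r : exists2 L : R, 0 < L & forall x y t,
  enorm x <= r -> enorm y <= r -> 0 <= t <= T ->
  enorm (Phi t x - Phi t y) <= expR (L * t) * enorm (x - y).
Proof.
have [L L0 vL] := locally_lipschitz_ball (flow_radius r) lv.
exists L => // x y t xr yr tT.
have := ode_dist (sPhi x) (sPhi y) (L := L) _ tT; rewrite /= !Phi0; apply.
move=> s /andP[s0 sT]; apply: vL; apply: flow_ball => //; by rewrite !ltW.
Qed.

Lemma flow_time r s t x : enorm x <= r -> 0 <= s <= T -> 0 <= t <= T ->
  enorm (Phi t x - Phi s x) <= n%:R * (C * flow_radius r * `|t - s|).
Proof.
move=> xr sT tT; apply: (ode_time_lipschitz (sPhi x)) => // a aT.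
by apply: (le_trans (vC _)); rewrite ler_wpM2l ?flow_bound// ltW.
Qed.

(** Both sides solve the equation on [0, T - s] from the point [Phi s x]. *)
Lemma flow_semigroup s t x : 0 <= t <= T -> 0 <= s <= T -> t + s <= T ->
  Phi t (Phi s x) = Phi (t + s) x.
Proof.
move=> /andP[t0 tT] /andP[s0 sT] tsT.
apply: (@ode_unique (T - s) (Phi^~ (Phi s x)) (fun t => Phi (t + s) x)).
- have [cX dX] := sPhi (Phi s x); split => // a /andP[a0 aT]; apply: dX.
  by rewrite a0 (lt_le_trans aT)// gerBl.
- have [cX dX] := sPhi x; split.
    move=> i a; apply: (@continuous_comp _ _ _ (fun a => a + s) (fun a => Phi a x 0 i)).
      by apply: cvgD; [exact: cvg_id|exact: cvg_cst].
    exact: cX.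
  move=> a /andP[a0 aT] i.
  have da : is_derive (a + s) 1 (fun a => Phi a x 0 i) (v (Phi (a + s) x) 0 i).
    by apply: dX; rewrite ltr_wpDr//= -ltrBrDr.
  have ds : is_derive a 1 (fun a : R => a + s) 1.
    have := is_deriveD (is_derive_id a 1) (is_derive_cst s a 1).
    by move=> /is_derive_eq; apply; rewrite addr0.
  by have := is_derive1_comp ds da; rewrite mulr1.
- by rewrite Phi0 add0r.
- by rewrite t0 lerBrDr.
Qed.

(** Stated for every real [t], since [push] takes the continuity proof as an argument and curves of
    measures are indexed by [R]; clamping brings [t] back to [0, T]. *)
Lemma flow_continuous t : continuous (Phi t).
Proof.
apply: locally_lipschitz_continuous => c; exists 1 => //.
have [L L0 PL] := flow_dist (enorm c + 1).
have tT : 0 <= clamp 0 T t <= T by apply: clamp_itv; exact: ltW.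
exists (expR (L * clamp 0 T t)) => x y xc yc; rewrite ![Phi t _]Phi_clamp.
have ball (z : E) : eball c 1 z -> enorm z <= enorm c + 1.
  rewrite /eball/= => zc; have := ler_enorm_dist z c 0; rewrite !subr0 => /le_trans.
  by apply; rewrite addrC lerD2l ltW.
by apply: PL => //; exact: ball.
Qed.

Lemma flow_time_continuous x : continuous (Phi^~ x).
Proof. exact: ode_continuous (sPhi x). Qed.

End flow_properties.
End flow.

(** * The push-forward by the flow is a solution *)

Section chain_rule.
Context (R : realType) (n : nat).
Local Notation E := 'rV[R]_n.
Implicit Types (f : E -> R) (x h z : E).

Lemma is_derive_cvg (V W : normedModType R) (f : V -> W) (x u : V) (d : W) :
  is_derive x u f d -> t^-1 *: (f (t *: u + x) - f x) @[t --> 0^'] --> d.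
Proof. by move=> [fx <-]; exact: fx. Qed.

Lemma cvg_is_derive (V W : normedModType R) (f : V -> W) (x u : V) (d : W) :
  t^-1 *: (f (t *: u + x) - f x) @[t --> 0^'] --> d -> is_derive x u f d.
Proof.
move=> fd; apply: DeriveDef; first by apply/cvg_ex; exists d.
exact: cvg_lim fd.
Qed.

Lemma is_derive_line f z (u : E) (s d : R) :
  is_derive (z + s *: u) u f d -> is_derive s 1 (fun t => f (z + t *: u)) d.
Proof.
move=> /is_derive_cvg H; apply: cvg_is_derive.
rewrite (_ : (fun t => _) = fun t => t^-1 *: (f (t *: u + (z + s *: u)) - f (z + s *: u)))//.
apply/funext => t; congr (_ *: (f _ - _)).
by rewrite (_ : t *: (1 : R) = t) ?scalerDl 1?addrCA//; exact: mulr1.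
Qed.

(** The corners of the path from 0 to [h] that follows one axis at a time. *)
Definition partial_vector h (k : nat) : E := \row_i (if (i < k)%N then h 0 i else 0).

Lemma partial_vectorS h (k : 'I_n) :
  partial_vector h k.+1 = partial_vector h k + h 0 k *: delta_mx 0 k.
Proof.
apply/rowP => i; rewrite !mxE ltnS leq_eqVlt /= -val_eqE/=.
have [ik|ik] := eqVneq (i : nat) k; last by rewrite /= mulr0 addr0.
by rewrite ik ltnn mulr1 add0r; congr (h 0 _); exact: val_inj.
Qed.

(** Test functions come with derivatives along the axes only, so the increment is telescoped along a
    path of axis-parallel edges, with the mean value theorem on each. The path never leaves the
    sup-norm ball of radius [|h|] about [x], where [fe] applies. *)
Lemma C1_increment f x h (e : R) :
  continuous f -> (forall i y, derivable f y (delta_mx 0 i)) ->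
  (forall i y, `|y - x| <= `|h| -> `|partial i f y - partial i f x| <= e) ->
  `|f (x + h) - f x - dotv (grad f x) h| <= e * \sum_i `|h 0 i|.
Proof.
move=> cf df fe.
have H0 : partial_vector h 0 = 0 by apply/rowP => i; rewrite !mxE.
have Hn : partial_vector h n = h by apply/rowP => i; rewrite !mxE ltn_ord.
pose g k := f (x + partial_vector h k).
have -> : f (x + h) - f x = \sum_(i < n) (g i.+1 - g i).
  rewrite -(big_mkord xpredT (fun i => g i.+1 - g i)) telescope_sumr//.
  by rewrite /g H0 Hn addr0.
rewrite /dotv -sumrB mulr_sumr (le_trans (ler_norm_sum _ _ _))//.
apply: ler_sum => k _.
pose z := x + partial_vector h k; pose u : E := delta_mx 0 k.
have [c /andP[c0 c1]] : exists2 c, 0 <= c <= 1 & 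
    f (z + (1 * h 0 k) *: u) - f (z + (0 * h 0 k) *: u) =
    (partial k f (z + (c * h 0 k) *: u) * h 0 k) * (1 - 0).
  apply: (@MVT_continuous _ (fun s => f (z + (s * h 0 k) *: u))
    (fun c => partial k f (z + (c * h 0 k) *: u) * h 0 k)) => //.
    move=> s; have cl : {for s, continuous (fun s : R => z + (s * h 0 k) *: u)}.
      apply: (@cvgD _ _ _ (nbhs s)); first exact: cvg_cst.
      apply: (@cvgZr_tmp _ _ _ (nbhs s)).
      by apply: cvgM; [exact: cvg_id|exact: cvg_cst].
    exact: (continuous_comp cl (cf _)).
  move=> s _.
  have d1 : is_derive s 1 (fun s : R => s * h 0 k) (h 0 k).
    have := is_deriveM (is_derive_id s 1) (is_derive_cst (h 0 k) s 1).
    by move=> /is_derive_eq; apply; rewrite scaler0 add0r /GRing.scale/= mulr1.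
  apply: (is_derive1_comp (g := fun s => f (z + s *: u)) d1).
  by apply: is_derive_line; apply: DeriveDef => //; exact: df.
rewrite mul1r mul0r scale0r addr0 subr0 mulr1 => E1.
have -> : g k.+1 - g k = partial k f (z + (c * h 0 k) *: u) * h 0 k.
  by rewrite -E1 /g partial_vectorS addrA.
rewrite mxE -mulrBl normrM ler_wpM2r//; apply: fe.
rewrite (_ : z + _ - x = partial_vector h k + (c * h 0 k) *: u); last first.
  by apply/rowP => j; rewrite /z !mxE; ring.
have [->|hk] := eqVneq (partial_vector h k + (c * h 0 k) *: u) 0; first by rewrite normr0.
rewrite [leLHS]/Num.Def.normr /= mx_normrE; apply: bigmax_le => // -[i j] _ /=.
rewrite (ord1 i) !mxE/= -val_eqE/=; have [jk|jk] := eqVneq (j : nat) k.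
  have -> : j = k by exact: val_inj.
  rewrite ltnn add0r mulr1 normrM (ger0_norm c0).
  apply: le_trans (coord_le_norm h k).
  by rewrite ler_piMl.
rewrite mulr0 addr0; case: ifPn => _; last by rewrite normr0.
exact: coord_le_norm.
Qed.

Lemma C1_chain_rule f (X : R -> E) (t : R) (y : E) :
  continuous f -> (forall i z, derivable f z (delta_mx 0 i)) ->
  (forall i, continuous (partial i f)) ->
  {for t, continuous X} -> (forall i, is_derive t 1 (fun s => X s 0 i) (y 0 i)) ->
  is_derive t 1 (fun s => f (X s)) (dotv (grad f (X t)) y).
Proof.
move=> cf df cpf cX dX; apply: cvg_is_derive.
pose h s := X (s *: 1 + t) - X t.
pose D s := \sum_i partial i f (X t) * (s^-1 *: (h s 0 i)).
have q i : s^-1 *: (h s 0 i) @[s --> 0^'] --> y 0 i.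
  rewrite (_ : (fun s => _) = fun s => s^-1 *: (X (s *: 1 + t) 0 i - X t 0 i)).
    exact: is_derive_cvg (dX i).
  by apply/funext => s; rewrite /h !mxE.
have Dcvg : D s @[s --> 0^'] --> dotv (grad f (X t)) y.
  rewrite /dotv; apply: (@cvg_big _ _ +%R 0 xpredT add_continuous) => i _.
  by rewrite mxE; apply: cvgM; [exact: cvg_cst|exact: q].
have Ncvg : \sum_i `|s^-1 *: (h s 0 i)| @[s --> 0^'] --> \sum_i `|y 0 i|.
  apply: (@cvg_big _ _ +%R 0 xpredT add_continuous) => i _.
  by apply: cvg_norm; exact: q.
set M := \sum_i `|y 0 i| in Ncvg.
have M0 : 0 <= M by apply: sumr_ge0 => i _; exact: normr_ge0.
apply/cvgrPdist_le => e e0.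
(* Near 0 the difference quotients of the coordinates sum to at most [M + 1], so the error of
   [C1_increment] is at most [e / 2]; the rest is the convergence of [D]. *)
pose d := e / 2 / (M + 1).
have d0 : 0 < d by rewrite !divr_gt0// ltr_wpDl.
have near1 i : \forall z \near X t, `|partial i f (X t) - partial i f z| < d.
  by move/cvgrPdist_lt : (cpf i (X t)) => /(_ _ d0).
have nearp : \forall z \near X t, forall i : 'I_n,
    `|partial i f (X t) - partial i f z| < d by exact: (filter_forall (nbhs_filter (X t)) near1).
have [a /= a0 pa] := (nbhs_ballP _ _).1 nearp.
have hcvg : \forall s \near 0^', `|h s| < a.
  have st : s + t @[s --> (0 : R)] --> t.
    by rewrite -[X in _ --> X]add0r; apply: cvgD; [exact: cvg_id|exact: cvg_cst].
  have Xst : X (s + t) @[s --> (0 : R)] --> X t by exact: cvg_comp st cX.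
  apply: (@cvg_within _ (nbhs (0 : R))).
  move/cvgrPdist_lt : Xst => /(_ _ a0); apply: filterS => s.
  by rewrite distrC /h (_ : s *: (1 : R) = s)//; exact: mulr1.
near=> s.
have s0 : s != 0 by near: s; exact: nbhs_dnbhs_neq.
have sa : `|h s| < a by near: s.
have h1 : `|dotv (grad f (X t)) y - D s| <= e / 2.
  by near: s; move/cvgrPdist_le : Dcvg; apply; rewrite divr_gt0.
have h2 : \sum_i `|s^-1 *: (h s 0 i)| <= M + 1.
  by apply: ltW; near: s; apply: (cvgr_lt _ Ncvg); rewrite ltrDl.
have inc := @C1_increment f (X t) (h s) d cf df.
have /inc : forall i z, `|z - X t| <= `|h s| -> `|partial i f z - partial i f (X t)| <= d.
  move=> i z zh; rewrite distrC; apply: ltW; apply: pa.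
  by rewrite ball_row/= distrC (le_lt_trans zh).
rewrite [X t + h s]addrC subrK => h3.
have h4 : `|s^-1 *: (f (X (s *: 1 + t)) - f (X t)) - D s| <= e / 2.
  have -> : D s = s^-1 * dotv (grad f (X t)) (h s).
    by rewrite /D /dotv mulr_sumr; apply: eq_bigr => i _; rewrite !mxE /GRing.scale/=; ring.
  rewrite /GRing.scale/= -mulrBr normrM.
  apply: (@le_trans _ _ (`|s^-1| * (d * \sum_i `|h s 0 i|))); first by rewrite ler_wpM2l.
  rewrite mulrCA mulr_sumr (_ : \sum_i _ = \sum_i `|s^-1 *: (h s 0 i)|); last first.
    by apply: eq_bigr => i _; rewrite normrM.
  apply: (@le_trans _ _ (d * (M + 1))); first by rewrite ler_wpM2l// ltW.
  by rewrite divfK// gt_eqF// ltr_wpDl.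
rewrite -[X in `|X|](subrKA (D s)) (le_trans (ler_normD _ _))// (splitr e) lerD//.
by rewrite distrC.
Unshelve. all: by end_near. Qed.

End chain_rule.

Lemma continuous_compose (X Y Z : topologicalType) (f : X -> Y) (g : Y -> Z) :
  continuous f -> continuous g -> continuous (fun x => g (f x)).
Proof. by move=> cf cg x; apply: continuous_comp; [exact: cf|exact: cg]. Qed.

(** * Integrals against measures carried by a ball *)

Section integrals_on_balls.
Context (R : realType) (n : nat).
Local Notation E := 'rV[R]_n.
Implicit Types (mu : Prob R E).

Lemma continuous_ball_bound (g : E -> R) (r : R) : continuous g ->
  exists2 M : R, 0 <= M & forall x, enorm x <= r -> `|g x| <= M.
Proof.
move=> cg; have cB : compact (g @` [set x : E | enorm x <= r]).
  by apply: continuous_compact; [exact: continuous_subspaceT|exact: enorm_compact].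
have [M [Mr MP]] := compact_bounded cB.
exists (Num.max M 0 + 1).
  by rewrite addr_ge0// le_max lexx orbT.
move=> x xr; apply: MP; last by exists x.
by rewrite ltr_pwDr// le_max lexx.
Qed.

Lemma integrable_ae_bounded mu (r M : R) (g : E -> R) :
  mu (~` [set x : E | enorm x <= r]) = 0%E ->
  measurable_fun setT (g : borel E -> R) ->
  (forall x, enorm x <= r -> `|g x| <= M) ->
  mu.-integrable setT (EFin \o g).
Proof.
move=> mur mg gM; apply/integrableP; split; first exact/measurable_EFinP.
have mB : measurable ([set x : E | enorm x <= r] : set (borel E)).
  by apply: closed_borel; exact: enorm_closed.
apply: (@le_lt_trans _ _ (\int[mu]_x `|M|%:E)%E); last first.
  by rewrite integral_cst_probability ltry.
apply: ae_ge0_le_integral => //.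
- by apply: measurableT_comp => //; exact/measurable_EFinP.
- exists (~` [set x : E | enorm x <= r]); split => //; first exact: measurableC.
  move=> x /= + xr; apply => _; rewrite lee_fin.
  exact: le_trans (gM x xr) (ler_norm _).
Qed.

Lemma Rintegral_full mu (B : set (borel E)) (g : E -> R) :
  measurable B -> mu (~` B) = 0%E -> mu.-integrable setT (EFin \o g) ->
  \int[mu]_x g x = \int[mu]_(x in B) g x.
Proof.
move=> mB B0 ig; rewrite /Rintegral.
rewrite (@negligible_integral _ _ _ mu setT (~` B))//; first by rewrite setTD setCK.
exact: measurableC.
Qed.

End integrals_on_balls.

(** * Test functions transported by the flow *)

Section flow_solution.
Context (R : realType) (n : nat) (v : 'rV[R]_n -> 'rV[R]_n).
Local Notation E := 'rV[R]_n.
Local Notation TE := (E * E)%type.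
Context (lv : locally_lipschitz v) (C : R) (C0 : 0 < C).
Hypothesis vC : forall x, enorm (v x) <= C * (1 + enorm x).
Context (T : R) (Phi : R -> E -> E).
Hypothesis T0 : 0 < T.
Hypothesis Phi0 : forall x, Phi 0 x = x.
Hypothesis sPhi : forall x, ode_solution v T (Phi^~ x).
Hypothesis Phi_clamp : forall t x, Phi t x = Phi (clamp 0 T t) x.
Hypothesis cPhi : forall t, continuous (Phi t).
Context (mu : Prob R E) (r : R).
Hypothesis mur : mu (~` [set x : E | enorm x <= r]) = 0%E.

(** Integrals are restricted to this set of full measure because the constants that dominate the
    integrands are bounds on it only. *)
Let B : set (borel E) := [set x : E | enorm x <= r].

Let mB : measurable B.
Proof. by apply: closed_borel; exact: enorm_closed. Qed.

Let flow_B t x : B x -> enorm (Phi t x) <= flow_radius C T r.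
Proof.
move=> xr; rewrite Phi_clamp; apply: (flow_ball C0 vC) => //.
by apply: clamp_itv; exact: ltW.
Qed.

Let integrable_flow (g : E -> R) : continuous g -> forall t,
  mu.-integrable setT (EFin \o (fun x => g (Phi t x))).
Proof.
move=> cg t; have [M M0 gM] := continuous_ball_bound (flow_radius C T r) cg.
apply: (integrable_ae_bounded mur (M := M)).
  by apply: continuous_measurable_real; exact: (continuous_compose (@cPhi t) cg).
by move=> x xr; apply: gM; exact: flow_B.
Qed.

Let integrable_flow_B (g : E -> R) : continuous g -> forall t,
  mu.-integrable B (EFin \o (fun x => g (Phi t x))).
Proof.
move=> cg t; apply: (@integrableS _ _ _ mu setT) => //.
exact: integrable_flow.
Qed.

Let mean_flow_continuous (g : E -> R) : continuous g ->
  continuous (fun t => \int[mu]_(x in B) g (Phi t x)).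
Proof.
move=> cg t; have [M M0 gM] := continuous_ball_bound (flow_radius C T r) cg.
apply: (@continuity_under_integral _ _ (borel E) mu (fun t x => g (Phi t x)) B mB
  (t - 1) (t + 1) _ _ (fun=> M)).
- by move=> x _; exact: integrable_flow_B.
- apply: aeW => x _ s _.
  exact: (@continuous_compose _ _ _ _ _ (@flow_time_continuous _ _ _ _ _ sPhi x) cg s).
- apply: (@integrableS _ _ _ mu setT) => //.
  by apply: (integrable_ae_bounded mur (M := `|M|)).
- by move=> s _; apply: aeW => x Bx; apply: gM; exact: flow_B.
- by rewrite inE /= in_itv/=; apply/andP; split; [rewrite gtrBl|rewrite ltrDl].
Qed.

Section test_function.
Context (f : E -> R).
Hypothesis cf : continuous f.
Hypothesis df : forall i z, derivable f z (delta_mx 0 i).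
Hypothesis cpf : forall i, continuous (partial i f).

Let g x := dotv (grad f x) (v x).

Let cg : continuous g.
Proof.
move=> x; apply: (@cvg_big _ _ +%R 0 xpredT add_continuous _ (nbhs x)) => i _.
under eq_fun do rewrite mxE.
rewrite mxE; apply: cvgM; first exact: cpf.
apply: (@continuous_comp _ _ _ v (fun y : E => y 0 i)).
  exact: locally_lipschitz_continuous.
exact: coord_continuous.
Qed.

Let flow_derive x t : 0 < t < T -> is_derive t 1 (fun s => f (Phi s x)) (g (Phi t x)).
Proof.
move=> tT; apply: C1_chain_rule => //.
  exact: (@flow_time_continuous _ _ _ _ _ sPhi x).
by have [_ dX] := sPhi x; exact: dX.
Qed.

Let mean_f t : \int[push (@cPhi t) mu]_x f x = \int[mu]_(x in B) f (Phi t x).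
Proof.
rewrite -(Rintegral_full mB mur); last exact: integrable_flow.
rewrite /Rintegral (@integral_mpush R _ _ _ mu _ (continuous_borel (@cPhi t)))//.
  by apply/measurable_EFinP; exact: continuous_measurable_real.
exact: integrable_flow.
Qed.

Let velocity (p : TE) : R := dotv (grad f p.1) p.2.

Let velocity_measurable : measurable_fun setT (velocity : borel TE -> R).
Proof.
apply: continuous_measurable_real => p.
apply: (@cvg_big _ _ +%R 0 xpredT add_continuous _ (nbhs p)) => i _.
under eq_fun do rewrite mxE.
rewrite mxE; apply: cvgM.
  by apply: (@continuous_comp _ _ _ fst (partial i f)); [exact: cvg_fst|exact: cpf].
apply: (@continuous_comp _ _ _ snd (fun y : E => y 0 i)); first exact: cvg_snd.
exact: coord_continuous.
Qed.

Let V t : Prob R TE := pvf_of_field lv (push (@cPhi t) mu).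

Let cgraph t : continuous (fun x => (Phi t x, v (Phi t x))).
Proof.
exact: (continuous_compose (@cPhi t) (continuous_graph lv)).
Qed.

Let integrable_velocity t : (V t).-integrable setT (EFin \o velocity).
Proof.
apply: (@integrable_mpush R _ _ _ mu _ (continuous_borel (@cgraph t))).
  exact/measurable_EFinP.
exact: (integrable_flow cg).
Qed.

Let drift_flow t :
  drift (pvf_of_field lv) f (push (@cPhi t) mu) = (\int[mu]_(x in B) g (Phi t x))%:E.
Proof.
rewrite -(Rintegral_full mB mur); last exact: integrable_flow.
rewrite /Rintegral fineK; last first.
  apply: integrable_fin_num => //; exact: integrable_flow.
rewrite /drift (@integral_mpush R _ _ _ mu _ (continuous_borel (@cgraph t)) (EFin \o velocity))//.
  exact/measurable_EFinP.
exact: (integrable_flow cg).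
Qed.

Let mean_lipschitz : exists2 M : R, 0 < M & forall s t, 0 <= s -> s <= t -> t <= T ->
  `|\int[push (@cPhi t) mu]_x f x - \int[push (@cPhi s) mu]_x f x| <= M * (t - s).
Proof.
have [M M0 gM] := continuous_ball_bound (flow_radius C T r) cg.
exists (M + 1) => [|s t s0 st tT]; first by rewrite ltr_wpDl.
have ist := integrable_flow_B cf s; have itt := integrable_flow_B cf t.
rewrite !mean_f -RintegralB//.
apply: (le_trans (le_normr_Rintegral _ _)) => //.
  have := integrableB mB itt ist; apply: eq_integrable => //.
have ic : mu.-integrable B (EFin \o (fun=> M * (t - s))).
  apply: (@integrableS _ _ _ mu setT) => //.
  by apply: (integrable_ae_bounded mur (M := `|M * (t - s)|)).
apply: (@le_trans _ _ (\int[mu]_(x in B) (M * (t - s)))).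
  apply: le_Rintegral => //.
    have := integrable_abse (integrableB mB itt ist); apply: eq_integrable => //.
  move=> x Bx.
  have := @norm_le_of_derive _ (fun s => f (Phi s x)) (fun s => M * s)
    (fun s => g (Phi s x)) (fun=> M) s t st.
  rewrite -mulrBr; apply.
  - exact: (continuous_compose (@flow_time_continuous _ _ _ _ _ sPhi x) cf).
  - by move=> a; apply: cvgM; [exact: cvg_cst|exact: cvg_id].
  - move=> a /andP[sa at_]; apply: flow_derive.
    by rewrite (le_lt_trans s0 sa) (lt_le_trans at_ tT).
  - move=> a _; have := is_deriveM (is_derive_cst M a 1) (is_derive_id a 1).
    by move=> /is_derive_eq; apply; rewrite scaler0 addr0 /GRing.scale/= mulr1.
  - by move=> a _; apply: gM; exact: flow_B.
rewrite Rintegral_cst// [X in fine X](_ : _ = 1%E) ?mulr1; last exact: probability_setC0.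
by rewrite ler_wpM2r ?subr_ge0// lerDl.
Qed.

Lemma mean_flow_solution :
    [/\ exists2 g : R -> R,
          (@lebesgue_measure R).-integrable `[0, T]%classic (EFin \o g) &
          {ae @lebesgue_measure R, forall s, `[0, T]%classic s ->
            (V s).-integrable setT (fun p => (dotv (grad f p.1) p.2)%:E) /\
            drift (pvf_of_field lv) f (push (@cPhi s) mu) = (g s)%:E},
        absolutely_continuous 0 T (fun t => \int[push (@cPhi t) mu]_x f x) &
        {ae @lebesgue_measure R, forall t, `]0, T[%classic t ->
          is_derive t 1 (fun s => \int[push (@cPhi s) mu]_x f x)
            (fine (drift (pvf_of_field lv) f (push (@cPhi t) mu)))}].
Proof.
split.
- exists (fun t => \int[mu]_(x in B) g (Phi t x)).
    apply: continuous_compact_integrable; first exact: segment_compact.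
    by apply: continuous_subspaceT; exact: mean_flow_continuous.
  by apply: aeW => s _; split; [exact: integrable_velocity|exact: drift_flow].
- have [M M0 FM] := mean_lipschitz.
  move=> e e0; exists (e / M) => [|k a b ab _ sd]; first by rewrite divr_gt0.
  apply: (@le_lt_trans _ _ (\sum_(i < k) M * (b i - a i))).
    by apply: ler_sum => i _; have [? ? ?] := ab i; exact: FM.
  by rewrite -mulr_sumr mulrC -ltr_pdivlMr.
- apply: aeW => t tT; rewrite drift_flow/=.
  have tT' : 0 < t < T by move: tT; rewrite /= in_itv.
  have -> : (fun s => \int[push (@cPhi s) mu]_x f x) =
      fun s => \int[mu]_(x in B) f (Phi s x) by apply/funext => s; exact: mean_f.
  have [M M0 gM] := continuous_ball_bound (flow_radius C T r) cg.
  have d1 s x : 0 < s < T -> partial1of2 (fun s x => f (Phi s x)) s x = g (Phi s x).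
    by move=> sT; rewrite partial1of2E; have [] := flow_derive x sT.
  have Ider (s : R) (x : E) : `]0, T[%classic s -> B x -> derivable (fun s => f (Phi s x)) s 1.
    by rewrite /= in_itv/= => sT _; have [] := flow_derive x sT.
  have intf (s : R) : `]0, T[%classic s -> mu.-integrable B (EFin \o (fun x => f (Phi s x))).
    by move=> _; exact: integrable_flow_B.
  have intM : mu.-integrable B (EFin \o (fun=> M)).
    apply: (@integrableS _ _ _ mu setT) => //.
    by apply: (integrable_ae_bounded mur (M := `|M|)).
  have ub (s : R) (x : E) : `]0, T[%classic s -> B x ->
      `|partial1of2 (fun s x => f (Phi s x)) s x| <= M.
    by rewrite /= in_itv/= => sT Bx; rewrite d1//; apply: gM; exact: flow_B.
  apply: DeriveDef.
    exact: (@derivable_under_integral _ _ (borel E) mu (fun s x => f (Phi s x)) B mB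
      t 0 T tT intf Ider (fun=> M) (fun=> M0) intM ub).
  rewrite -derive1E (@differentiation_under_integral _ _ (borel E) mu
    (fun s x => f (Phi s x)) B mB t 0 T tT intf Ider (fun=> M) (fun=> M0) intM ub).
  by apply: eq_Rintegral => x _; exact: d1.
Qed.

End test_function.

Lemma flow_is_solution :
  is_solution (pvf_of_field lv) T (fun t => push (@cPhi t) mu).
Proof.
move=> f [sf _].
(* The empty word speaks of [f] and the one-letter words of its partial derivatives: together they
   make [f] of class C^1. *)
have [cf df] := sf [::].
by apply: mean_flow_solution => // i; have [] := sf [:: i].
Qed.

End flow_solution.

(** * Euler schemes and lattice approximate solutions *)

Section euler_scheme.
Context (R : realType) (n : nat) (v : 'rV[R]_n -> 'rV[R]_n).
Local Notation E := 'rV[R]_n.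

Definition grid_velocity (N : nat) (y : E) : E := grid_floor N (v y).

Definition euler (N l : nat) (y : E) : E :=
  iter l (fun y => y + N%:R^-1 *: grid_velocity N y) y.

Definition euler_curve (N : nat) (t : R) (y : E) : E :=
  let l := Num.truncn (t * N%:R) in
  euler N l y + (t - l%:R / N%:R) *: grid_velocity N (euler N l y).

Lemma euler_curveE (N l : nat) (t : R) (y : E) : (0 < N)%N ->
  0 <= t <= N%:R^-1 ->
  euler_curve N (l%:R / N%:R + t) y =
  euler N l y + t *: grid_velocity N (euler N l y).
Proof.
move=> N0 /andP[t0 tN]; have Np : 0 < (N%:R : R) by rewrite ltr0n.
have E1 : (l%:R / N%:R + t) * N%:R = l%:R + t * N%:R.
  by rewrite mulrDl divfK// gt_eqF.
have tN0 : 0 <= t * N%:R by rewrite mulr_ge0// ltW.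
rewrite /euler_curve E1.
have [tN1|tN1] := ltP (t * N%:R) 1.
  have -> : Num.truncn (l%:R + t * N%:R) = l.
    by apply: truncn_def; rewrite lerDl tN0/= -[l.+1%:R]natr1 ltrD2l.
  by rewrite addrAC subrr add0r.
(* At the right end of a step the truncation already returns [l.+1] and the affine term vanishes:
   both descriptions of the node agree. *)
have tE : t = N%:R^-1.
  by apply/eqP; rewrite eq_le tN/= -[leLHS]mul1r ler_pdivrMr.
have -> : Num.truncn (l%:R + t * N%:R) = l.+1.
  rewrite tE mulVf ?gt_eqF// natr1; apply: truncn_def.
  by rewrite lexx ltr_nat ltnS leqnn.
rewrite tE -[l.+1%:R]natr1 mulrDl mul1r subrr scale0r addr0.
by rewrite /euler iterS.
Qed.

(** A velocity in Z^n/N acting for a time 1/N is a displacement in Z^n/N^2; this explains the two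
    mesh sizes. *)
Lemma euler_grid (N l : nat) (y : E) : (0 < N)%N ->
  (forall j, exists a : int, y 0 j = a%:~R / (N ^ 2)%:R) ->
  forall j, exists a : int, euler N l y 0 j = a%:~R / (N ^ 2)%:R.
Proof.
move=> N0 gy; elim: l => [//|l IH] j; rewrite /euler iterS -/(euler N l y).
have [a aE] := IH j; have [b bE] := grid_floor_grid N (v (euler N l y)) j.
exists (a + b); rewrite !mxE aE; move: bE; rewrite mxE => ->.
by rewrite intrD natrX expr2 invfM; ring.
Qed.

Context (C : R) (C0 : 0 < C).
Hypothesis vC : forall x, enorm (v x) <= C * (1 + enorm x).
Context (T : R) (T0 : 0 < T).

(** Rounding enlarges the growth constant from [C] to [C + n] and the initial radius from [r] to at
    most [r + n]. *)
Definition euler_radius (r : R) : R := expR ((C + n%:R) * T) * (1 + r + n%:R).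

Lemma grid_velocity_close (N : nat) (y : E) : (0 < N)%N ->
  enorm (v y - grid_velocity N y) <= n%:R * N%:R^-1.
Proof. exact: enorm_grid_floor. Qed.

Lemma invN_le1 (N : nat) : (0 < N)%N -> N%:R^-1 <= 1 :> R.
Proof. by move=> N0; rewrite invf_le1 ?ltr0n// ler1n. Qed.

Lemma grid_velocity_le (N : nat) (y : E) : (0 < N)%N ->
  enorm (grid_velocity N y) <= (C + n%:R) * (1 + enorm y).
Proof.
move=> N0; have h1 := grid_velocity_close y N0; have h2 := vC y.
have h3 := enormD (v y) (grid_velocity N y - v y).
rewrite addrC subrK enormB in h3; apply: (le_trans h3).
rewrite mulrDl; apply: lerD => //; apply: (le_trans h1).
rewrite ler_wpM2l//; apply: (le_trans (invN_le1 N0)).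
by rewrite lerDl enorm_ge0.
Qed.

(** Discrete Gronwall: each step multiplies [1 + enorm z] by at most 1 + (C + n)/N, which is at most
    exp((C + n)/N). *)
Lemma euler_bound (N l : nat) (x : E) (r : R) : (0 < N)%N ->
  l%:R / N%:R <= T -> enorm x <= r ->
  1 + enorm (euler N l (grid_floor (N ^ 2) x)) <= euler_radius r.
Proof.
move=> N0 lT xr; have Np : 0 < (N%:R : R) by rewrite ltr0n.
have C'0 : 0 <= C + n%:R by rewrite addr_ge0// ltW.
have N20 : (0 < N ^ 2)%N by rewrite expn_gt0 N0.
set y := grid_floor _ x.
have y0 : 1 + enorm y <= 1 + r + n%:R.
  have h1 := enorm_grid_floor x N20; rewrite -/y in h1.
  have h2 := enormD x (y - x); rewrite addrC subrK enormB in h2.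
  have h3 : n%:R * (N ^ 2)%:R^-1 <= n%:R :> R by rewrite ler_piMr// invN_le1.
  by move: h1 h2 h3; lra.
have H : 1 + enorm (euler N l y) <= expR ((C + n%:R) * (l%:R / N%:R)) * (1 + r + n%:R).
  elim: l lT => [_|l IH lT]; first by rewrite mul0r mulr0 expR0 mul1r.
  have lT' : l%:R / N%:R <= T.
    by apply: le_trans lT; rewrite ler_pM2r ?invr_gt0// ler_nat.
  rewrite /euler iterS -/(euler N l y); set z := euler N l y in IH *.
  have h1 := enormD z (N%:R^-1 *: grid_velocity N z).
  rewrite enormZ (ger0_norm (_ : 0 <= N%:R^-1)) ?invr_ge0 ?(ltW Np)// in h1.
  have h2 := grid_velocity_le z N0.
  have h3 : 1 + enorm (z + N%:R^-1 *: grid_velocity N z) <=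
      (1 + (C + n%:R) / N%:R) * (1 + enorm z).
    rewrite -lerBrDl; apply: (le_trans h1).
    apply: (@le_trans _ _ (enorm z + N%:R^-1 * ((C + n%:R) * (1 + enorm z)))).
      by rewrite lerD2l ler_wpM2l ?invr_ge0 ?(ltW Np).
    by rewrite -subr_ge0 (_ : _ - _ = 0)//; ring.
  apply: (le_trans h3).
  have -> : expR ((C + n%:R) * (l.+1%:R / N%:R)) =
      expR ((C + n%:R) / N%:R) * expR ((C + n%:R) * (l%:R / N%:R)).
    by rewrite -expRD -natr1; congr expR; ring.
  rewrite -mulrA.
  apply: ler_pM.
  - by rewrite addr_ge0// divr_ge0// ltW.
  - by rewrite addr_ge0// enorm_ge0.
  - exact: expR_ge1Dx.
  - exact: IH.
apply: (le_trans H); rewrite ler_wpM2r//.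
  by apply: le_trans y0; rewrite addr_ge0// enorm_ge0.
by rewrite ler_expR ler_wpM2l.
Qed.

End euler_scheme.

(** * Convergence of the Euler scheme to the flow *)

Section euler_convergence.
Context (R : realType) (n : nat) (v : 'rV[R]_n -> 'rV[R]_n).
Local Notation E := 'rV[R]_n.
Context (lv : locally_lipschitz v) (C : R) (C0 : 0 < C).
Hypothesis vC : forall x, enorm (v x) <= C * (1 + enorm x).
Context (T : R) (Phi : R -> E -> E).
Hypothesis T0 : 0 < T.
Hypothesis Phi0 : forall x, Phi 0 x = x.
Hypothesis sPhi : forall x, ode_solution v T (Phi^~ x).

Lemma time_step (N : nat) (t : R) : (0 < N)%N -> 0 <= t <= T ->
  exists l, exists2 s, 0 <= s <= N%:R^-1 & t = l%:R / N%:R + s /\ l%:R / N%:R <= T.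
Proof.
move=> N0 /andP[t0 tT]; have Np : 0 < (N%:R : R) by rewrite ltr0n.
have tN0 : 0 <= t * N%:R by rewrite mulr_ge0// ltW.
have /andP[h1 h2] := truncn_itv tN0.
set l := Num.truncn _ in h1 h2.
have h3 : l%:R / N%:R <= t by rewrite ler_pdivrMr.
exists l, (t - l%:R / N%:R).
  rewrite subr_ge0 h3/= lerBlDr -[X in X + _]mul1r -mulrDl ler_pdivlMr//.
  by rewrite addrC natr1 ltW.
by split; [rewrite addrC subrK|exact: le_trans h3 tT].
Qed.

Lemma euler_cvg (r : R) : exists2 K : R, 0 <= K & forall (N : nat) t x,
  (0 < N)%N -> 0 <= t <= T -> enorm x <= r ->
  enorm (Phi t x - euler_curve v N t (grid_floor (N ^ 2) x)) <= K / N%:R.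
Proof.
pose rho := Num.max (euler_radius n C T r) (flow_radius C T r).
have [L L0 vL] := locally_lipschitz_ball rho lv.
have Phi_rho t x : 0 <= t <= T -> enorm x <= r -> enorm (Phi t x) <= rho.
  move=> tT xr; rewrite le_max; apply/orP; right.
  exact: (flow_ball C0 vC Phi0 sPhi).
have y_rho N l x : (0 < N)%N -> l%:R / N%:R <= T -> enorm x <= r ->
    enorm (euler v N l (grid_floor (N ^ 2) x)) <= rho.
  move=> N0 lT xr; rewrite le_max; apply/orP; left.
  have := euler_bound C0 vC N0 lT xr; apply: le_trans.
  by rewrite lerDr.
pose M := C * flow_radius C T r.
(* The term [n] is the rounding of the velocity. In the other, a trajectory moves by at most n M/N
   during a step, so [v] varies by L n M/N along it, and [ode_step] adds a factor [n]. *)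
pose D := n%:R + n%:R * (L * (n%:R * `|M|)).
have D0 : 0 <= D by rewrite addr_ge0// !mulr_ge0// ltW.
have L0' := ltW L0.
have step N l x s : (0 < N)%N -> enorm x <= r -> 0 <= s <= N%:R^-1 ->
    l%:R / N%:R + s <= T ->
    let y := euler v N l (grid_floor (N ^ 2) x) in
    enorm (Phi (l%:R / N%:R + s) x - (y + s *: grid_velocity v N y)) <=
    (1 + s * L) * enorm (Phi (l%:R / N%:R) x - y) + s * D / N%:R.
  move=> N0 xr /andP[s0 sN] lsT; cbv zeta; set y := euler v N l _.
  have Np : 0 < (N%:R : R) by rewrite ltr0n.
  pose a : R := l%:R / N%:R; rewrite -/a in lsT *.
  have a0 : 0 <= a by rewrite divr_ge0.
  have aT : a <= T by apply: le_trans lsT; rewrite lerDl.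
  have aT' : 0 <= a <= T by rewrite a0.
  have h1 : enorm (Phi (a + s) x - Phi a x - s *: v (Phi a x)) <=
      n%:R * ((L * (n%:R * `|M|) / N%:R) * s).
    have := @ode_step _ _ v T (Phi^~ x) (L * (n%:R * `|M|) / N%:R) a (a + s) (sPhi x) a0.
    rewrite lerDl [a + s - a]addrAC subrr add0r; apply => // b /andP[ab bs].
    have bT : 0 <= b <= T by rewrite (le_trans a0 ab) (le_trans bs lsT).
    have h := flow_time C0 vC Phi0 sPhi xr aT' bT.
    apply: (le_trans (vL _ _ (Phi_rho _ _ bT xr) (Phi_rho _ _ aT' xr))).
    rewrite -!mulrA; apply: ler_wpM2l => //; apply: (le_trans h).
    apply: ler_wpM2l => //; apply: ler_pM => //.
    - by rewrite mulr_ge0 ?(ltW C0)// mulr_ge0 ?expR_ge0// addr_ge0// (le_trans (enorm_ge0 x)).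
    - exact: ler_norm.
    - by rewrite ger0_norm ?subr_ge0// (le_trans _ sN)// lerBlDl.
  have h2 : enorm (v (Phi a x) - v y) <= L * enorm (Phi a x - y).
    by apply: vL; [exact: Phi_rho|exact: y_rho].
  have h3 := grid_velocity_close v y N0.
  rewrite (_ : _ - _ = (Phi (a + s) x - Phi a x - s *: v (Phi a x)) +
     ((Phi a x - y) + (s *: (v (Phi a x) - v y) + s *: (v y - grid_velocity v N y)))); last first.
    by apply/rowP => j; rewrite !mxE; ring.
  apply: (le_trans (enormD _ _)).
  have k1 := enormD (Phi a x - y) (s *: (v (Phi a x) - v y) + s *: (v y - grid_velocity v N y)).
  have k2 := enormD (s *: (v (Phi a x) - v y)) (s *: (v y - grid_velocity v N y)).
  rewrite !enormZ !(ger0_norm s0) in k2.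
  have k3 := ler_wpM2l s0 h2; have k4 := ler_wpM2l s0 h3.
  have -> : (1 + s * L) * enorm (Phi a x - y) + s * D / N%:R =
     n%:R * (L * (n%:R * `|M|) / N%:R * s) + (enorm (Phi a x - y) +
     (s * (L * enorm (Phi a x - y)) + s * (n%:R / N%:R))) by rewrite /D; ring.
  apply: lerD => //; apply: (le_trans k1); rewrite lerD2l; apply: (le_trans k2).
  exact: lerD.
(* The initial error is n/N^2 <= n/N. Each step amplifies by at most exp(L/N) and adds D/N^2; the
   additions over a time a amount to D a/N before amplification. *)
have grid_err N l x : (0 < N)%N -> enorm x <= r -> l%:R / N%:R <= T ->
    enorm (Phi (l%:R / N%:R) x - euler v N l (grid_floor (N ^ 2) x)) <=
    expR (L * (l%:R / N%:R)) * ((n%:R + D * (l%:R / N%:R)) / N%:R).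
  move=> N0 xr; have Np : 0 < (N%:R : R) by rewrite ltr0n.
  have N20 : (0 < N ^ 2)%N by rewrite expn_gt0 N0.
  elim: l => [_|l IH lT].
    rewrite mul0r !mulr0 expR0 mul1r addr0 Phi0.
    apply: (le_trans (enorm_grid_floor x N20)).
    rewrite ler_wpM2l// lef_pV2 ?posrE ?ltr0n// ler_nat.
    by rewrite -mulnn leq_pmulr.
  have lE : l.+1%:R / N%:R = l%:R / N%:R + N%:R^-1 :> R by rewrite -natr1 mulrDl mul1r.
  rewrite lE in lT *.
  have lT' : l%:R / N%:R <= T by apply: le_trans lT; rewrite lerDl invr_ge0.
  have NN : 0 <= (N%:R^-1 : R) <= N%:R^-1 by rewrite lexx invr_ge0 ltW.
  have := step N l x _ N0 xr NN lT => /= H; apply: (le_trans H); clear H.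
  have IH' := IH lT'.
  set a : R := l%:R / N%:R in IH' *.
  have a0 : 0 <= a by rewrite divr_ge0.
  have g0 : 0 <= (n%:R + D * a) / N%:R by rewrite divr_ge0// addr_ge0// mulr_ge0.
  have f1 : 1 + N%:R^-1 * L <= expR (L * N%:R^-1).
    by rewrite mulrC; exact: expR_ge1Dx.
  have f2 : 0 <= N%:R^-1 * D / N%:R by rewrite !mulr_ge0// invr_ge0 ltW.
  rewrite [L * (a + _)]mulrDr expRD.
  apply: (@le_trans _ _ (expR (L * N%:R^-1) * (expR (L * a) * ((n%:R + D * a) / N%:R)) +
     expR (L * a) * expR (L * N%:R^-1) * (N%:R^-1 * D / N%:R))); last first.
    by rewrite -subr_ge0 (_ : _ - _ = 0)//; ring.
  apply: lerD.
    apply: ler_pM => //; last exact: enorm_ge0.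
    by rewrite addr_ge0// mulr_ge0// invr_ge0 ltW.
  have iN : 0 <= (N%:R^-1 : R) by rewrite invr_ge0 ltW.
  have g1 : 1 <= expR (L * a) * expR (L * N%:R^-1).
    by rewrite -expRD -[leLHS](@expR0 R) ler_expR addr_ge0// mulr_ge0.
  by rewrite -[leLHS]mul1r ler_wpM2r.
(* The error at the last node, followed by one possibly incomplete step of length at most 1. *)
pose K := (1 + L) * (expR (L * T) * (n%:R + D * T)) + D.
have T0' := ltW T0.
have K0 : 0 <= K.
  by rewrite addr_ge0// mulr_ge0 ?addr_ge0// mulr_ge0 ?expR_ge0// addr_ge0// mulr_ge0.
exists K => // N t x N0 tT xr.
have Np : 0 < (N%:R : R) by rewrite ltr0n.
have [l [s sN [tE lT]]] := time_step N0 tT.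
have lsT : l%:R / N%:R + s <= T by rewrite -tE; case/andP: tT.
rewrite tE euler_curveE//; apply: (le_trans (step _ _ _ _ N0 xr sN lsT)).
have s1 : s <= 1 by case/andP: sN => _ /le_trans; apply; exact: invN_le1.
have s0 : 0 <= s by case/andP: sN.
have h := grid_err _ _ _ N0 xr lT.
set a : R := l%:R / N%:R in lT h *.
have a0 : 0 <= a by rewrite divr_ge0.
rewrite [K / _]mulrDl; apply: lerD; last first.
  by rewrite ler_wpM2r ?invr_ge0 ?(ltW Np)// ler_piMl.
rewrite -!mulrA; apply: ler_pM.
- by rewrite addr_ge0// mulr_ge0.
- exact: enorm_ge0.
- by rewrite lerD2l ler_piMl.
apply: (le_trans h); apply: ler_pM.
- exact: expR_ge0.
- by rewrite divr_ge0// addr_ge0// mulr_ge0.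
- by rewrite ler_expR ler_wpM2l.
- by rewrite ler_wpM2r ?invr_ge0 ?(ltW Np)// lerD2l ler_wpM2l.
Qed.

End euler_convergence.

Lemma probability_finite_partition d (T : measurableType d) (R : realType)
    (P : probability T R) (I : finType) (Q : I -> set T) (A : set T) :
  (forall i, measurable (Q i)) -> (forall i j x, Q i x -> Q j x -> i = j) ->
  P (~` (\bigcup_i Q i)) = 0%E -> measurable A ->
  P A = (\sum_i P (A `&` Q i))%E.
Proof.
move=> mQ dQ Q0 mA.
have mU : measurable (\bigcup_i Q i).
  by apply: fin_bigcup_measurable => //; exact: finite_finset.
rewrite -(measure_setI_full mA mU Q0) setI_bigcupr.
rewrite measure_fin_bigcup//.
- rewrite (fsbigE (enum I)) ?enum_uniq//=; last by move=> i _; rewrite mem_enum.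
  by rewrite big_enum_cond/=; apply: eq_bigl => i; rewrite in_setT.
- exact: finite_finset.
- move=> i j _ _ [x [[_ Qi] [_ Qj]]]; exact: dQ Qi Qj.
- by move=> i _; exact: measurableI.
Qed.

(** * Lattice approximate solutions as push-forwards *)

Section lattice_approximations.
Context (R : realType) (n : nat) (v : 'rV[R]_n -> 'rV[R]_n).
Local Notation E := 'rV[R]_n.
Context (lv : locally_lipschitz v).

Definition lattice_flow (N : nat) (t : R) (x : E) : E :=
  euler_curve v N t (grid_floor (N ^ 2) x).

Lemma measurable_lattice_flow (N : nat) (t : R) : (0 < N)%N ->
  measurable_fun setT (lattice_flow N t : borel E -> borel E).
Proof.
by move=> N0; apply: (@measurable_grid_fun R n (N ^ 2)); rewrite expn_gt0 N0.
Qed.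

Lemma indicator_dirac (P : Prob R E) (Q : set (borel E)) (A : set (borel E))
    (x : E) (Y : E -> E) :
  measurable A -> (forall y, Q y -> Y y = x) ->
  P ((Y @^-1` A) `&` Q) = (P Q * \d_(x : borel E) A)%E.
Proof.
move=> mA QY; rewrite diracE; have [xA|xA] := boolP (x \in A).
  rewrite mule1; congr (P _); apply/seteqP; split=> y; first by case.
  by move=> Qy; split => //=; rewrite QY//; exact: set_mem.
rewrite mule0 (_ : _ `&` _ = set0) ?measure0//.
apply/seteqP; split=> // y [/= Ay Qy]; move/negP : xA; apply.
by apply: mem_set; rewrite -(QY _ Qy).
Qed.

Context (C : R) (C0 : 0 < C).
Hypothesis vC : forall x, enorm (v x) <= C * (1 + enorm x).
Context (T : R) (T0 : 0 < T).

(** The two lower bounds on [N] keep velocities and positions in [-N, N]^n: this is what large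
    enough means for [N]. *)
Lemma grid_flow_lattice (N l : nat) (x : E) (r : R) : (0 < N)%N ->
  (C + n%:R) * euler_radius n C T r <= N%:R -> euler_radius n C T r <= N%:R ->
  l%:R / N%:R <= T -> enorm x <= r ->
  let y := euler v N l (grid_floor (N ^ 2) x) in
  (exists i : lattice n N (N ^ 2), lattice_point R i = y) /\
  (exists j : lattice n N N, lattice_point R j = grid_velocity v N y).
Proof.
move=> N0 CN rN lT xr; cbv zeta; set y := euler v N l _.
have N20 : (0 < N ^ 2)%N by rewrite expn_gt0 N0.
have yr := euler_bound C0 vC N0 lT xr; rewrite -/y in yr.
have y1 : enorm y <= 1 + enorm y by rewrite lerDr.
split; apply: grid_lattice => //.
- by apply: euler_grid => // j; exact: grid_floor_grid.
- move=> j; apply: (le_trans (coord_le_enorm _ _)).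
  exact: le_trans y1 (le_trans yr rN).
- by move=> j; exact: grid_floor_grid.
- move=> j; apply: (le_trans (coord_le_enorm _ _)); apply: le_trans CN.
  apply: (le_trans (grid_velocity_le vC y N0)).
  by rewrite ler_wpM2l// addr_ge0// ltW.
Qed.

Lemma euler_is_LAS (mu0 : Prob R E) (r : R) (N : nat) (N0 : (0 < N)%N) :
  mu0 (~` [set x : E | enorm x <= r]) = 0%E ->
  (C + n%:R) * euler_radius n C T r <= N%:R -> euler_radius n C T r <= N%:R ->
  is_LAS (pvf_of_field lv) T mu0 N
    (fun t => mpush mu0 (measurable_lattice_flow t N0)).
Proof.
move=> mu0r CN rN.
have N20 : (0 < N ^ 2)%N by rewrite expn_gt0 N0.
have flow0 l x : lattice_flow N (l%:R / N%:R) x = euler v N l (grid_floor (N ^ 2) x).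
  have tN : 0 <= (0 : R) <= N%:R^-1 by rewrite lexx invr_ge0 ler0n.
  have := euler_curveE v l (grid_floor (N ^ 2) x) N0 tN.
  by rewrite !addr0 scale0r addr0.
have mB : measurable ([set x : E | enorm x <= r] : set (borel E)).
  by apply: closed_borel; exact: enorm_closed.
have cover (I : finType) (Q : I -> set (borel E)) : (forall i, measurable (Q i)) ->
    (forall x, enorm x <= r -> exists i, Q i x) -> mu0 (~` (\bigcup_i Q i)) = 0%E.
  move=> mQ QB; apply: (subset_measure0 _ _ _ mu0r).
  - apply: measurableC; apply: fin_bigcup_measurable => //; exact: finite_finset.
  - exact: measurableC.
  - by apply: subsetC => x /QB[i Qi]; exists i.
have mflow (t : R) (A : set (borel E)) : measurable A ->
    measurable (lattice_flow N t @^-1` A : set (borel E)).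
  by move=> mA; rewrite -[X in measurable X]setTI; exact: measurable_lattice_flow.
split => //.
- move=> A mA.
  have mQ (i : lattice n N (N ^ 2)) :
      measurable (cell (N ^ 2) (lattice_point R i) : set (borel E)).
    exact: cell_measurable.
  have flowE x : lattice_flow N 0 x = grid_floor (N ^ 2) x.
    by have := flow0 0%N x; rewrite mul0r.
  rewrite mpushE (probability_finite_partition (Q := fun i : lattice n N (N ^ 2) =>
    (cell (N ^ 2) (lattice_point R i) : set (borel E))) mQ).
  + apply: eq_bigr => i _; apply: indicator_dirac => // y iy.
    by rewrite flowE; apply/lattice_cell.
  + move=> i j x /(lattice_cell _ _ N20) xi /(lattice_cell _ _ N20) xj.
    by apply: (@lattice_point_inj R n N (N ^ 2) N20); rewrite -xi -xj.
  + apply: cover => // x xr.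
    have [|i ix] := @grid_floor_lattice R n N (N ^ 2) x N20.
      move=> j; apply: (le_trans (coord_le_enorm _ _)).
      apply: (le_trans xr); apply: le_trans rN.
      apply: (@le_trans _ _ (1 * (1 + r + n%:R))).
        by rewrite mul1r -addrA addrC addrAC -addrA lerDl.
      have r0 : 0 <= r by apply: le_trans xr; exact: enorm_ge0.
      rewrite ler_wpM2r ?addr_ge0//.
      by rewrite -[leLHS](@expR0 R) ler_expR mulr_ge0 ?addr_ge0// ltW.
    by exists i; apply/lattice_cell.
  + exact: mflow.
- move=> l t tN ltT A mA.
  have lT : l%:R / N%:R <= T.
    by apply: le_trans ltT; rewrite lerDl; case/andP: tN.
  pose I : finType := (lattice n N (N ^ 2) * lattice n N N)%type.
  (* Starting points are sorted by position at time l/N and by rounded velocity. The position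
     determines the velocity, so [Q k] is empty for every other velocity, where the LAS also has
     zero mass. *)
  pose Q (k : I) : set (borel E) := [set x |
    euler v N l (grid_floor (N ^ 2) x) = lattice_point R k.1 /\
    grid_floor N (v (lattice_point R k.1)) = lattice_point R k.2].
  have mQ k : measurable (Q k).
    pose S : set E := [set x | x = lattice_point R k.1 /\
      grid_floor N (v (lattice_point R k.1)) = lattice_point R k.2].
    have mS : measurable (S : set (borel E)).
      rewrite /S; have [kk|kk] := pselect
          (grid_floor N (v (lattice_point R k.1)) = lattice_point R k.2).
        rewrite (_ : mkset _ = [set lattice_point R k.1]).
          apply: closed_borel; apply: accessible_closed_set1.
          by apply: hausdorff_accessible; exact: norm_hausdorff.
        by apply/seteqP; split=> x /=; [case|].
      by rewrite (_ : mkset _ = set0)//; apply/seteqP; split=> x // [].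
    have := mflow (l%:R / N%:R) S mS; congr measurable; apply/seteqP; split=> x;
      by rewrite /Q /S /= flow0.
  rewrite mpushE (probability_finite_partition (Q := Q) mQ).
  + rewrite pair_big/=; apply: eq_bigr => -[i j] _ /=.
    rewrite (@indicator_dirac _ _ _ (lattice_point R i + t *: lattice_point R j))//.
      congr (_ * _)%E.
      suff -> : Q (i, j) = lattice_flow N (l%:R / N%:R) @^-1`
          [set x | x = lattice_point R i /\ cell N (lattice_point R j) (v x)] by [].
      apply/seteqP; split=> x.
        move=> [/= yi ij]; rewrite flow0 yi; split => //.
        by apply/(lattice_cell _ _ N0).
      move=> [/=]; rewrite flow0 => yi ij; split => //=.
      by rewrite -yi; apply/(lattice_cell _ _ N0).
    move=> y [/= yi ij].
    by rewrite /lattice_flow euler_curveE// yi /grid_velocity ij.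
  + move=> [i j] [i' j'] x [/= xi ij] [/= xi' ij'].
    have ii : i = i'.
      by apply: (@lattice_point_inj R n N (N ^ 2) N20); rewrite -xi -xi'.
    rewrite -ii in ij' *; congr pair.
    by apply: (@lattice_point_inj R n N N N0); rewrite -ij -ij'.
  + apply: cover => // x xr.
    have [[i iE] [j jE]] := grid_flow_lattice N0 CN rN lT xr.
    by exists (i, j); split; rewrite /= iE// jE.
  + exact: mflow.
Qed.

Lemma is_LAS_unique (mu0 : Prob R E) (N : nat) (mu mu' : R -> Prob R E) :
  is_LAS (pvf_of_field lv) T mu0 N mu -> is_LAS (pvf_of_field lv) T mu0 N mu' ->
  forall t, 0 <= t <= T -> same_measure (mu t) (mu' t).
Proof.
move=> [N0 mu_0 mu_l] [_ mu'_0 mu'_l].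
have Np : 0 < (N%:R : R) by rewrite ltr0n.
pose V : PVF R n := pvf_of_field lv.
have step l t : 0 <= t <= N%:R^-1 -> l%:R / N%:R + t <= T ->
    same_measure (mu (l%:R / N%:R)) (mu' (l%:R / N%:R)) ->
    same_measure (mu (l%:R / N%:R + t)) (mu' (l%:R / N%:R + t)).
  move=> tN ltT same A mA; rewrite mu_l// mu'_l//.
  apply: eq_bigr => i _; apply: eq_bigr => j _; congr (_ * _)%E.
  apply: (pvf_ext V same).
  (* [pvf_ext] compares measures on Borel sets only; the set at hand is a rectangle of Borel
     sets. *)
  rewrite (_ : mkset _ = [set lattice_point R i] `*` cell N (lattice_point R j))//.
  apply: measurable_setX_borel; last exact: cell_measurable.
  apply: closed_borel; apply: accessible_closed_set1.
  by apply: hausdorff_accessible; exact: norm_hausdorff.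
have grid l : l%:R / N%:R <= T -> same_measure (mu (l%:R / N%:R)) (mu' (l%:R / N%:R)).
  elim: l => [_|l IH lT].
    by rewrite mul0r => A mA; rewrite mu_0// mu'_0.
  have lE : l.+1%:R / N%:R = l%:R / N%:R + N%:R^-1 :> R by rewrite -natr1 mulrDl mul1r.
  rewrite lE in lT *; apply: step => //.
    by rewrite lexx invr_ge0 ltW.
  by apply: IH; apply: le_trans lT; rewrite lerDl invr_ge0 ltW.
move=> t tT; have [l [s sN [tE lT]]] := time_step N0 tT.
rewrite tE; apply: step => //; last exact: grid.
by rewrite -tE; case/andP: tT.
Qed.

End lattice_approximations.

(** * Supports and limits for W *)

Section supports.
Context (R : realType) (n : nat).
Local Notation E := 'rV[R]_n.
Local Notation TE := (E * E)%type.

Lemma supp_sub_closed (X : ptopologicalType) (mu : Prob R X) (F : set X) :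
  closed F -> mu (~` F) = 0%E -> supp mu `<=` F.
Proof.
move=> cF F0 x xs; apply: contrapT => Fx.
have := xs (~` F); rewrite F0 ltxx => H.
by have : false by apply: H; split => //; rewrite openC.
Qed.

Lemma cprob_radius (mu : cprob R E) : exists2 r : R, 0 < r & supp mu `<=` eball 0 r.
Proof.
have [M [Mr MP]] := compact_bounded (@cprob_compact _ _ mu).
exists (n%:R * (Num.max M 0 + 1) + 1).
  by rewrite ltr_wpDl// mulr_ge0// addr_ge0// le_max lexx orbT.
move=> x xs; rewrite eballP ltr_pwDr//.
apply: (le_trans (enorm_le_norm x)); rewrite ler_wpM2l//; apply: MP => //.
by rewrite ltr_pwDr// le_max lexx.
Qed.

Lemma closed_ball_null (mu : Prob R E) (r : R) : supp mu `<=` eball 0 r ->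
  mu (~` [set x : E | enorm x <= r]) = 0%E.
Proof.
move=> /supp_eball_null; apply: subset_measure0.
- by apply: measurableC; apply: closed_borel; exact: enorm_closed.
- by apply: measurableC; apply: open_borel; exact: enorm_open.
- by apply: subsetC => x /= /ltW.
Qed.

Lemma pvf_of_field_sublinear (v : E -> E) (lv : locally_lipschitz v) (C : R) :
  0 < C -> (forall x, enorm (v x) <= C * (1 + enorm x)) ->
  pvf_sublinear (pvf_of_field lv) C.
Proof.
move=> C0 vC mu; apply: ge_ereal_sup => _ [p ps <-].
have cv := locally_lipschitz_continuous lv.
(* The graph of [v] over the support of [mu], written as a closed condition. It carries the whole
   mass, so it contains the support of the lift. *)
pose F := [set p : TE | supp mu p.1 /\ enorm (p.2 - v p.1) <= 0].
have cF : closed F.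
  apply: closedI.
    apply: (preimage_closed (f := fst : TE -> E)); last exact: supp_closed.
    by move=> q _; exact: cvg_fst.
  apply: (preimage_closed (f := fun q : TE => enorm (q.2 - v q.1))) (@closed_le R 0) => q _.
  apply: (@continuous_comp _ _ _ (fun q : TE => q.2 - v q.1) (@enorm R n)).
    apply: (@cvgB _ _ _ (nbhs q)); first exact: cvg_snd.
    by apply: (@continuous_comp _ _ _ fst v); [exact: cvg_fst|exact: cv].
  exact: continuous_enorm.
have F0 : pvf_of_field lv mu (~` F) = 0%E.
  rewrite /= /graph_measure pushE (_ : _ @^-1` _ = ~` supp mu); first exact: supp_null.
  apply/seteqP; split=> x /=; last by move=> h [].
  by move=> h xs; apply: h; split => //=; rewrite subrr enorm0.
have [p1 p2] := supp_sub_closed cF F0 ps.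
have -> : p.2 = v p.1.
  apply/eqP; rewrite -subr_eq0; apply/eqP/enorm_eq0/eqP.
  by rewrite eq_le enorm_ge0 p2.
apply: (@le_trans _ _ (C%:E * (1 + (enorm p.1)%:E))%E).
  by rewrite -EFinD -EFinM lee_fin.
apply: lee_wpmul2l; first by rewrite lee_fin ltW.
by apply: leeD => //; apply: ereal_sup_ubound; exists p.1.
Qed.

(** Markov's inequality, used once for each approximation, bounds the mass of a closed [F] by that
    of a thickening up to [2 * e]. Letting [e] and then the thickness tend to 0 gives one
    inequality, and the hypothesis is symmetric. *)
Lemma same_measure_W_limit (mu mu' : Prob R E) :
  (forall e : R, 0 < e -> exists m m' : Prob R E,
    [/\ same_measure m m', (W mu m <= e%:E)%E & (W mu' m' <= e%:E)%E]) ->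
  same_measure mu mu'.
Proof.
move=> H; suff half (m1 m2 : Prob R E) :
    (forall e : R, 0 < e -> exists m m' : Prob R E,
      [/\ same_measure m m', (W m1 m <= e%:E)%E & (W m2 m' <= e%:E)%E]) ->
    forall F : set E, closed F -> (m1 F <= m2 F)%E.
  apply: same_measure_closed => F cF; apply/eqP; rewrite eq_le.
  apply/andP; split.
    exact: (half mu mu').
  apply: (half mu' mu) => // e e0; have [m [m' [mm h1 h2]]] := H e e0.
  by exists m', m; split => // A mA; rewrite mm.
clear; move=> {}H F cF.
have key (d e : R) : 0 < d -> 0 < e -> (m1 F <= m2 (thickening F (2 * d)) + (2 * e)%:E)%E.
  (* Half of [d * e], because [W_lt_thickening] asks for a strict inequality. *)
  move=> d0 e0; have [|m [m' [mm W1 W2]]] := H (d * e / 2).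
    by rewrite divr_gt0// mulr_gt0.
  have lt : ((d * e / 2)%:E < (d * e)%:E)%E.
    by rewrite lte_fin ltr_pdivrMr// ltr_pMr ?mulr_gt0// ltr1n.
  have mF : measurable (F : set (borel E)) by exact: closed_borel.
  have mT : measurable (thickening F d : set (borel E)).
    by apply: open_borel; exact: thickening_open.
  have mTT : measurable (thickening (thickening F d) d : set (borel E)).
    by apply: open_borel; exact: thickening_open.
  have mT2 : measurable (thickening F (2 * d) : set (borel E)).
    by apply: open_borel; exact: thickening_open.
  have h1 := W_lt_thickening mF d0 (le_lt_trans W1 lt).
  have h2 := W_lt_thickening mT d0 (le_lt_trans (le_trans (W_sym _ _) W2) lt).
  have h3 : (m2 (thickening (thickening F d) d) <= m2 (thickening F (2 * d)))%E.
    by apply: le_measure; rewrite ?inE//; exact: thickening_thickening.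
  apply: (le_trans h1); rewrite (mm _ mT).
  apply: (le_trans (leeD2r _ h2)); rewrite -addeA -EFinD.
  apply: leeD => //; rewrite lee_fin; lra.
have key2 d : 0 < d -> (m1 F <= m2 (thickening F (2 * d)))%E.
  move=> d0; apply/lee_addgt0Pr => e e0.
  have e20 : 0 < e / 2 by rewrite divr_gt0.
  by have := key d _ d0 e20; rewrite [2 * (e / 2)]mulrC divfK.
have := thickening_cvg (mu := m2) cF => h.
apply: (cvge_to_ge h).
apply: nearW => k; have : 0 < (k.+1%:R^-1 : R) / 2 by rewrite divr_gt0// invr_gt0.
by move=> /key2; rewrite mulrC divfK.
Qed.

End supports.

(** * Effect of a push-forward on W and on supports *)

Section flow_of_measures.
Context (R : realType) (n : nat).
Local Notation E := 'rV[R]_n.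

Lemma W_ge0 (mu nu : Prob R E) : (0 <= W mu nu)%E.
Proof.
apply: le_ereal_inf_tmp => _ [tau _ <-]; apply: integral_ge0 => p _.
by rewrite lee_fin enorm_ge0.
Qed.

Lemma W_push_lipschitz (f : E -> E) (cf : continuous f) (K r : R)
    (mu nu : Prob R E) :
  0 < K -> mu (~` [set x : E | enorm x <= r]) = 0%E ->
  nu (~` [set x : E | enorm x <= r]) = 0%E ->
  (forall x y, enorm x <= r -> enorm y <= r ->
    enorm (f x - f y) <= K * enorm (x - y)) ->
  (W (push cf mu) (push cf nu) <= K%:E * W mu nu)%E.
Proof.
move=> K0 mur nur fK; rewrite -lee_pdivrMl//.
apply: le_ereal_inf_tmp => _ [tau ctau <-]; rewrite lee_pdivrMl//.
have mff := measurable_fun_pair_borel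
  (measurableT_comp (continuous_borel cf) (@measurable_fst_borel R n))
  (measurableT_comp (continuous_borel cf) (@measurable_snd_borel R n)).
have [c1 c2] := ctau.
have mB : measurable ([set x : E | enorm x <= r] : set (borel E)).
  by apply: closed_borel; exact: enorm_closed.
have mf (A : set (borel E)) : measurable A -> measurable (f @^-1` A : set (borel E)).
  by move=> mA; rewrite -[X in measurable X]setTI; exact: continuous_borel.
apply: (@le_trans _ _ (cost (mpush tau mff))).
  apply: ereal_inf_lbound; exists (mpush tau mff) => //.
  by split=> [A mA|A mA]; [exact: (c1 _ (mf _ mA))|exact: (c2 _ (mf _ mA))].
rewrite /cost ge0_integral_mpush; first last.
- by move=> p; rewrite lee_fin enorm_ge0.
- exact: measurable_dist.
rewrite -ge0_integralZl//; last 3 first.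
- exact: measurable_dist.
- by move=> p _; rewrite lee_fin enorm_ge0.
- by rewrite lee_fin ltW.
apply: ae_ge0_le_integral => //.
- by move=> p _; rewrite lee_fin enorm_ge0.
- exact: (measurableT_comp (@measurable_dist R n) mff).
- by move=> p _; rewrite mule_ge0// lee_fin ?enorm_ge0// ltW.
- by apply: measurable_funeM; exact: measurable_dist.
- exists (~` ([set x | enorm x <= r] `*` [set x | enorm x <= r])); split.
  + by apply: measurableC; exact: measurable_setX_borel.
  + exact: (coupling_null ctau mB mB mur nur).
  + by move=> p /= + [p1 p2]; apply => _; rewrite -EFinM lee_fin; exact: fK.
Qed.

Lemma supp_push (f : E -> E) (cf : continuous f) (r rho : R) (mu : Prob R E) :
  mu (~` [set x : E | enorm x <= r]) = 0%E ->
  (forall x, enorm x <= r -> enorm (f x) <= rho) ->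
  supp (push cf mu) `<=` [set x : E | enorm x <= rho].
Proof.
move=> mur frho; apply: supp_sub_closed; first exact: enorm_closed.
rewrite pushE; apply: (subset_measure0 _ _ _ mur).
- rewrite -[X in measurable X]setTI; apply: continuous_borel => //.
  by apply: measurableC; apply: closed_borel; exact: enorm_closed.
- by apply: measurableC; apply: closed_borel; exact: enorm_closed.
- by move=> x /= h xr; apply: h; exact: frho.
Qed.

Lemma supp_push_compact (f : E -> E) (cf : continuous f) (mu : cprob R E) :
  compact (supp (push cf mu)).
Proof.
have [r r0 mur] := cprob_radius mu.
have [M M0 fM] := continuous_ball_bound r (continuous_compose cf (@continuous_enorm R n)).
apply: (subclosed_compact (@supp_closed _ _ _) (enorm_compact (r := M))).
apply: (supp_push (closed_ball_null mur)) => x xr.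
exact: le_trans (ler_norm _) (fM x xr).
Qed.

End flow_of_measures.

Theorem theorem6p1 (R : realType) (n : nat) (v : 'rV[R]_n -> 'rV[R]_n)
    (v_lip : locally_lipschitz v) (C : R) (C_gt0 : 0 < C)
    (v_growth : forall x, enorm (v x) <= C * (1 + enorm x)) :
  locally_W_lipschitz (pvf_of_field v_lip) /\
  forall T : R, 0 < T ->
    exists S : R -> cprob R 'rV[R]_n -> cprob R 'rV[R]_n,
      [/\ lipschitz_semigroup (pvf_of_field v_lip) C T S,
          limit_of_LAS (pvf_of_field v_lip) T S &
          forall S' : R -> cprob R 'rV[R]_n -> cprob R 'rV[R]_n,
            lipschitz_semigroup (pvf_of_field v_lip) C T S' ->
            limit_of_LAS (pvf_of_field v_lip) T S' ->
            forall t mu, 0 <= t <= T -> same_measure (S' t mu) (S t mu)].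
Proof.
split; first exact: pvf_of_field_W_lipschitz.
move=> T T0.
have [Phi [Phi0 sPhi Phi_clamp]] := flow_exists v_lip C_gt0 v_growth T0.
have cPhi := flow_continuous v_lip C_gt0 v_growth T0 Phi0 sPhi Phi_clamp.
pose S t (mu : cprob R 'rV[R]_n) : cprob R 'rV[R]_n :=
  CProb (@supp_push_compact _ _ _ (@cPhi t) mu).
have T0' := ltW T0.
have SLAS (mu : cprob R 'rV[R]_n) : exists2 N0 : nat, (0 < N0)%N & exists2 K : R, 0 <= K &
    forall N, (N0 <= N)%N -> exists2 m : R -> Prob R 'rV[R]_n,
      is_LAS (pvf_of_field v_lip) T mu N m &
      forall t, 0 <= t <= T -> (W (S t mu) (m t) <= (K / N%:R)%:E)%E.
  have [r r0 mur] := cprob_radius mu; have mur0 := closed_ball_null mur.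
  pose rho := Num.max ((C + n%:R) * euler_radius n C T r) (euler_radius n C T r).
  have [K K0 PhiK] := euler_cvg v_lip C_gt0 v_growth T0 Phi0 sPhi r.
  exists (Num.truncn rho).+1 => //; exists K => // N rhoN.
  have N0 : (0 < N)%N by apply: leq_trans rhoN.
  have rN : rho <= N%:R by apply: ltW; apply: (lt_le_trans (truncnS_gt _)); rewrite ler_nat.
  exists (fun t => mpush mu (measurable_lattice_flow v t N0)).
    apply: (euler_is_LAS v_lip C_gt0 v_growth T0 N0 mur0).
      by apply: le_trans rN; rewrite le_max lexx.
    by apply: le_trans rN; rewrite le_max lexx orbT.
  move=> t tT.
  apply: (W_le_law (P := mu) (f := Phi t) (g := lattice_flow v N t)
    (mf := continuous_borel (@cPhi t)) (mg := measurable_lattice_flow v t N0)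
    (N := [set x | enorm x <= r])) => //.
  - by apply: closed_borel; exact: enorm_closed.
  - by rewrite divr_ge0.
  - by move=> x xr; exact: PhiK.
have S_LAS : limit_of_LAS (pvf_of_field v_lip) T S.
  move=> mu; have [N0 N0p [K K0 HN]] := SLAS mu.
  have H k : exists m : R -> Prob R 'rV[R]_n,
      is_LAS (pvf_of_field v_lip) T mu (k + N0) m /\
      forall t, 0 <= t <= T -> (W (S t mu) (m t) <= (K / (k + N0)%:R)%:E)%E.
    by have [m h1 h2] := HN (k + N0)%N (leq_addl _ _); exists m.
  have [m mP] := choice H.
  (* The shift by [N0] skips the values of [N] for which the scheme is not known to stay in the
     grids. *)
  exists (fun k => (k + N0)%N), m; split.
  - by move=> i j ij; rewrite ltn_add2r.
  - by move=> k; have [] := mP k.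
  - move=> e e0; exists (Num.truncn (K / e)).+1 => //= k ke t tT.
    have [_ /(_ t tT) h] := mP k; apply: (le_trans h); rewrite lee_fin.
    have kp : 0 < ((k + N0)%:R : R) by rewrite ltr0n addn_gt0 N0p orbT.
    rewrite ler_pdivrMr// mulrC -ler_pdivrMr//; apply: ltW.
    by apply: (lt_le_trans (truncnS_gt _)); rewrite ler_nat (leq_trans ke)// leq_addr.
exists S; split => //.
  split.
  - exact: pvf_of_field_sublinear.
  - move=> mu A mA; rewrite /= pushE (_ : Phi 0 @^-1` A = A)//.
    by apply/seteqP; split=> x /=; rewrite Phi0.
  - move=> mu t s tT sT tsT A mA; rewrite [LHS]pushE [LHS]pushE [RHS]pushE.
    congr ((mu : Prob R _) _).
    apply/seteqP; split=> x /=;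
      by rewrite (flow_semigroup v_lip C_gt0 v_growth Phi0 sPhi x tT sT tsT).
  - move=> mu; have [r r0 mur] := cprob_radius mu; have mur0 := closed_ball_null mur.
    exact: (flow_is_solution v_lip C_gt0 v_growth T0 Phi0 sPhi Phi_clamp cPhi mur0).
  - move=> r r0.
    have [L L0 PhiL] := flow_dist v_lip C_gt0 v_growth Phi0 sPhi r.
    pose M := n%:R * (C * flow_radius C T r).
    have M0 : 0 <= M.
      by rewrite mulr_ge0// mulr_ge0 ?(ltW C_gt0)// mulr_ge0 ?expR_ge0// addr_ge0// ltW.
    (* [L] is the exponential rate in space and [M] the Lipschitz constant in time; their sum serves
       for both bounds. *)
    exists (L + M) => [|mu nu mur nur t s tT sT]; first by rewrite ltr_pwDl.
    have mur0 := closed_ball_null mur; have nur0 := closed_ball_null nur.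
    have t0 : 0 <= t by case/andP: tT.
    split.
    (* The growth estimate concerns [1 + enorm], so the closed ball obtained has radius smaller by 1
       and fits in the required open ball. *)
    + move=> y /(supp_push (cf := @cPhi t) (rho := expR (C * t) * (r + 1) - 1) mur0) /= h.
      rewrite eballP; apply: (@le_lt_trans _ _ (expR (C * t) * (r + 1) - 1)).
        apply: h => x xr; rewrite lerBrDl.
        apply: (le_trans (flow_growth C_gt0 v_growth Phi0 sPhi x tT)).
        by rewrite ler_wpM2l ?expR_ge0// addrC lerD2r.
      by rewrite ltrBlDr ltrDl.
    + apply: (@le_trans _ _ ((expR (L * t))%:E * W mu nu)%E).
        apply: (W_push_lipschitz (@cPhi t) (expR_gt0 _) mur0 nur0).
        by move=> x y xr yr; exact: PhiL.
      apply: lee_wpmul2r; first exact: W_ge0.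
      by rewrite lee_fin ler_expR ler_wpM2r// lerDl.
    + apply: (W_le_law (P := mu) (f := Phi t) (g := Phi s)
        (mf := continuous_borel (@cPhi t)) (mg := continuous_borel (@cPhi s))
        (N := [set x | enorm x <= r])) => //.
      * by apply: closed_borel; exact: enorm_closed.
      * by rewrite mulr_ge0// addr_ge0// ltW.
      * move=> x xr; have := flow_time C_gt0 v_growth Phi0 sPhi xr sT tT.
        move=> /le_trans; apply; rewrite mulrA ler_wpM2r//.
        by rewrite lerDr ltW.
move=> S' _ S'_LAS t mu tT.
have [N0 N0p [K K0 HN]] := SLAS mu.
have [phi [m [phi_mono m_LAS m_cvg]]] := S'_LAS mu.
apply: same_measure_W_limit => e e0.
(* A large [k] thus puts [phi k] beyond [N0] and makes [K / phi k] at most [e], so that the Euler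
   LAS of the same index is also within [e] of the flow. *)
have phi_ge k : (k <= phi k)%N.
  by elim: k => // k IH; apply: (leq_ltn_trans IH); exact: phi_mono.
have [k1 _ Hk1] := m_cvg e e0.
pose k := maxn k1 (maxn N0 (Num.truncn (K / e)).+1).
have [m' m'_LAS m'W] := HN (phi k) (leq_trans (leq_trans (leq_maxl N0 _) (leq_maxr k1 _)) (phi_ge k)).
exists (m k t), (m' t); split.
- exact: (is_LAS_unique (m_LAS k) m'_LAS).
- by apply: Hk1 => //=; exact: leq_maxl.
- apply: (le_trans (m'W t tT)); rewrite lee_fin.
  have Kk : ((Num.truncn (K / e)).+1 <= phi k)%N.
    exact: leq_trans (leq_trans (leq_maxr N0 _) (leq_maxr k1 _)) (phi_ge k).
  have kp : 0 < ((phi k)%:R : R) by rewrite ltr0n (leq_trans _ Kk).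
  rewrite ler_pdivrMr// mulrC -ler_pdivrMr//; apply: ltW.
  by apply: (lt_le_trans (truncnS_gt _)); rewrite ler_nat.
Qed.
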